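(* Let $m\in\mathbb{N}$ and $d\in\mathbb{N}$, and let $n\in\mathbb{N}$. (i) If $n\ge27^d$, then $$a_n(I_d:H^{m}_{\rm mix}(\mathbb{T}^d)\to L_2(\mathbb{T}^d))\le\Big[\frac{6^d}{(d-1)!}\Big]^m2^{-d/2}\,\frac{(\ln n)^{(d-1)m}}{n^m}.$$ (ii) If $n>(12\,e^2)^d$, then $$a_n(I_d:H^{m}_{\rm mix}(\mathbb{T}^d)\to L_2(\mathbb{T}^d))\ge\Big[\frac{3\cdot2^d}{d!\,(2+\ln12)^d}\Big]^m\frac{(\ln n)^{(d-1)m}}{n^m}.$$
   Context: $\mathbb{N}=\{1,2,3,\dots\}$. $\mathbb{T}^d$ is the $d$-torus, represented by $[0,2\pi]^d$ with opposite sides identified. $L_2(\mathbb{T}^d)$ carries the norm $\|f|L_2(\mathbb{T}^d)\|=(\int_{\mathbb{T}^d}|f(x)|^2dx)^{1/2}$. For $m\in\mathbb{N}$, $H^m_{\rm mix}(\mathbb{T}^d)$ is the space of all $f\in L_2(\mathbb{T}^d)$ such that all distributional derivatives $D^\alpha f$ with $\alpha\in\mathbb{N}_0^d$, $|\alpha|_\infty=\max_j\alpha_j\le m$, belong to $L_2(\mathbb{T}^d)$, equipped with the norm $$\|f|H^m_{\rm mix}(\mathbb{T}^d)\|=\Big(\sum_{|\alpha|_\infty\le m}\|D^\alpha f|L_2(\mathbb{T}^d)\|^2\Big)^{1/2}.$$ Equivalently, $\|f|H^m_{\rm mix}(\mathbb{T}^d)\|^2=\sum_{k\in\mathbb{Z}^d}|c_k(f)|^2\prod_{j=1}^d\sum_{\alpha=0}^m|k_j|^{2\alpha}$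 (with $0^0=1$), where $c_k(f)=(2\pi)^{-d/2}\int_{\mathbb{T}^d}f(x)e^{-ikx}dx$. $I_d$ denotes the identical embedding $f\mapsto f$. The approximation numbers of a bounded linear operator $T:X\to Y$ between Banach spaces are $a_n(T:X\to Y)=\inf\{\|T-A:X\to Y\| : A:X\to Y \text{ bounded linear},\ {\rm rank}\,A<n\}$, $n\in\mathbb{N}$. *)

(* Defs.v *)
From HB Require Import structures.
From mathcomp Require Import all_boot all_order all_algebra.
From mathcomp Require Import all_classical all_reals all_analysis.
From mathcomp Require Import complex.

Set Implicit Arguments.
Unset Strict Implicit.
Unset Printing Implicit Defensive.

Import Order.TTheory GRing.Theory Num.Theory.
Import numFieldNormedType.Exports.

Local Open Scope classical_set_scope.
Local Open Scope ring_scope.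
Local Open Scope complex_scope.

Section ApproximationNumbers.
Context {R : realType} {V W : lmodType R[i]}.

(* A normed space is given as a subset X of an ambient vector space together
   with a seminorm pX on X; the normed space meant is the quotient of X by the
   null vectors of pX.  Accordingly an operator is a map on representatives,
   and equality in the target is equality up to a vector of seminorm 0. *)
Variables (X : set V) (pX : V -> R) (Y : set W) (pY : W -> R).

(* Boundedness and linearity up to null vectors make A compatible with the
   passage to the quotients. *)
Definition bounded_linear_operator (A : V -> W) : Prop :=
  [/\ forall f, X f -> Y (A f),
      forall (a : R[i]) f g, X f -> X g ->
        pY (A (a *: f + g) - (a *: A f + A g)) = 0 &
      exists2 c : R, 0 <= c & forall f, X f -> pY (A f) <= c * pX f].

Definition rank_lt (A : V -> W) (n : nat) : Prop :=
  exists2 r : nat, (r < n)%N &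
    exists2 e : 'I_r -> W, (forall i, Y (e i)) &
      forall f, X f -> exists c : 'I_r -> R[i],
        pY (A f - \sum_(i < r) c i *: e i) = 0.

Definition operator_norm (T : V -> W) : \bar R :=
  ereal_sup [set (pY (T f))%:E | f in [set f | X f /\ pX f <= 1]].

Definition approximation_number (T : V -> W) (n : nat) : \bar R :=
  ereal_inf [set operator_norm (fun f => T f - A f) |
             A in [set A | bounded_linear_operator A /\ rank_lt A n]].

End ApproximationNumbers.

Section TorusMeasure.
Variable R : realType.

Local Notation RM := (measurableTypeR R).
Local Notation period := (`[0%R, (2 * pi)%R]%classic : set R).

Let measurable_period : measurable (period : set RM).
Proof. exact: measurable_itv. Qed.

Let lebesgue_period_lty : (lebesgue_measure (period : set RM) < +oo)%E.
Proof. by rewrite lebesgue_measure_itv/=; case: ifP => // _; rewrite ltry. Qed.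

Definition circle_measure : {finite_measure set RM -> \bar R} :=
  mfrestr measurable_period lebesgue_period_lty.

Definition cons_pair n (p : RM * n.-tuple RM) : n.+1.-tuple RM :=
  [the n.+1.-tuple RM of p.1 :: p.2].

Let measurable_cons_pair n :
  measurable_fun [set: RM * n.-tuple RM] (@cons_pair n).
Proof. exact: (@measurable_cons _ _ _ RM). Qed.

Section circle_product.
Variables (n : nat) (mu : {finite_measure set (n.-tuple RM) -> \bar R}).

Definition circle_product : set (n.+1.-tuple RM) -> \bar R :=
  pushforward (circle_measure \x mu)%E (@cons_pair n).

Let mcons := @measurable_cons_pair n.

Let circle_product0 : circle_product set0 = 0%E.
Proof. by rewrite /circle_product /pushforward preimage_set0 measure0. Qed.

Let circle_product_ge0 A : (0 <= circle_product A)%E.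
Proof. exact: measure_ge0. Qed.

Let circle_product_sigma_additive : semi_sigma_additive circle_product.
Proof. exact: measure_semi_sigma_additive. Qed.

HB.instance Definition _ := isMeasure.Build _ _ _ circle_product
  circle_product0 circle_product_ge0 circle_product_sigma_additive.

Let circle_product_fin : fin_num_fun circle_product.
Proof.
apply: lty_fin_num_fun => /=; rewrite /circle_product /pushforward.
rewrite preimage_setT -setXTT product_measure1E//.
by rewrite lte_mul_pinfty// ?fin_num_measure// -ge0_fin_numE// fin_num_measure.
Qed.

HB.instance Definition _ :=
  Measure_isFinite.Build _ _ _ circle_product circle_product_fin.

End circle_product.

(* Lebesgue measure on [0, 2 pi]^d, viewed as a measure on R^d carried by this
   cube; it identifies the d-torus with the cube up to a null set. *)
Fixpoint torus_measure (d : nat) :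
    {finite_measure set (d.-tuple RM) -> \bar R} :=
  if d is n.+1 then circle_product (torus_measure n) else \d_([tuple]).

End TorusMeasure.

Section TorusFunctions.
Context {R : realType} (d : nat).

Local Notation C := R[i].
Local Notation point := (d.-tuple (measurableTypeR R)).
Local Notation mu := (torus_measure R d).

Definition complex_integral (F : point -> C) : C :=
  (\int[mu]_x complex.Re (F x)) +i* (\int[mu]_x complex.Im (F x)).

Definition L2 : set (point -> C) :=
  [set f : point -> C | [/\ measurable_fun setT (fun x => complex.Re (f x) : R),
               measurable_fun setT (fun x => complex.Im (f x) : R) &
               (\int[mu]_x ((Normc.normc (f x)) ^+ 2)%:E < +oo)%E]].

Definition L2norm (f : point -> C) : R :=
  Num.sqrt (\int[mu]_x (Normc.normc (f x)) ^+ 2).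

Definition iterated_partial (s : seq 'I_d) (phi : 'rV[R]_d -> R) :
    'rV[R]_d -> R :=
  foldr (fun j psi x => 'D_('e_j) psi x) phi s.

Definition smooth (phi : 'rV[R]_d -> R) : Prop :=
  forall s : seq 'I_d, continuous (iterated_partial s phi) /\
    forall (j : 'I_d) x, derivable (iterated_partial s phi) x 'e_j.

(* C^oo functions on the torus, i.e. smooth functions on R^d that are
   2 pi-periodic in each variable. *)
Definition torus_test_function (phi : 'rV[R]_d -> C) : Prop :=
  [/\ smooth (fun x => complex.Re (phi x)), smooth (fun x => complex.Im (phi x)) &
      forall (j : 'I_d) x, phi (x + (2 * pi) *: 'e_j) = phi x].

Definition multi_index_seq (alpha : 'I_d -> nat) : seq 'I_d :=
  flatten [seq nseq (alpha j) j | j <- enum 'I_d].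

Definition classical_derivative (alpha : 'I_d -> nat) (phi : 'rV[R]_d -> C)
    (x : 'rV[R]_d) : C :=
  iterated_partial (multi_index_seq alpha) (fun y => complex.Re (phi y)) x +i*
  iterated_partial (multi_index_seq alpha) (fun y => complex.Im (phi y)) x.

Definition row_of_point (x : point) : 'rV[R]_d := \row_j tnth x j.

(* g represents the distribution D^alpha f on the torus. *)
Definition distributional_derivative (alpha : 'I_d -> nat)
    (f g : point -> C) : Prop :=
  forall phi, torus_test_function phi ->
    complex_integral
      (fun x => f x * classical_derivative alpha phi (row_of_point x)) =
    (-1) ^+ (\sum_j alpha j) *
      complex_integral (fun x => g x * phi (row_of_point x)).

(* D^alpha f as a function, when this distribution belongs to L_2; the choice
   is unique up to a null set. *)
Definition L2_derivative (alpha : 'I_d -> nat) (f : point -> C) : point -> C :=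
  xget (fun=> 0) [set g | L2 g /\ distributional_derivative alpha f g].

Definition Hmix (m : nat) : set (point -> C) :=
  [set f : point -> C | L2 f /\
     forall alpha : 'I_d -> nat, (forall j, (alpha j <= m)%N) ->
       exists2 g, L2 g & distributional_derivative alpha f g].

Definition Hmix_norm (m : nat) (f : point -> C) : R :=
  Num.sqrt (\sum_(alpha : {ffun 'I_d -> 'I_m.+1})
              L2norm (L2_derivative (fun j => alpha j) f) ^+ 2).

(* a_n(I_d : H^m_mix(T^d) -> L_2(T^d)) *)
Definition approximation_number_embedding (m n : nat) : \bar R :=
  approximation_number (Hmix m) (Hmix_norm m) L2 L2norm
    (fun f : point -> C => f) n.

End TorusFunctions.

(* Main.v *)
(* The monomials e_k(x) = exp(i k.x) diagonalise the embedding: by Parseval's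
   identity on the torus, ||f||_L2 and ||f||_Hmix are, up to the common factor
   (2 pi)^(d/2), the weighted l2 norms of the Fourier coefficients c_k(f) with
   weights 1 and w_k, where w_k^2 = prod_j sum_(a <= m) k_j^(2a).  Projecting
   onto the frequencies in the hyperbolic cross prod_j (1 + |k_j|) <= N bounds
   a_n from above; conversely an operator of rank < n vanishes, up to a null
   function, at some nonzero combination of n monomials, which bounds a_n from
   below.  Since
     2^(d/2) 2^(-dm) prod_j (1 + |k_j|)^m <= w_k <= prod_j (1 + |k_j|)^m,
   it remains to count the points of the hyperbolic cross, by induction on d
   with a telescoping comparison of sums with powers of the logarithm.
   Parseval's identity is obtained on the circle by convolving with the kernel
   ((1 + cos t) / 2)^n, and on the torus by induction on d with Fubini. *)
Require Import Defs.
From mathcomp Require Import all_boot all_order all_algebra.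
From mathcomp Require Import all_classical all_reals all_analysis.
From mathcomp Require Import measurable_realfun complex zify ring lra.

Set Implicit Arguments.
Unset Strict Implicit.
Unset Printing Implicit Defensive.

Import Order.TTheory GRing.Theory Num.Theory.
Import numFieldNormedType.Exports.

Local Open Scope classical_set_scope.
Local Open Scope ring_scope.
Local Open Scope complex_scope.

(** * Complex-valued square-integrable functions *)

(** [L2_derivative] is fixed only by choice and the seminorms ignore null functions, so all
    information is drawn from the coefficients [ip f (chard k)]. Testing against conjugate
    characters gives |c_k(D^alpha f)| = |k^alpha| |c_k(f)|; Bessel's inequality then bounds norms
    from below, and Parseval is used in the form that a common bound on all finite sums of squared
    coefficients bounds the norm. Constants: splitting the cross by the number l of nonzero
    coordinates produces the sum of C(d,l) 2^l, which is 3^d; with the factor 2^d of the weight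
    comparison this makes 6^d. The condition n >= 27^d gives L = ln n >= d, so that L^l / l! is
    largest at l = d - 1. In the lower count, the induction step on d drops the slice k = 0 and
    starts the telescoping sum at 2, which costs ln 2 inside the logarithm. The condition n > (12
    e^2)^d says ln n > d (2 + ln 12), and it keeps this reduced logarithm above ln n / (2 + ln
    12). *)

Local Notation Rec := complex.Re.
Local Notation Imc := complex.Im.

Section ComplexFacts.
Context {R : realType}.
Implicit Types z w : R[i].

(** The squared modulus as a polynomial in the real and imaginary parts, so that facts about it fall
    to [ring] and [lra]. *)
Definition sqn z : R := Rec z ^+ 2 + Imc z ^+ 2.

Lemma ReD z w : Rec (z + w) = Rec z + Rec w. Proof. by case: z; case: w. Qed.
Lemma ImD z w : Imc (z + w) = Imc z + Imc w. Proof. by case: z; case: w. Qed.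
Lemma ReN z : Rec (- z) = - Rec z. Proof. by case: z. Qed.
Lemma ImN z : Imc (- z) = - Imc z. Proof. by case: z. Qed.
Lemma ReM z w : Rec (z * w) = Rec z * Rec w - Imc z * Imc w.
Proof. by case: z; case: w. Qed.
Lemma ImM z w : Imc (z * w) = Rec z * Imc w + Imc z * Rec w.
Proof. by case: z; case: w. Qed.
Lemma ReJ z : Rec (conjc z) = Rec z. Proof. by case: z. Qed.
Lemma ImJ z : Imc (conjc z) = - Imc z. Proof. by case: z. Qed.
Definition ReImE := (ReD, ImD, ReN, ImN, ReM, ImM, ReJ, ImJ).

Lemma complex_ext z w : Rec z = Rec w -> Imc z = Imc w -> z = w.
Proof. by case: z; case: w => a b c d /= -> ->. Qed.

Lemma sqr_normcE z : Normc.normc z ^+ 2 = sqn z.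
Proof. by case: z => a b; rewrite /sqn /= sqr_sqrtr// addr_ge0 ?sqr_ge0. Qed.

Lemma sqn_ge0 z : 0 <= sqn z. Proof. by rewrite addr_ge0 ?sqr_ge0. Qed.
Lemma sqnM z w : sqn (z * w) = sqn z * sqn w.
Proof. by rewrite /sqn !ReImE; ring. Qed.
Lemma sqnJ z : sqn (conjc z) = sqn z.
Proof. by rewrite /sqn !ReImE; ring. Qed.
Lemma sqnN z : sqn (- z) = sqn z.
Proof. by rewrite /sqn !ReImE; ring. Qed.
Lemma sqn0 : sqn 0 = 0. Proof. by rewrite /sqn /=; ring. Qed.
Lemma sqn1 : sqn 1 = 1. Proof. by rewrite /sqn /=; ring. Qed.
Lemma sqn_real (a : R) : sqn a%:C = a ^+ 2.
Proof. by rewrite /sqn /=; ring. Qed.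
Lemma sqnX z n : sqn (z ^+ n) = sqn z ^+ n.
Proof. by elim: n => [|n IH]; rewrite ?expr0 ?sqn1// !exprS sqnM IH. Qed.
Lemma sqn_eq0 z : sqn z = 0 -> z = 0.
Proof.
move=> h; have : (Rec z ^+ 2 == 0) && (Imc z ^+ 2 == 0).
  by rewrite -paddr_eq0 ?sqr_ge0//; apply/eqP.
by rewrite !sqrf_eq0 => /andP[/eqP h1 /eqP h2]; apply: complex_ext.
Qed.
Lemma sqn_gt0 z : z != 0 -> 0 < sqn z.
Proof. by move=> z0; rewrite lt0r sqn_ge0 andbT; apply: contraNN z0 => /eqP/sqn_eq0->. Qed.
Lemma sqnD_le z w : sqn (z + w) <= 2 * sqn z + 2 * sqn w.
Proof.
rewrite /sqn !ReImE.
have := sqr_ge0 (Rec z - Rec w); have := sqr_ge0 (Imc z - Imc w).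
by lra.
Qed.
Lemma mulJE z : z * conjc z = (sqn z)%:C.
Proof. by apply: complex_ext; rewrite !ReImE /sqn /=; ring. Qed.

Definition cis (t : R) : R[i] := cos t +i* sin t.
Lemma cisD s t : cis (s + t) = cis s * cis t.
Proof. by apply: complex_ext; rewrite !ReImE /= ?cosD ?sinD; ring. Qed.
Lemma cis0 : cis 0 = 1.
Proof. by rewrite /cis cos0 sin0. Qed.
Lemma cisN t : cis (- t) = conjc (cis t).
Proof. by rewrite /cis cosN sinN. Qed.
Lemma sqn_cis t : sqn (cis t) = 1.
Proof. by rewrite /sqn /= cos2Dsin2. Qed.
Lemma cis_int2pi (k : int) : cis (k%:~R * (2 * pi)) = 1.
Proof.
have key n : cis (n%:R * (2 * pi)) = 1.
  elim: n => [|n IH]; first by rewrite mul0r cis0.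
  rewrite -natr1 mulrDl mul1r cisD IH mul1r.
  by rewrite /cis mulr_natl cos2pi sin2pi.
case: k => n; first by rewrite -pmulrn key.
by rewrite NegzE mulrNz mulNr cisN -pmulrn key conjc1.
Qed.
Lemma cis_nat (t : R) (n : nat) : cis (n%:R * t) = cis t ^+ n.
Proof.
elim: n => [|n IH]; first by rewrite mul0r cis0 expr0.
by rewrite -natr1 mulrDl mul1r cisD IH exprSr.
Qed.

End ComplexFacts.

(** * Square-integrable functions, inner products and Bessel's inequality over a finite measure *)

Section ComplexIntegral.
Context d (T : measurableType d) (R : realType).
Variable mu : {finite_measure set T -> \bar R}.
Implicit Types (f g : T -> R[i]) (u v : T -> R).

Definition rint (u : T -> R) := mu.-integrable setT (EFin \o u).

Lemma rintD u v : rint u -> rint v -> rint (fun x => u x + v x).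
Proof. by move=> hu hv; have := integrableD measurableT hu hv. Qed.
Lemma rintZ c u : rint u -> rint (fun x => c * u x).
Proof. by move=> hu; have := integrableZl measurableT c hu. Qed.
Lemma rintN u : rint u -> rint (fun x => - u x).
Proof. by move=> hu; have := integrableN hu. Qed.
Lemma rintB u v : rint u -> rint v -> rint (fun x => u x - v x).
Proof. by move=> hu hv; apply: rintD => //; apply: rintN. Qed.
Lemma rint_eq u v : u =1 v -> rint u -> rint v.
Proof. by move=> /funext->. Qed.
Lemma rint_cst c : rint (cst c).
Proof. exact: finite_measure_integrable_cst. Qed.
Lemma rint0 : rint (fun=> 0). Proof. exact: (rint_cst 0). Qed.
Lemma rint_meas u : rint u -> measurable_fun setT u.
Proof. by move=> /integrableP[/measurable_EFinP]. Qed.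
Lemma rint_le u v : measurable_fun setT u -> (forall x, `|u x| <= v x) ->
  rint v -> rint u.
Proof.
move=> mu' uv hv; apply: le_integrable hv => //; first exact/measurable_EFinP.
by move=> x _ /=; rewrite lee_fin (le_trans (uv x))// ler_norm.
Qed.
Lemma rint_bounded u M : measurable_fun setT u -> (forall x, `|u x| <= M) -> rint u.
Proof. by move=> mu' uM; apply: rint_le (rint_cst M). Qed.
Lemma rint_of_ge0_lty u : measurable_fun setT u -> (forall x, 0 <= u x) ->
  (\int[mu]_x (u x)%:E < +oo)%E -> rint u.
Proof.
move=> mu' u0 ufin; apply/integrableP; split; first exact/measurable_EFinP.
by under eq_integral => x _ do rewrite /= ger0_norm//.
Qed.

(** At the torus measure this is convertible with [complex_integral], as [L2f] is with [L2]; a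
    general finite measure also covers the circle. *)
Definition cint f : R[i] := (\int[mu]_x Rec (f x)) +i* (\int[mu]_x Imc (f x)).
Definition cintegrable f := rint (fun x => Rec (f x)) /\ rint (fun x => Imc (f x)).

Lemma cintegrableD f g : cintegrable f -> cintegrable g -> cintegrable (f \+ g).
Proof.
move=> [f1 f2] [g1 g2]; split.
  by apply: rint_eq (rintD f1 g1) => x /=; rewrite ReD.
by apply: rint_eq (rintD f2 g2) => x /=; rewrite ImD.
Qed.
Lemma cintegrableZ a f : cintegrable f -> cintegrable (fun x => a * f x).
Proof.
move=> [f1 f2]; split.
  by apply: rint_eq (rintB (rintZ (Rec a) f1) (rintZ (Imc a) f2)) => x /=; rewrite ReM.
by apply: rint_eq (rintD (rintZ (Rec a) f2) (rintZ (Imc a) f1)) => x /=; rewrite ImM.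
Qed.
Lemma cintegrable0 : cintegrable (fun=> 0).
Proof. by split; exact: rint0. Qed.
Lemma cintegrable_sum (I : Type) (s : seq I) (F : I -> T -> R[i]) :
  (forall i, cintegrable (F i)) -> cintegrable (fun x => \sum_(i <- s) F i x).
Proof.
move=> hF; elim: s => [|i s IH].
  by under eq_fun do rewrite big_nil; exact: cintegrable0.
by under eq_fun do rewrite big_cons; exact: cintegrableD.
Qed.

Lemma eq_cint f g : f =1 g -> cint f = cint g.
Proof. by move=> /funext->. Qed.
Lemma cintD f g : cintegrable f -> cintegrable g ->
  cint (fun x => f x + g x) = cint f + cint g.
Proof.
move=> [f1 f2] [g1 g2]; apply: complex_ext; rewrite ReImE /=.
  by rewrite -RintegralD//; apply: eq_Rintegral => x _; rewrite ReD.
by rewrite -RintegralD//; apply: eq_Rintegral => x _; rewrite ImD.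
Qed.
Lemma cintZ a f : cintegrable f -> cint (fun x => a * f x) = a * cint f.
Proof.
move=> [f1 f2]; apply: complex_ext; rewrite ReImE /=.
  rewrite -RintegralZl// -[X in _ - X]RintegralZl// -RintegralB//; last 2 first.
  - exact: rintZ.
  - exact: rintZ.
  by apply: eq_Rintegral => x _; rewrite ReM.
rewrite -RintegralZl// -[X in _ + X]RintegralZl// -RintegralD//; last 2 first.
- exact: rintZ.
- exact: rintZ.
by apply: eq_Rintegral => x _; rewrite ImM.
Qed.
Lemma cint0 : cint (fun=> 0) = 0.
Proof. by rewrite /cint /= Rintegral_cst// mul0r. Qed.
Lemma cint_sum (I : Type) (s : seq I) (F : I -> T -> R[i]) :
  (forall i, cintegrable (F i)) ->
  cint (fun x => \sum_(i <- s) F i x) = \sum_(i <- s) cint (F i).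
Proof.
move=> hF; elim: s => [|i s IH].
  by under eq_cint do rewrite big_nil; rewrite big_nil cint0.
under eq_cint do rewrite big_cons.
by rewrite cintD// ?IH ?big_cons//; exact: cintegrable_sum.
Qed.

Definition cmeas f := measurable_fun setT (fun x => Rec (f x)) /\
  measurable_fun setT (fun x => Imc (f x)).
Definition L2f : set (T -> R[i]) :=
  [set f : T -> R[i] | [/\ measurable_fun setT (fun x => Rec (f x) : R),
    measurable_fun setT (fun x => Imc (f x) : R) &
    (\int[mu]_x ((Normc.normc (f x)) ^+ 2)%:E < +oo)%E]].
Definition nrm2 f : R := \int[mu]_x (Normc.normc (f x)) ^+ 2.

Lemma nrm2E f : nrm2 f = \int[mu]_x sqn (f x).
Proof. by apply: eq_Rintegral => x _; rewrite sqr_normcE. Qed.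
Lemma nrm2_ge0 f : 0 <= nrm2 f.
Proof. by apply: Rintegral_ge0 => x _; exact: sqr_ge0. Qed.

Lemma cmeas_sqn f : cmeas f -> measurable_fun setT (fun x => sqn (f x)).
Proof. by move=> [f1 f2]; apply: measurable_funD; apply: measurable_funX. Qed.

Lemma L2fP f : L2f f <-> cmeas f /\ rint (fun x => sqn (f x)).
Proof.
split=> [[f1 f2 f3]|[[f1 f2] f3]].
  split=> //; apply: rint_of_ge0_lty; [|by move=> x; exact: sqn_ge0|].
  - exact: cmeas_sqn.
  - by move: f3; under eq_integral do rewrite sqr_normcE.
split=> //; under eq_integral do rewrite sqr_normcE.
move/integrableP : f3 => [_]; apply: le_lt_trans.
apply: ge0_le_integral => //.
- by move=> x _; rewrite lee_fin sqn_ge0.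
- by apply/measurable_EFinP/cmeas_sqn.
- by apply/measurable_EFinP/measurableT_comp => //; exact: cmeas_sqn.
- by move=> x _ /=; rewrite lee_fin ler_norm.
Qed.

Lemma cmeasD f g : cmeas f -> cmeas g -> cmeas (f \+ g).
Proof.
move=> [f1 f2] [g1 g2]; split.
  by under eq_fun do rewrite ReD; exact: measurable_funD.
by under eq_fun do rewrite ImD; exact: measurable_funD.
Qed.
Lemma cmeasM f g : cmeas f -> cmeas g -> cmeas (f \* g).
Proof.
move=> [f1 f2] [g1 g2]; split.
  under eq_fun do rewrite ReM.
  by apply: measurable_funB; apply: measurable_funM.
under eq_fun do rewrite ImM.
by apply: measurable_funD; apply: measurable_funM.
Qed.
Lemma cmeas_cst c : cmeas (cst c). Proof. by split. Qed.
Lemma cmeasJ f : cmeas f -> cmeas (fun x => conjc (f x)).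
Proof.
move=> [f1 f2]; split; first by under eq_fun do rewrite ReJ.
by under eq_fun do rewrite ImJ; exact: measurableT_comp.
Qed.

Lemma L2fD f g : L2f f -> L2f g -> L2f (f \+ g).
Proof.
move=> /L2fP[f1 f2] /L2fP[g1 g2]; apply/L2fP; split; first exact: cmeasD.
apply: rint_le (rintD (rintZ 2 f2) (rintZ 2 g2)); first exact/cmeas_sqn/cmeasD.
by move=> x; rewrite ger0_norm ?sqn_ge0// sqnD_le.
Qed.
Lemma L2fZ a f : L2f f -> L2f (fun x => a * f x).
Proof.
move=> /L2fP[f1 f2]; apply/L2fP; split.
  by have := cmeasM (cmeas_cst a) f1.
by apply: rint_eq (rintZ (sqn a) f2) => x; rewrite sqnM.
Qed.
Lemma L2fB f g : L2f f -> L2f g -> L2f (f \- g).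
Proof.
move=> hf hg; rewrite (_ : f \- g = f \+ (fun x => -1 * g x)).
  exact: L2fD (L2fZ (-1) hg).
by apply/funext => x /=; rewrite mulN1r.
Qed.
Lemma L2f0 : L2f (fun=> 0).
Proof.
apply/L2fP; split; first exact: (cmeas_cst 0).
by apply: (rint_eq _ rint0) => x; rewrite sqn0.
Qed.
Lemma L2f_sum (I : Type) (s : seq I) (F : I -> T -> R[i]) :
  (forall i, L2f (F i)) -> L2f (fun x => \sum_(i <- s) F i x).
Proof.
move=> hF; elim: s => [|i s IH].
  by under eq_fun do rewrite big_nil; exact: L2f0.
by under eq_fun do rewrite big_cons; exact: L2fD.
Qed.
Lemma L2fJ f : L2f f -> L2f (fun x => conjc (f x)).
Proof.
move=> /L2fP[f1 f2]; apply/L2fP; split; first exact: cmeasJ.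
by apply: (rint_eq _ f2) => x; rewrite sqnJ.
Qed.
Lemma L2f_bounded f M : cmeas f -> (forall x, sqn (f x) <= M) -> L2f f.
Proof.
move=> mf fM; apply/L2fP; split=> //.
apply: (@rint_bounded _ M); first exact: cmeas_sqn.
by move=> x; rewrite ger0_norm ?sqn_ge0.
Qed.

Lemma L2f_prod f g : L2f f -> L2f g -> cintegrable (fun x => f x * g x).
Proof.
move=> /L2fP[f1 f2] /L2fP[g1 g2].
have [m1 m2] := cmeasM f1 g1.
have hi := rintD f2 g2.
have key (z w : R[i]) : `|Rec (z * w)| <= sqn z + sqn w /\ `|Imc (z * w)| <= sqn z + sqn w.
  rewrite !ReImE /sqn !ler_norml.
  have := sqr_ge0 (Rec z + Rec w); have := sqr_ge0 (Rec z - Rec w).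
  have := sqr_ge0 (Imc z + Imc w); have := sqr_ge0 (Imc z - Imc w).
  have := sqr_ge0 (Rec z + Imc w); have := sqr_ge0 (Rec z - Imc w).
  have := sqr_ge0 (Imc z + Rec w); have := sqr_ge0 (Imc z - Rec w).
  have := sqr_ge0 (Rec z); have := sqr_ge0 (Imc z).
  have := sqr_ge0 (Rec w); have := sqr_ge0 (Imc w).
  by move=> *; split; apply/andP; split; lra.
split; apply: rint_le hi => //.
  by move=> x; have [] := key (f x) (g x).
by move=> x; have [] := key (f x) (g x).
Qed.

Definition ip f g := cint (fun x => f x * conjc (g x)).

Lemma ip_cintegrable f g : L2f f -> L2f g -> cintegrable (fun x => f x * conjc (g x)).
Proof. by move=> hf hg; apply: L2f_prod => //; exact: L2fJ. Qed.

Lemma ipDl f1 f2 g : L2f f1 -> L2f f2 -> L2f g -> ip (f1 \+ f2) g = ip f1 g + ip f2 g.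
Proof.
move=> h1 h2 hg; rewrite /ip -cintD; [|exact: ip_cintegrable..].
by apply: eq_cint => x /=; rewrite mulrDl.
Qed.
Lemma ipZl a f g : L2f f -> L2f g -> ip (fun x => a * f x) g = a * ip f g.
Proof.
move=> hf hg; rewrite /ip -cintZ; last exact: ip_cintegrable.
by apply: eq_cint => x; rewrite mulrA.
Qed.
Lemma ipBl f1 f2 g : L2f f1 -> L2f f2 -> L2f g -> ip (f1 \- f2) g = ip f1 g - ip f2 g.
Proof.
move=> h1 h2 hg; rewrite -mulN1r -ipZl// -ipDl//; last exact: L2fZ.
by apply: eq_cint => x /=; rewrite mulN1r.
Qed.
Lemma ip_suml (I : Type) (s : seq I) (F : I -> T -> R[i]) g :
  (forall i, L2f (F i)) -> L2f g ->
  ip (fun x => \sum_(i <- s) F i x) g = \sum_(i <- s) ip (F i) g.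
Proof.
move=> hF hg; rewrite /ip -cint_sum; last by move=> i; apply: ip_cintegrable.
by apply: eq_cint => x; rewrite mulr_suml.
Qed.

Lemma nrm2_sub f e a : L2f f -> L2f e ->
  nrm2 (fun x => f x - a * e x) =
  nrm2 f + sqn a * nrm2 e - 2 * Rec (conjc a * ip f e).
Proof.
move=> hf he; rewrite !nrm2E /ip -cintZ; last exact: ip_cintegrable.
have hi := ip_cintegrable hf he.
have /L2fP[_ f2] := hf; have /L2fP[_ e2] := he.
have [hz _] := cintegrableZ (conjc a) hi.
rewrite /cint /= -[sqn a * _]RintegralZl// -RintegralD//; last exact: rintZ.
rewrite -[2 * _]RintegralZl//.
rewrite -RintegralB//; [|by apply: rintD => //; exact: rintZ|exact: rintZ].
apply: eq_Rintegral => x _.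
by rewrite /sqn !ReImE; ring.
Qed.

(* completing the square in [nrm2_sub] *)
Lemma orth_sum (I : eqType) (s : seq I) (e : I -> T -> R[i]) (a : I -> R[i]) (V : R) f :
  L2f f -> (forall i, L2f (e i)) -> uniq s -> 0 < V ->
  (forall i j, ip (e i) (e j) = if i == j then V%:C else 0) ->
  nrm2 (fun x => f x - \sum_(i <- s) a i * e i x) =
  nrm2 f + \sum_(i <- s) (sqn (V%:C * a i - ip f (e i)) - sqn (ip f (e i))) / V.
Proof.
move=> hf he us V0 oe; elim: s f hf us => [|i s IH] f hf /=.
  move=> _; rewrite big_nil addr0; congr (nrm2 _); apply/funext => x.
  by rewrite big_nil subr0.
move=> /andP[nis us].
have hae : L2f (fun x => a i * e i x) by exact: L2fZ.
have hf' : L2f (fun x => f x - a i * e i x) by exact: L2fB.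
transitivity (nrm2 (fun x => (f x - a i * e i x) - \sum_(j <- s) a j * e j x)).
  by congr nrm2; apply/funext => x; rewrite big_cons opprD addrA.
rewrite IH// nrm2_sub// big_cons addrA; congr (_ + _).
  have -> : nrm2 (e i) = V.
    rewrite nrm2E; have := oe i i; rewrite eqxx /ip /cint => -[<- _].
    by apply: eq_Rintegral => x _; rewrite mulJE.
  rewrite -addrA; congr (_ + _).
  apply: (mulIf (lt0r_neq0 V0)); rewrite divfK ?lt0r_neq0//.
  by rewrite /sqn !ReImE /=; ring.
apply: eq_big_seq => j js.
have -> : ip (fun x => f x - a i * e i x) (e j) = ip f (e j).
  rewrite (ipBl hf hae (he j)) ipZl// oe.
  by case: eqP => [ij|_]; [move: nis; rewrite ij js|rewrite mulr0 subr0].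
by [].
Qed.

Lemma bessel (I : eqType) (s : seq I) (e : I -> T -> R[i]) (V : R) f :
  L2f f -> (forall i, L2f (e i)) -> uniq s -> 0 < V ->
  (forall i j, ip (e i) (e j) = if i == j then V%:C else 0) ->
  \sum_(i <- s) sqn (ip f (e i)) <= V * nrm2 f.
Proof.
move=> hf he us V0 oe.
(* The coefficients of the orthogonal projection annihilate the completed squares in [orth_sum]. *)
have := nrm2_ge0 (fun x => f x - \sum_(i <- s) ((V^-1)%:C * ip f (e i)) * e i x).
rewrite (orth_sum _ hf he us V0 oe)//.
under eq_bigr => i _.
  rewrite mulrA (_ : V%:C * (V^-1)%:C = 1); last first.
    by apply: complex_ext; rewrite !ReImE/= ?mulr0 ?mul0r ?subr0 ?addr0 ?divff// lt0r_neq0.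
  rewrite mul1r subrr sqn0 sub0r mulNr.
  over.
rewrite sumrN subr_ge0 -mulr_suml ler_pdivrMr// mulrC.
by rewrite mulrC.
Qed.

(** The orthogonal projection is the best approximation: dropping the completed squares in
    [orth_sum] shows that any coefficients [a] approximating [f] within [eps] force Bessel's
    inequality to be sharp up to [V * eps]. *)
Lemma parseval_of_approx (I : eqType) (s : seq I) (e : I -> T -> R[i]) (a : I -> R[i]) (V : R) f eps :
  L2f f -> (forall i, L2f (e i)) -> uniq s -> 0 < V ->
  (forall i j, ip (e i) (e j) = if i == j then V%:C else 0) ->
  nrm2 (fun x => f x - \sum_(i <- s) a i * e i x) <= eps ->
  V * nrm2 f <= \sum_(i <- s) sqn (ip f (e i)) + V * eps.
Proof.
move=> hf he us V0 oe; rewrite (orth_sum _ hf he us V0 oe)//.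
rewrite -mulr_suml sumrB -(ler_pM2l V0) mulrDr [V * (_ / V)]mulrC divfK ?lt0r_neq0//.
have : 0 <= \sum_(i <- s) sqn (V%:C * a i - ip f (e i)) by apply: sumr_ge0 => i _; exact: sqn_ge0.
lra.
Qed.

Lemma nrm2D_le f g : L2f f -> L2f g -> nrm2 (f \+ g) <= 2 * nrm2 f + 2 * nrm2 g.
Proof.
move=> hf hg; have /L2fP[_ fi] := hf; have /L2fP[_ gi] := hg.
have /L2fP[_ fgi] := L2fD hf hg.
rewrite !nrm2E -!RintegralZl// -RintegralD//; [|exact: rintZ|exact: rintZ].
apply: le_Rintegral => //; first by apply: rintD; exact: rintZ.
by move=> x _; exact: sqnD_le.
Qed.

Lemma nrm2Z a f : L2f f -> nrm2 (fun x => a * f x) = sqn a * nrm2 f.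
Proof.
move=> /L2fP[_ fi]; rewrite !nrm2E -RintegralZl//.
by apply: eq_Rintegral => x _; rewrite sqnM.
Qed.

(** Applied to [h = A f]: an operator that sends [f] to a null function has the whole norm of [f] as
    its error there. *)
Lemma nrm2_eq0_sub f h : L2f f -> L2f h -> nrm2 h = 0 -> nrm2 (fun x => f x - h x) = nrm2 f.
Proof.
move=> hf hh h0.
have ae0 : ae_eq mu setT (fun x => (sqn (h x))%:E) (cst 0%E).
  have /L2fP[mh ih] := hh.
  have mh' : measurable_fun setT (fun x => (sqn (h x))%:E).
    by apply/measurable_EFinP; exact: cmeas_sqn.
  apply/(@ae_eq_integral_abs _ _ _ mu setT measurableT) => //.
  under eq_integral => x _ do rewrite gee0_abs ?lee_fin ?sqn_ge0//.
  have := h0; rewrite nrm2E /Rintegral => h00.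
  rewrite -[LHS]fineK ?h00//.
  exact: integrable_fin_num.
rewrite !nrm2E; congr fine; apply: ae_eq_integral => //.
- by apply/measurable_EFinP/cmeas_sqn; have [? ? _] := L2fB hf hh.
- by apply/measurable_EFinP/cmeas_sqn; have [? ? _] := hf.
apply: filterS ae0 => x /(_ I)[/sqn_eq0->] _.
by rewrite subr0.
Qed.

End ComplexIntegral.

(** * The circle: characters and Parseval identity *)

Section Circle.
Variable R : realType.
Local Notation RM := (measurableTypeR R).
Local Notation mu1 := (circle_measure R).
Local Notation per := (`[0%R, (2 * pi)%R]%classic : set R).
Local Notation leb := (@lebesgue_measure R).

Lemma measurable_per : measurable (per : set RM).
Proof. exact: measurable_itv. Qed.

Lemma leb_per_lty : (leb (per : set RM) < +oo)%E.
Proof. by rewrite lebesgue_measure_itv/=; case: ifP => // _; rewrite ltry. Qed.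

Lemma twopi_gt0 : 0 < 2 * pi :> R.
Proof. by rewrite mulr_gt0 ?pi_gt0. Qed.

Lemma circle_measure_perC : mu1 (~` per) = 0%E.
Proof. by transitivity (leb ((~` per) `&` per)); rewrite // setICl measure0. Qed.

Lemma circle_measureT : mu1 setT = (2 * pi)%:E.
Proof.
transitivity (leb (setT `&` per)); first by [].
rewrite setTI lebesgue_measure_itv/= lte_fin twopi_gt0.
by rewrite oppr0 addr0.
Qed.

Lemma integral_circle_in (f : RM -> \bar R) :
  (\int[mu1]_(x in per) f x = \int[leb]_(x in per) f x)%E.
Proof.
apply: eq_measure_integral => A mA AD.
change (leb (A `&` per) = leb A).
by rewrite setIidl.
Qed.

Lemma ge0_integral_circle (f : RM -> \bar R) :
  measurable_fun setT f -> (forall x, 0 <= f x)%E ->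
  (\int[mu1]_x f x = \int[leb]_(x in per) f x)%E.
Proof.
move=> mf f0; rewrite -integral_circle_in.
have := @ge0_negligible_integral _ RM R mu1 setT (~` per) f.
rewrite setTD setCK; apply => //.
- by apply: measurableC; exact: measurable_per.
- exact: circle_measure_perC.
Qed.

Lemma integrable_circleP (f : RM -> R) : measurable_fun setT f ->
  rint mu1 f <-> leb.-integrable (per : set RM) (EFin \o f).
Proof.
move=> mf; split=> [|] /integrableP[mf' fi]; apply/integrableP; split.
- exact/measurable_EFinP/measurable_funTS.
- move: fi; rewrite ge0_integral_circle//.
  exact: measurableT_comp.
- exact/measurable_EFinP.
- move: fi; rewrite ge0_integral_circle//.
  by apply/measurableT_comp => //; apply/measurable_EFinP.
Qed.

Lemma integral_circle (f : RM -> R) : rint mu1 f ->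
  (\int[mu1]_x (f x)%:E = \int[leb]_(x in per) (f x)%:E)%E.
Proof.
move=> fi; rewrite -integral_circle_in.
have := @negligible_integral _ RM R mu1 setT (~` per) (EFin \o f).
rewrite setTD setCK; apply => //.
- by apply: measurableC; exact: measurable_per.
- exact: circle_measure_perC.
Qed.

Lemma continuous_meas (f : R -> R) : continuous f -> measurable_fun (setT : set RM) f.
Proof. exact: continuous_measurable_fun. Qed.

(** The two endpoints form a null set; they are discarded because [conv_cvg] gives convergence only
    in the open interval. *)
Lemma ae_per (P : RM -> Prop) : (forall x, 0 < x < 2 * pi -> P x) -> {ae mu1, forall x, P x}.
Proof.
move=> hP; exists (~` `]0%R, (2 * pi)%R[%classic); split.
- by apply: measurableC; exact: measurable_itv.
- change (leb ((~` `]0%R, (2 * pi)%R[%classic) `&` per) = 0%E).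
  rewrite setIC.
  apply: (@subset_measure0 _ _ _ leb _ ([set 0; 2 * pi] : set RM)).
  + by apply: measurableD; exact: measurable_itv.
  + by apply: measurableU; exact: measurable_set1.
  + move=> x [] /=; rewrite !in_itv /= => /andP[x0 x1] /negP.
    rewrite negb_and -!leNgt => /orP[h|h].
      by left; apply/eqP; rewrite eq_le h.
    by right; apply/eqP; rewrite eq_le h x1.
  + have := @measureU0 _ RM R leb [set 0] [set 2 * pi] (measurable_set1 _) (measurable_set1 _).
    move=> h; apply: (etrans (h _)); first exact: lebesgue_measure_set1.
    exact: lebesgue_measure_set1.
- move=> x /= hx; rewrite in_itv /= => h; apply: hx; exact: hP.
Qed.

Lemma circle_FTC (G g : R -> R) : (forall x : R, is_derive x (1 : R) G (g x)) -> continuous g ->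
  \int[mu1]_x g x = G (2 * pi) - G 0.
Proof.
move=> dG cg.
have cG : continuous G.
  by move=> x; apply/differentiable_continuous/derivable1_diffP; have [] := dG x.
have gb : rint mu1 g.
  apply/integrable_circleP; first exact: continuous_meas.
  apply: continuous_compact_integrable; first exact: segment_compact.
  exact: continuous_subspaceT.
rewrite /Rintegral integral_circle// (@continuous_FTC2 _ g G)//.
- exact: twopi_gt0.
- exact: continuous_subspaceT.
- split.
  + by move=> x _; have [] := dG x.
  + by apply: cvg_at_right_filter; exact: cG.
  + by apply: cvg_at_left_filter; exact: cG.
- by move=> x _; rewrite derive1E; have [] := dG x.
Qed.

End Circle.

Section CircleCharacters.
Variable R : realType.
Local Notation RM := (measurableTypeR R).
Local Notation mu1 := (circle_measure R).

Definition char1 (k : int) (x : R) : R[i] := cis (k%:~R * x).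

Lemma is_derive_cosZ (a x : R) : is_derive x (1 : R) (fun y : R => cos (a * y)) (- (a * sin (a * x))).
Proof.
have h : is_derive x (1 : R) (fun y : R => a * y) a.
  have := @is_deriveZ _ _ _ (fun y : R => y) a x 1 1 (is_derive_id _ _).
  by rewrite /GRing.scale/= mulr1.
have := @is_derive1_comp _ cos (fun y => a * y) x _ _ (is_derive_cos (a * x)) h.
by move=> h2; apply: is_derive_eq h2 _; rewrite mulNr mulrC.
Qed.
Lemma is_derive_sinZ (a x : R) : is_derive x (1 : R) (fun y : R => sin (a * y)) (a * cos (a * x)).
Proof.
have h : is_derive x (1 : R) (fun y : R => a * y) a.
  have := @is_deriveZ _ _ _ (fun y : R => y) a x 1 1 (is_derive_id _ _).
  by rewrite /GRing.scale/= mulr1.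
have := @is_derive1_comp _ sin (fun y => a * y) x _ _ (is_derive_sin (a * x)) h.
by move=> h2; apply: is_derive_eq h2 _; rewrite mulrC.
Qed.

Lemma continuous_cosZ (a : R) : continuous (fun y : R => cos (a * y)).
Proof. by move=> x; apply/differentiable_continuous/derivable1_diffP; have [] := is_derive_cosZ a x. Qed.
Lemma continuous_sinZ (a : R) : continuous (fun y : R => sin (a * y)).
Proof. by move=> x; apply/differentiable_continuous/derivable1_diffP; have [] := is_derive_sinZ a x. Qed.

Lemma char1_meas k : cmeas (char1 k : RM -> R[i]).
Proof.
by split; apply: continuous_meas; [exact: continuous_cosZ|exact: continuous_sinZ].
Qed.

Lemma char1_L2 k : L2f mu1 (char1 k).
Proof.
apply: (@L2f_bounded _ _ _ _ _ 1); first exact: char1_meas.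
by move=> x; rewrite sqn_cis.
Qed.

Lemma cint_char1 k : cint mu1 (char1 k) = if k == 0 then (2 * pi)%:C else 0.
Proof.
have [->|k0] := eqVneq.
  rewrite /cint /char1 /cis /=.
  under eq_Rintegral do rewrite mul0r cos0.
  under [X in _ +i* X]eq_Rintegral do rewrite mul0r sin0.
  by rewrite !Rintegral_cst//= circle_measureT /= mul1r mul0r.
have k0' : k%:~R != 0 :> R by rewrite intr_eq0.
have [h1 h2] : cos (k%:~R * (2 * pi)) = 1 :> R /\ sin (k%:~R * (2 * pi)) = 0 :> R.
  by have [] := @cis_int2pi R k.
apply: complex_ext => /=.
- have dG (x : R) : is_derive x (1 : R) (fun x => (k%:~R)^-1 * sin (k%:~R * x)) (cos (k%:~R * x)).
    have := is_deriveZ (k%:~R^-1) (is_derive_sinZ (k%:~R) x).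
    by move=> h; apply: is_derive_eq h _; rewrite /GRing.scale/= mulKf.
  rewrite (circle_FTC dG) ?h2 ?mulr0 ?sin0 ?mulr0 ?subrr//.
  exact: continuous_cosZ.
- have dG (x : R) : is_derive x (1 : R) (fun x => - (k%:~R)^-1 * cos (k%:~R * x)) (sin (k%:~R * x)).
    have := is_deriveZ (- k%:~R^-1) (is_derive_cosZ (k%:~R) x).
    by move=> h; apply: is_derive_eq h _; rewrite /GRing.scale/= mulrNN mulKf.
  rewrite (circle_FTC dG) ?h1 ?mulr0 ?cos0 ?subrr//.
  exact: continuous_sinZ.
Qed.

Lemma char1B k l x : char1 k x * conjc (char1 l x) = char1 (k - l) x.
Proof. by rewrite /char1 -cisN -cisD intrB mulrBl. Qed.

Lemma ip_char1 k l : ip mu1 (char1 k) (char1 l) = if k == l then (2 * pi)%:C else 0.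
Proof.
rewrite /ip; under eq_cint do rewrite char1B.
by rewrite cint_char1 subr_eq0.
Qed.

End CircleCharacters.

(** * The kernel ((1 + cos t) / 2)^n and its Fourier coefficients *)

Section PowerKernel.
Variable R : realType.
Local Notation RM := (measurableTypeR R).
Local Notation mu1 := (circle_measure R).

(** This is cos(t/2)^(2n), the de la Vallee Poussin kernel before normalisation: nonnegative, peaked
    at the multiples of 2 pi, and a trigonometric polynomial. *)
Definition ker (n : nat) (t : R) : R := ((1 + cos t) / 2) ^+ n.
(* Fourier coefficient of [ker n] at frequency [j - n]; see [ker_expand] *)
Definition kerc (n j : nat) : R := 'C(n.*2, j)%:R / 4 ^+ n.

Lemma ker_ge0 n t : 0 <= ker n t.
Proof. by rewrite exprn_ge0// divr_ge0//; have := cos_geN1 t; lra. Qed.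

Lemma ker_expand n t :
  (ker n t)%:C = \sum_(j < n.*2.+1) (kerc n j)%:C * cis ((j%:Z - n%:Z)%:~R * t).
Proof.
have -> : ker n t = Rec ((ker n t)%:C) by [].
(* In this form the n-th power is a binomial expansion of exponent 2n with frequencies shifted by
   [- n]. *)
have base : ((1 + cos t) / 2)%:C = (1 + cis t) ^+ 2 * cis (- t) * (4^-1)%:C.
  rewrite cisN expr2.
  have h1 := cos2Dsin2 t.
  apply: complex_ext; rewrite !ReImE /=; set c := cos t in h1 *; set s := sin t in h1 *.
    have h2 : s ^+ 2 = 1 - c ^+ 2 by lra.
    by field: h2.
  have h2 : s ^+ 2 = 1 - c ^+ 2 by lra.
    by field: h2.
have bigE (z : R[i]) m : (1 + z) ^+ m = \sum_(j < m.+1) ('C(m, j)%:R)%:C * z ^+ j.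
  rewrite exprDn; apply: eq_bigr => i _.
  by rewrite expr1n mul1r -mulr_natl; congr (_ * _); rewrite rmorph_nat.
rewrite /= /ker rmorphXn/= base 2!exprMn -exprM mul2n bigE !mulr_suml.
apply: eq_bigr => j _.
have -> : (kerc n j)%:C = ('C(n.*2, j)%:R)%:C * (4^-1)%:C ^+ n.
  by rewrite /kerc -exprVn rmorphM rmorphXn.
have -> : cis ((j%:Z - n%:Z)%:~R * t) = cis t ^+ j * cis (- t) ^+ n.
  by rewrite -!cis_nat -cisD; congr cis; rewrite intrB mulrBl mulrN.
ring.
Qed.

(** The mean of the kernel decays at most polynomially, which is beaten by the geometric decay away
    from the peak. The induction compares the ratio (2n+1)/(2n+2) of consecutive values with
    (n+1)/(n+2). *)
Lemma kerc_mid_ge n : (n.+1%:R)^-1 <= kerc n n.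
Proof.
rewrite /kerc.
elim: n => [|n IH]; first by rewrite bin0 expr0 divr1 invr1.
have hb : (n.+1 * 'C(n.+1.*2, n.+1) = 2 * (n.*2.+1) * 'C(n.*2, n))%N.
  have e1 := mul_bin_diag n.+1.*2 n.
  have e2 := mul_bin_down n.*2.+1 n.
  rewrite /= in e1 e2; rewrite doubleS in e1 *.
  rewrite -e1 -[(n.*2.+2)]/((n.+1).*2) -mul2n -!mulnA e2; congr (_ * (_ * _))%N.
  by rewrite subSn -?addnn ?leq_addl// addnK.
have -> : 'C(n.+1.*2, n.+1)%:R = 2 * n.*2.+1%:R / n.+1%:R * 'C(n.*2, n)%:R :> R.
  apply: (mulfI (x := n.+1%:R)); first by rewrite pnatr_eq0.
  by rewrite -[LHS]natrM hb !natrM; field; rewrite addrC natr1 pnatr_eq0.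
have h4 : 0 < 4 ^+ n :> R by rewrite exprn_gt0.
have hn : 0 <= n%:R :> R by rewrite ler0n.
have -> : 2 * n.*2.+1%:R / n.+1%:R * 'C(n.*2, n)%:R / 4 ^+ n.+1 =
    2 * n.*2.+1%:R / n.+1%:R / 4 * ('C(n.*2, n)%:R / 4 ^+ n) :> R.
  by rewrite exprS; field; rewrite (lt0r_neq0 h4) /= addrC natr1 pnatr_eq0.
apply: (@le_trans _ _ (2 * n.*2.+1%:R / n.+1%:R / 4 * (n.+1%:R)^-1)); last first.
  by rewrite ler_wpM2l// !mulr_ge0// invr_ge0.
rewrite -[n.*2.+1%:R]natr1 -[n.+2%:R]natr1 -[n.+1%:R]natr1 -muln2 natrM.
rewrite -subr_ge0.
have -> : 2 * (n%:R * 2 + 1) / (n%:R + 1) / 4 / (n%:R + 1) - (n%:R + 1 + 1)^-1 =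
  n%:R / (2 * (n%:R + 1) ^+ 2 * (n%:R + 1 + 1)) :> R.
  by field; apply/andP; split; lra.
by rewrite divr_ge0// mulr_ge0// ?mulr_ge0 ?sqr_ge0//; lra.
Qed.

End PowerKernel.

Section AeLe.
Context d (T : measurableType d) (R : realType).
Variable mu : {finite_measure set T -> \bar R}.

(** The pointwise maximum dominates [f1] everywhere and equals [f2] almost everywhere. *)
Lemma ae_le_Rintegral (f1 f2 : T -> R) : rint mu f1 -> rint mu f2 ->
  {ae mu, forall x, f1 x <= f2 x} -> \int[mu]_x f1 x <= \int[mu]_x f2 x.
Proof.
move=> h1 h2 h12.
have mmax : measurable_fun setT (fun x => Num.max (f1 x) (f2 x)).
  exact: (measurable_maxr (rint_meas h1) (rint_meas h2)).
have hmax : rint mu (fun x => Num.max (f1 x) (f2 x)).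
  have habs (f : T -> R) : rint mu f -> rint mu (fun x => `|f x|).
    by move=> hf; exact: integrable_norm.
  apply: rint_le (rintD (habs _ h1) (habs _ h2)) => // x.
  by rewrite /Num.max; case: ifP => _; rewrite ?lerDl ?lerDr.
apply: (@le_trans _ _ (\int[mu]_x Num.max (f1 x) (f2 x))).
  by apply: le_Rintegral => // x _; rewrite le_max lexx.
rewrite le_eqVlt; apply/orP; left; apply/eqP; congr fine.
apply: ae_eq_integral => //.
- exact/measurable_EFinP.
- by apply/measurable_EFinP; exact: rint_meas h2.
by apply: filterS h12 => x h _; congr EFin; rewrite max_r.
Qed.

End AeLe.

Section Symm.
Definition symm (n : nat) : seq int := [seq (j%:Z - n%:Z) | j <- iota 0 n.*2.+1].

Lemma big_symm (V : nmodType) n (F : int -> V) :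
  \sum_(k <- symm n) F k = \sum_(j < n.*2.+1) F (j%:Z - n%:Z).
Proof. by rewrite big_map -[in LHS](subn0 n.*2.+1) -/(index_iota _ _) big_mkord. Qed.

Lemma uniq_symm n : uniq (symm n).
Proof. by rewrite map_inj_uniq ?iota_uniq// => i j /addIr []. Qed.

End Symm.

(** * Convolution with the kernel *)

Section Convolution.
Variable R : realType.
Local Notation RM := (measurableTypeR R).
Local Notation mu1 := (circle_measure R).
Implicit Types g : R -> R.

(** The convolution of [u] with [ker n], written directly as a trigonometric polynomial; [convcE]
    identifies it with the integral. *)
Definition convc (n : nat) (u : RM -> R[i]) (x : R) : R[i] :=
  \sum_(j < n.*2.+1) ((kerc R n j)%:C * ip mu1 u (char1 (j%:Z - n%:Z))) * char1 (j%:Z - n%:Z) x.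

Lemma char1D k (x t : R) : char1 k (x - t) = char1 k x * conjc (char1 k t).
Proof. by rewrite /char1 -cisN -cisD mulrBr. Qed.

Lemma convcE n u (x : R) : L2f mu1 u ->
  cint mu1 (fun t => (ker n (x - t))%:C * u t) = convc n u x.
Proof.
move=> hu; rewrite /convc.
transitivity (cint mu1 (fun t => \sum_(j < n.*2.+1)
   ((kerc R n j)%:C * char1 (j%:Z - n%:Z) x) * (u t * conjc (char1 (j%:Z - n%:Z) t)))).
  apply: eq_cint => t; rewrite ker_expand mulr_suml; apply: eq_bigr => j _.
  rewrite -/(char1 (j%:Z - n%:Z) (x - t)) char1D; ring.
have hj (j : 'I_n.*2.+1) : cintegrable mu1 (fun t => u t * conjc (char1 (j%:Z - n%:Z) t)).
  by apply: ip_cintegrable => //; exact: char1_L2.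
rewrite cint_sum; last by move=> j; exact: cintegrableZ.
by apply: eq_bigr => j _; rewrite cintZ// /ip; ring.
Qed.

(** Only frequency 0, at index [j = n], survives against a constant. This computes the mass of the
    translated kernel for every [x], as used in [int_ker]. *)
Lemma convc1 n (x : R) : convc n (cst 1) x = (2 * pi * kerc R n n)%:C.
Proof.
have nn : (n < n.*2.+1)%N by rewrite ltnS -addnn leq_addl.
rewrite /convc (bigD1 (Ordinal nn))//= subrr.
have e1 : cst 1 = char1 0 :> (RM -> R[i]).
  by apply/funext => t; rewrite /char1 mul0r cis0.
rewrite big1 ?addr0 => [|j jn].
  by rewrite e1 ip_char1 eqxx /char1 mul0r cis0 mulr1 mulrC -rmorphM.
rewrite e1 ip_char1 ifN ?mulr0 ?mul0r//.
rewrite eq_sym subr_eq0; apply: contraNN jn => /eqP[jn].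
by apply/eqP/val_inj.
Qed.

Lemma continuous_ker n (x : R) : continuous (fun t : R => ker n (x - t)).
Proof.
move=> t; rewrite /ker.
have h : {for t, continuous (fun t : R => (1 + cos (x - t)) / 2)}.
  apply: cvgM; last exact: cvg_cst.
  apply: cvgD; first exact: cvg_cst.
  apply: continuous_comp; last exact: continuous_cos.
  by apply: cvgB; [exact: cvg_cst|exact: cvg_id].
exact: (continuous_comp h (@exprn_continuous _ n _)).
Qed.

Lemma ker_le1 n (t : R) : ker n t <= 1.
Proof. by rewrite exprn_ile1// ?divr_ge0//; have := cos_geN1 t; have := cos_le1 t; lra. Qed.

Section ContinuousBounded.
Variables (g : R -> R) (M : R).
Hypothesis cg : continuous g.
Hypothesis gM : forall x, `|g x| <= M.

Definition conv n (x : R) : R := (2 * pi * kerc R n n)^-1 * \int[mu1]_t (ker n (x - t) * g t).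

Lemma kerc_mid_gt0 n : 0 < kerc R n n.
Proof. by rewrite (lt_le_trans _ (kerc_mid_ge R n)). Qed.

Lemma conv_norm_gt0 n : 0 < 2 * pi * kerc R n n.
Proof. by apply: mulr_gt0; [exact: twopi_gt0|exact: kerc_mid_gt0]. Qed.

Lemma g_L2 : L2f mu1 (fun t => (g t)%:C).
Proof.
apply: (@L2f_bounded _ _ _ _ _ (M ^+ 2)).
  by split => //=; apply: continuous_meas.
move=> x; rewrite sqn_real -real_normK ?num_real//.
by rewrite lerXn2r ?nnegrE// (le_trans _ (gM x)).
Qed.

Lemma rint_kerg n x : rint mu1 (fun t => ker n (x - t) * g t).
Proof.
apply: (@rint_bounded _ _ _ _ _ M).
  apply: measurable_funM; apply: continuous_meas => //; exact: continuous_ker.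
move=> t; rewrite normrM ger0_norm ?ker_ge0//.
by rewrite (le_trans _ (gM t))// ler_piMl// ker_le1.
Qed.

Lemma rint_ker n x : rint mu1 (fun t => ker n (x - t)).
Proof.
apply: (@rint_bounded _ _ _ _ _ 1).
  apply: continuous_meas => //; exact: continuous_ker.
by move=> t; rewrite ger0_norm ?ker_ge0// ker_le1.
Qed.

Lemma int_ker n x : \int[mu1]_t ker n (x - t) = 2 * pi * kerc R n n.
Proof.
have := convc1 n x; rewrite -convcE; last first.
  by apply: (@L2f_bounded _ _ _ _ _ 1) => //; move=> t; rewrite sqn1.
rewrite /cint => -[h _]; rewrite -h.
by apply: eq_Rintegral => t _; rewrite mulr1 mulr0 subr0.
Qed.

Lemma conv_convc n x : (conv n x)%:C = ((2 * pi * kerc R n n)^-1)%:C * convc n (fun t => (g t)%:C) x.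
Proof.
rewrite -convcE; last exact: g_L2.
rewrite /conv rmorphM; congr (_ * _); rewrite /cint; apply: complex_ext => /=.
  by apply: eq_Rintegral => t _; rewrite !mulr0 subr0.
under eq_Rintegral do rewrite mulr0 mul0r addr0.
by rewrite Rintegral_cst// mul0r.
Qed.

Lemma conv_diff n x : conv n x - g x =
  (2 * pi * kerc R n n)^-1 * \int[mu1]_t (ker n (x - t) * (g t - g x)).
Proof.
have q0 : 2 * pi * kerc R n n != 0.
  by rewrite lt0r_neq0 ?conv_norm_gt0.
under eq_Rintegral do rewrite mulrBr.
rewrite RintegralB//; [|exact: rint_kerg|].
  rewrite RintegralZr//; last exact: rint_ker.
  by rewrite int_ker mulrBr mulKf.
under eq_fun do rewrite mulrC.
by have := rintZ (g x) (rint_ker n x).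
Qed.

Lemma conv_le n x : `|conv n x - g x| <= 2 * M.
Proof.
rewrite conv_diff normrM gtr0_norm ?invr_gt0 ?conv_norm_gt0//.
rewrite mulrC ler_pdivrMr ?conv_norm_gt0//.
have hi : rint mu1 (fun t => ker n (x - t) * (g t - g x)).
  apply: rint_eq (rintB (rint_kerg n x) (rintZ (g x) (rint_ker n x))) => t /=.
  by rewrite mulrBr [g x * _]mulrC.
apply: (le_trans (le_normr_Rintegral _ hi)) => //.
rewrite -(int_ker n x) -RintegralZl//; last exact: rint_ker.
apply: le_Rintegral => //.
- exact: integrable_norm.
- exact: rintZ (rint_ker n x).
move=> t _; rewrite normrM ger0_norm ?ker_ge0// mulrC ler_wpM2r ?ker_ge0//.
by rewrite (le_trans (ler_normB _ _))// mulr_natl mulr2n lerD.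
Qed.

End ContinuousBounded.

End Convolution.

Section Convergence.
Variable R : realType.
Local Notation RM := (measurableTypeR R).
Local Notation mu1 := (circle_measure R).

(** The last term s^n is the smallest of the n+1 terms of the geometric sum (1 - s^(n+1)) / (1 -
    s). *)
Lemma natexp_le (s : R) n : 0 <= s -> s < 1 -> n.+1%:R * s ^+ n <= (1 - s)^-1.
Proof.
move=> s0 s1; have s1' : 0 < 1 - s by lra.
suff h : (1 - s) * (n.+1%:R * s ^+ n) <= 1 - s ^+ n.+1.
  rewrite -[leRHS]mul1r ler_pdivlMr// mulrC (le_trans h)// lerBlDr lerDl exprn_ge0//.
elim: n => [|n IH]; first by rewrite expr0 expr1 mulr1 mulr1.
have h1 : (1 - s) * (n.+1%:R * s ^+ n.+1) <= s * (1 - s ^+ n.+1).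
  by apply: le_trans (ler_wpM2l s0 IH); rewrite exprS !mulrA ler_wpM2r ?exprn_ge0//; lra.
have h2 : s ^+ n.+1 <= 1 by rewrite exprn_ile1// ltW.
have h3 : (1 - s) * s ^+ n.+1 <= 1 - s by rewrite ler_piMr// ltW.
rewrite [s ^+ n.+2]exprS -[n.+2%:R]natr1.
by move: (s ^+ n.+1) (n.+1%:R) h1 h2 h3 => P N h1 h2 h3; lra.
Qed.

Lemma natexp_cvg0 (r : R) : 0 <= r -> r < 1 -> n.+1%:R * r ^+ n @[n --> \oo] --> (0 : R).
Proof.
(* With r = s^2, one factor s^n absorbs [n.+1] by [natexp_le] and the other tends to 0. *)
move=> r0 r1; pose s := Num.sqrt r.
have s0 : 0 <= s by exact: sqrtr_ge0.
have s1 : s < 1 by rewrite -sqrtr1 ltr_sqrt.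
have rE : r = s * s by rewrite -expr2 sqr_sqrtr.
apply: (@squeeze_cvgr _ _ _ _ (fun=> 0) (fun n => s ^+ n * (1 - s)^-1)).
- near=> n; apply/andP; split; first by rewrite mulr_ge0// exprn_ge0.
  rewrite rE exprMn mulrA mulrC ler_wpM2l ?exprn_ge0//.
  exact: natexp_le.
- exact: cvg_cst.
- rewrite -[X in _ --> X](mul0r (1 - s)^-1); apply: cvgM; last exact: cvg_cst.
  by apply: cvg_expr; rewrite ger0_norm.
Unshelve. all: by end_near. Qed.

Lemma cos_tail (dl y : R) : 0 < dl -> dl <= pi -> dl <= `|y| -> `|y| <= 2 * pi - dl ->
  cos y <= cos dl.
Proof.
move=> d0 dp dy y2; rewrite -cos_norm; move: (`|y|) dy y2 => z dz z2.
have p0 : 0 < pi :> R by exact: pi_gt0.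
have mono a b : 0 <= a -> a <= b -> b <= pi -> cos b <= cos a :> R.
  move=> a0 ab bp; rewrite leNgt ltr_cos ?in_itv/= ?a0 ?bp ?(le_trans a0 ab) ?(le_trans ab bp)//.
  by rewrite -leNgt.
have [zp|zp] := leP z pi; first by apply: mono; lra.
have -> : cos z = cos (2 * pi - z).
  by rewrite -cosN -(cosD2pi (- z)); congr cos; rewrite mulr2n; ring.
by apply: mono; lra.
Qed.

Section ContinuousBounded.
Variables (g : R -> R) (M : R).
Hypothesis cg : continuous g.
Hypothesis gM : forall x, `|g x| <= M.

(** [g] may take different values at 0 and 2 pi, so convergence is claimed only inside the period.
    The kernel concentrates at [t = x]: near [x] continuity controls the integrand, elsewhere the
    kernel is at most [r ^+ n] with r < 1. *)
Lemma conv_cvg (x : R) : 0 < x < 2 * pi -> conv g n x @[n --> \oo] --> g x.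
Proof.
move=> /andP[x0 x2]; apply/cvgrPdist_le => e e0.
have M0 : 0 <= M by rewrite (le_trans _ (gM 0)).
have e2 : 0 < e / 2 by rewrite divr_gt0.
have /cvgrPdist_le/(_ _ e2)/nbhs_ballP[d1 /= d1_gt0 hd1] := @cg x.
(* Keeping [dl] below [x] and [2 * pi - x] gives |x - t| <= 2 pi - dl for t in the period, away from
   the peaks of the kernel at 2 pi and -2 pi. *)
pose dl := Num.min d1 (Num.min x (2 * pi - x)).
have dl0 : 0 < dl by rewrite !lt_min d1_gt0 x0 subr_gt0.
have [dl1 dl2 dl3] : [/\ dl <= d1, dl <= x & dl <= 2 * pi - x].
  by rewrite /dl; split; rewrite !ge_min lexx ?orbT.
have dlp : dl <= pi by lra.
pose r := (1 + cos dl) / 2.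
have r0 : 0 <= r by rewrite divr_ge0//; have := cos_geN1 dl; lra.
have r1 : r < 1.
  have : cos dl < 1.
    rewrite -cos0 ltr_cos ?in_itv/= ?lexx ?pi_ge0//.
    by rewrite ltW.
  by rewrite /r; lra.
(* The far part contributes 2 M r^n times 2 pi; dividing by the mass 2 pi [kerc n n], at least 2 pi
   / (n+1), produces the factor [n.+1]. *)
have bound n : `|g x - conv g n x| <= e / 2 + 2 * M * (n.+1%:R * r ^+ n).
  have q0 := conv_norm_gt0 R n.
  rewrite distrC (conv_diff cg gM) normrM gtr0_norm ?invr_gt0//.
  rewrite mulrC ler_pdivrMr//.
  have hi : rint mu1 (fun t => ker n (x - t) * (g t - g x)).
    apply: rint_eq (rintB (rint_kerg cg gM n x) (rintZ (g x) (rint_ker n x))) => t /=.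
    by rewrite mulrBr [g x * _]mulrC.
  apply: (le_trans (le_normr_Rintegral _ hi)) => //.
  have hk := rintZ (e / 2) (rint_ker n x).
  have hc : rint mu1 (cst (2 * M * r ^+ n)) by exact: rint_cst.
  apply: (@le_trans _ _ (\int[mu1]_t (e / 2 * ker n (x - t) + 2 * M * r ^+ n))).
    apply: ae_le_Rintegral; [exact: integrable_norm|exact: rintD hk hc|].
    apply: ae_per => t /andP[t0 t2].
    rewrite normrM ger0_norm ?ker_ge0//.
    have [xt|xt] := ltP `|x - t| dl.
      rewrite -[leLHS]addr0 lerD//; last by rewrite !mulr_ge0// exprn_ge0.
      rewrite mulrC ler_wpM2r ?ker_ge0// distrC; apply: hd1.
      by rewrite /ball /= (lt_le_trans xt).
    rewrite -[leLHS]add0r lerD//; first by rewrite mulr_ge0 ?ker_ge0// ltW.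
    rewrite mulrC ler_pM ?ker_ge0//.
      by rewrite (le_trans (ler_normB _ _))// mulr_natl mulr2n lerD.
    have k0 : 0 <= (1 + cos (x - t)) / 2.
      by rewrite divr_ge0//; have := cos_geN1 (x - t); lra.
    apply: lerXn2r; rewrite ?nnegrE//.
    rewrite /r ler_wpM2r ?invr_ge0// lerD2l cos_tail//.
    rewrite ler_norml; lra.
  rewrite (RintegralD measurableT hk hc) RintegralZl//; last exact: rint_ker.
  rewrite int_ker Rintegral_cst// (_ : fine _ = 2 * pi); last by rewrite -[RHS]/(fine (2 * pi)%:E) -circle_measureT.
  rewrite [leRHS]mulrDl lerD2l.
  have -> : 2 * M * (n.+1%:R * r ^+ n) * (2 * pi * kerc R n n) =
    2 * M * r ^+ n * (2 * pi) * (n.+1%:R * kerc R n n) by ring.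
  rewrite ler_peMr ?mulr_ge0 ?exprn_ge0 ?pi_ge0//.
  have := kerc_mid_ge R n.
  by rewrite -[_^-1]mul1r ler_pdivrMr// mulrC.
have hcv : 2 * M * (n.+1%:R * r ^+ n) @[n --> \oo] --> (0 : R).
  rewrite -[X in _ --> X](mulr0 (2 * M)); apply: cvgM; first exact: cvg_cst.
  exact: natexp_cvg0.
move/cvgrPdist_le : hcv => /(_ _ e2); apply: filterS => n.
rewrite sub0r normrN => hn; apply: (le_trans (bound n)).
by have := ler_norm (2 * M * (n.+1%:R * r ^+ n)); lra.
Qed.

Lemma conv_meas n : measurable_fun (setT : set RM) (conv g n : RM -> R).
Proof.
have h : cmeas (fun x : RM => (conv g n x)%:C).
  under eq_fun do rewrite (conv_convc cg gM).
  have h1 : cmeas (fun x : RM => convc n (fun t => (g t)%:C) x).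
    have hL (j : 'I_n.*2.+1) : L2f mu1 (fun x => ((kerc R n j)%:C *
        ip mu1 (fun t => (g t)%:C) (char1 (j%:Z - n%:Z))) * char1 (j%:Z - n%:Z) x).
      by apply: L2fZ; exact: char1_L2.
    by have [] := L2f_sum (index_enum 'I_n.*2.+1) hL.
  exact: (cmeasM (cmeas_cst _ ((2 * pi * kerc R n n)^-1)%:C) h1).
by have [] := h.
Qed.

Lemma conv_L2_cvg e : 0 < e ->
  \forall n \near \oo, \int[mu1]_x (g x - conv g n x) ^+ 2 <= e.
Proof.
move=> e0.
have M0 : 0 <= M by rewrite (le_trans _ (gM 0)).
have mf n : measurable_fun (setT : set RM) (fun x => (g x - conv g n x) ^+ 2).
  apply: measurable_funX; apply: measurable_funB; [exact: continuous_meas|exact: conv_meas].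
pose F n (x : RM) := ((g x - conv g n x) ^+ 2)%:E.
have c1 n : measurable_fun setT (F n) by apply/measurable_EFinP.
have c2 : {ae mu1, forall x, setT x -> F n x @[n --> \oo] --> 0%E}.
  apply: ae_per => x hx _; apply: cvg_EFin; first by near=> n.
  have h : (fun n => g x - conv g n x) @ \oo --> g x - g x.
    by apply: cvgB; [exact: cvg_cst|exact: conv_cvg].
  have := cvgM h h; rewrite subrr mulr0.
  move=> h2; rewrite (_ : _ \o _ = (fun n => g x - conv g n x) * (fun n => g x - conv g n x))//.
  exact: (h2 _).
have c3 : mu1.-integrable setT (cst ((2 * M) ^+ 2)%:E) by exact: rint_cst.
have c4 : {ae mu1, forall x n, setT x -> (`|F n x| <= ((2 * M) ^+ 2)%:E)%E}.
  apply: aeW => x n _ /=; rewrite lee_fin ger0_norm ?sqr_ge0//.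
  by rewrite -real_normK ?num_real// lerXn2r ?nnegrE ?mulr_ge0// distrC (conv_le cg gM).
have [_ _] := dominated_convergence measurableT c1 (measurable_cst (0%E : \bar R)) c2 c3 c4.
rewrite integral_cst//= mul0e => h.
have /fine_cvg/cvgrPdist_le/(_ _ e0) : (\int[mu1]_x ((g x - conv g n x) ^+ 2)%:E)%E @[n --> \oo] --> 0%:E by exact: h.
apply: filterS => n; rewrite sub0r normrN; apply: le_trans; exact: ler_norm.
Unshelve. all: by end_near. Qed.

End ContinuousBounded.
End Convergence.

(** * Density of trigonometric polynomials and Parseval on the circle *)

Section CircleParseval.
Variable R : realType.
Local Notation RM := (measurableTypeR R).
Local Notation mu1 := (circle_measure R).
Local Notation leb := (@lebesgue_measure R).
Local Notation per := (`[0%R, (2 * pi)%R]%classic : set R).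

Definition clamp (M y : R) : R := Num.max (- M) (Num.min M y).

Lemma clamp_norm M y : 0 <= M -> `|clamp M y| <= M.
Proof.
move=> M0; rewrite /clamp /Num.max /Num.min ler_norml.
by case: ifP; case: ifP => /=; lra.
Qed.
Lemma clamp_id M y : `|y| <= M -> clamp M y = y.
Proof.
rewrite ler_norml => /andP[h1 h2].
by rewrite /clamp min_r// max_r.
Qed.
Lemma clamp_dist M y z : `|y| <= M -> `|y - clamp M z| <= `|y - z|.
Proof.
rewrite ler_norml => /andP[h1 h2]; rewrite /clamp /Num.max /Num.min.
rewrite ler_norml; have := ler_norm (y - z); have := ler_norm (- (y - z)); rewrite normrN.
by case: ifP; case: ifP => /=; lra.
Qed.
Lemma clamp_le M y : 0 <= M -> `|y - clamp M y| <= `|y|.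
Proof.
move=> M0; rewrite /clamp /Num.max /Num.min.
rewrite ler_norml; have := ler_norm y; have := ler_norm (- y); rewrite normrN.
by case: ifP; case: ifP => /=; lra.
Qed.
Lemma continuous_clamp M (f : R -> R) : continuous f -> continuous (fun x => clamp M (f x)).
Proof.
move=> cf; apply: (@max_fun_continuous _ _ _ (fun=> - M)); first exact: cst_continuous.
by apply: min_fun_continuous => //; exact: cst_continuous.
Qed.
Lemma measurable_clamp d (T : measurableType d) M (f : T -> R) :
  measurable_fun setT f -> measurable_fun setT (fun x => clamp M (f x)).
Proof.
move=> mf; apply: (@measurable_maxr _ _ _ _ (fun=> - M)) => //.
exact: (@measurable_minr _ _ _ _ (fun=> M)).
Qed.

Lemma truncate_L2 (u : RM -> R) e : measurable_fun setT u -> rint mu1 (fun x => u x ^+ 2) ->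
  0 < e -> exists n : nat, \int[mu1]_x (u x - clamp n%:R (u x)) ^+ 2 <= e.
Proof.
move=> um ui e0.
pose F n (x : RM) := ((u x - clamp n%:R (u x)) ^+ 2)%:E.
have c1 n : measurable_fun setT (F n).
  apply/measurable_EFinP; apply: measurable_funX; apply: measurable_funB => //.
  exact: measurable_clamp.
have c2 : {ae mu1, forall x, setT x -> F n x @[n --> \oo] --> 0%E}.
  apply: aeW => x _; apply: cvg_near_cst.
  have [N _ hN] := @nbhs_infty_ger R `|u x|.
  exists N => // n /hN /= hn.
  by rewrite /F clamp_id// subrr expr0n.
have c4 : {ae mu1, forall x n, setT x -> (`|F n x| <= (u x ^+ 2)%:E)%E}.
  apply: aeW => x n _ /=; rewrite lee_fin ger0_norm ?sqr_ge0//.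
  rewrite -real_normK ?num_real// -[leRHS]real_normK ?num_real// lerXn2r ?nnegrE//.
  exact: clamp_le.
have [_ _] := dominated_convergence measurableT c1 (measurable_cst (0%E : \bar R)) c2 ui c4.
rewrite integral_cst//= mul0e => h.
have /fine_cvg/cvgrPdist_le/(_ _ e0)[N _ /(_ N (leqnn N))] : (\int[mu1]_x (F n x))%E @[n --> \oo] --> 0%:E by exact: h.
by rewrite /= sub0r normrN => hh; exists N; apply: le_trans hh; exact: ler_norm.
Qed.

Lemma rint_sqr_circle (u : RM -> R) M : measurable_fun setT u -> (forall x, `|u x| <= M) ->
  rint mu1 (fun x => u x ^+ 2).
Proof.
move=> um uM; apply: (@rint_bounded _ _ _ _ _ (M ^+ 2)).
  exact: measurable_funX.
move=> x; rewrite ger0_norm ?sqr_ge0// -real_normK ?num_real//.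
by rewrite lerXn2r ?nnegrE// (le_trans _ (uM x)).
Qed.

Lemma rint_sqrB (f g : RM -> R) : measurable_fun setT f -> measurable_fun setT g ->
  rint mu1 (fun x => f x ^+ 2) -> rint mu1 (fun x => g x ^+ 2) ->
  rint mu1 (fun x => (f x - g x) ^+ 2).
Proof.
move=> mf mg hf hg; apply: rint_le (rintD (rintZ 2 hf) (rintZ 2 hg)).
  by apply: measurable_funX; exact: measurable_funB.
move=> x; rewrite ger0_norm ?sqr_ge0//.
by have := sqr_ge0 (f x + g x); lra.
Qed.

(** Continuous functions approximate in L1. Between functions bounded by M the squared L2 distance
    is at most 2M times the L1 distance, so [u] is truncated first and the continuous approximant is
    clamped to the same bound. *)
Lemma continuous_dense_L2 (u : RM -> R) e : measurable_fun setT u ->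
  rint mu1 (fun x => u x ^+ 2) -> 0 < e ->
  exists g : R -> R, exists M : R, [/\ continuous g, forall x, `|g x| <= M &
    \int[mu1]_x (u x - g x) ^+ 2 <= e].
Proof.
move=> um ui e0.
have [n hn] := truncate_L2 um ui (divr_gt0 e0 (ltr0n _ 4)).
pose M : R := n%:R; pose v x := clamp M (u x).
have M0 : 0 <= M by rewrite ler0n.
have vM x : `|v x| <= M by exact: clamp_norm.
have vm : measurable_fun (setT : set RM) (v : RM -> R) by exact: measurable_clamp.
have vi : leb.-integrable (per : set RM) (EFin \o v).
  by apply/integrable_circleP => //; exact: rint_bounded vM.
have [h_ [hc hi /fine_cvg hcv]] :=
  approximation_continuous_integrable (@measurable_per R) (leb_per_lty R) vi.
pose e' := e / (8 * M + 8).
(* The choice of [e'] gives 2 M e' <= e / 4, and the summand 8 keeps the denominator positive when M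
   = 0. *)
have e'0 : 0 < e' by rewrite divr_gt0//; lra.
have /cvgrPdist_le/(_ _ e'0)[N _ /(_ N (leqnn N))] := hcv.
rewrite /= sub0r normrN => hN.
pose g x := clamp M (h_ N x).
have gc : continuous g by exact: continuous_clamp.
have gM x : `|g x| <= M by exact: clamp_norm.
have gm : measurable_fun (setT : set RM) (g : RM -> R) by exact: continuous_meas.
have hm : measurable_fun (setT : set RM) (h_ N : RM -> R) by exact: continuous_meas.
have rv := rint_sqr_circle vm vM.
have rg := rint_sqr_circle gm gM.
have ruv := rint_sqrB um vm ui rv.
have rvg := rint_sqrB vm gm rv rg.
have rug := rint_sqrB um gm ui rg.
exists g, M; split => //.
have step1 : \int[mu1]_x (u x - g x) ^+ 2 <=
    2 * (\int[mu1]_x (u x - v x) ^+ 2) + 2 * (\int[mu1]_x (v x - g x) ^+ 2).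
  rewrite -!RintegralZl// -RintegralD//; [|exact: rintZ|exact: rintZ].
  apply: le_Rintegral => //; first by apply: rintD; exact: rintZ.
  by move=> x _; have := sqr_ge0 ((u x - v x) - (v x - g x)); lra.
have hh : rint mu1 (h_ N : RM -> R) by apply/integrable_circleP.
have rvh : rint mu1 (fun x => `|v x - h_ N x|).
  apply: integrable_norm => //; apply: rintB => //.
  exact: rint_bounded vM.
have step2 : \int[mu1]_x (v x - g x) ^+ 2 <= 2 * M * e'.
  apply: (@le_trans _ _ (2 * M * \int[mu1]_x `|v x - h_ N x|)).
    rewrite -RintegralZl//; apply: le_Rintegral => //; first exact: rintZ.
    move=> x _; rewrite -real_normK ?num_real// expr2 ler_pM//.
      by rewrite (le_trans (ler_normB _ _))// mulr_natl mulr2n lerD.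
    exact: clamp_dist.
  rewrite ler_wpM2l ?mulr_ge0// /Rintegral integral_circle//.
  by apply: le_trans hN; exact: ler_norm.
apply: (le_trans step1).
have h3 : \int[mu1]_x (u x - v x) ^+ 2 <= e / 4 by exact: hn.
have h4 : 2 * M * e' <= e / 4.
  rewrite /e' mulrA ler_pdivrMr; last by lra.
  rewrite -subr_ge0 (_ : _ - _ = e * 2); first by rewrite mulr_ge0// ltW.
  by field.
lra.
Qed.

Definition trig (a : int -> R[i]) n (x : RM) : R[i] := \sum_(k <- symm n) a k * char1 k x.

(** Approximability is stated for all large degrees, so that the approximants of the real and
    imaginary parts can share one degree in [trig_dense]. *)
Lemma real_trig_dense (u : RM -> R) e : measurable_fun setT u ->
  rint mu1 (fun x => u x ^+ 2) -> 0 < e ->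
  \forall n \near \oo, exists a, nrm2 mu1 (fun x => (u x)%:C - trig a n x) <= e.
Proof.
move=> um ui e0.
have e4 : 0 < e / 4 by rewrite divr_gt0.
have [g [M [gc gM hg]]] := continuous_dense_L2 um ui e4.
have := conv_L2_cvg gc gM e4; apply: filterS => n hn.
pose q := 2 * pi * kerc R n n.
(* Frequency [k] in [symm n] sits at index k + n of the kernel expansion; this integer is
   nonnegative there, so [absz] merely changes its type. *)
pose a k := (q^-1 * kerc R n (absz (k + n%:Z)))%:C * ip mu1 (fun t => (g t)%:C) (char1 k).
exists a; have -> : trig a n = (fun x => (conv g n x)%:C).
  apply/funext => x; rewrite /trig big_symm (conv_convc gc gM) /convc mulr_sumr.
  apply: eq_bigr => j _; rewrite /a subrK absz_nat -/q rmorphM !mulrA; ring.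
rewrite nrm2E.
have gm : measurable_fun (setT : set RM) (g : RM -> R) by exact: continuous_meas.
have cm := conv_meas gc gM n.
have rg := rint_sqr_circle gm gM.
have rug := rint_sqrB um gm ui rg.
have cM x : `|conv g n x| <= 3 * M.
  have := conv_le gc gM n x; have := gM x; have := ler_normD (conv g n x - g x) (g x).
  by rewrite subrK; lra.
have rc := rint_sqr_circle cm cM.
have rgc := rint_sqrB gm cm rg rc.
have ruc := rint_sqrB um cm ui rc.
apply: (@le_trans _ _ (2 * (\int[mu1]_x (u x - g x) ^+ 2) + 2 * (\int[mu1]_x (g x - conv g n x) ^+ 2))); last by lra.
rewrite -!RintegralZl// -RintegralD//; [|exact: rintZ|exact: rintZ].
under eq_Rintegral do rewrite -rmorphB sqn_real.
apply: le_Rintegral => //; first by apply: rintD; exact: rintZ.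
by move=> x _; have := sqr_ge0 ((u x - g x) - (g x - conv g n x)); lra.
Qed.

Lemma trig_L2 a n : L2f mu1 (trig a n).
Proof. by apply: L2f_sum => k; apply: L2fZ; exact: char1_L2. Qed.

Lemma trig_dense (f : RM -> R[i]) e : L2f mu1 f -> 0 < e ->
  \forall n \near \oo, exists a, nrm2 mu1 (fun x => f x - trig a n x) <= e.
Proof.
move=> hf e0; have /L2fP[[f1 f2] f3] := hf.
have e4 : 0 < e / 4 by rewrite divr_gt0.
have fr : rint mu1 (fun x => Rec (f x) ^+ 2).
  apply: rint_le f3; first exact: measurable_funX.
  by move=> x; rewrite ger0_norm ?sqr_ge0// lerDl sqr_ge0.
have fi : rint mu1 (fun x => Imc (f x) ^+ 2).
  apply: rint_le f3; first exact: measurable_funX.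
  by move=> x; rewrite ger0_norm ?sqr_ge0// lerDr sqr_ge0.
have := real_trig_dense f2 fi e4; have := real_trig_dense f1 fr e4.
apply: filterS2 => n [a ha] [b hb].
exists (fun k => a k + (0 +i* 1) * b k).
have rL (u : RM -> R) : measurable_fun setT u -> rint mu1 (fun x => u x ^+ 2) ->
    L2f mu1 (fun x => (u x)%:C).
  move=> um ui; apply/L2fP; split; first by split.
  by apply: rint_eq ui => x; rewrite sqn_real.
have h1 := L2fB (rL _ f1 fr) (trig_L2 a n).
have h2 := L2fB (rL _ f2 fi) (trig_L2 b n).
have := nrm2D_le h1 (L2fZ (0 +i* 1) h2).
have -> : nrm2 mu1 (fun x => (0 +i* 1) * ((fun x => (Imc (f x))%:C) \- trig b n) x) =
   nrm2 mu1 ((fun x => (Imc (f x))%:C) \- trig b n).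
  rewrite !nrm2E; apply: eq_Rintegral => x _.
  by rewrite sqnM (_ : sqn (0 +i* 1) = 1) ?mul1r// /sqn /=; ring.
rewrite (_ : _ \+ _ = (fun x => f x - trig (fun k => a k + (0 +i* 1) * b k) n x)).
  by move=> h; apply: (le_trans h); move: ha hb; rewrite /=; lra.
apply/funext => x /=; rewrite mulrBr addrACA -opprD; congr (_ - _).
  by apply: complex_ext; rewrite !ReImE /=; ring.
rewrite /trig mulr_sumr -big_split; apply: eq_bigr => k _ /=.
by rewrite mulrDl mulrA.
Qed.

Lemma parseval1 (f : RM -> R[i]) e : L2f mu1 f -> 0 < e ->
  \forall n \near \oo,
    2 * pi * nrm2 mu1 f <= \sum_(k <- symm n) sqn (ip mu1 f (char1 k)) + e.
Proof.
move=> hf e0; have p0 := twopi_gt0 R.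
have := trig_dense hf (divr_gt0 e0 p0); apply: filterS => n [a ha].
have := parseval_of_approx hf (@char1_L2 R) (uniq_symm n) p0 (@ip_char1 R) ha.
by rewrite mulrC [2 * pi * (e / _)]mulrC divfK ?lt0r_neq0.
Qed.

End CircleParseval.

(** * The torus: characters and Parseval identity *)

Section TorusFubini.
Variable R : realType.
Local Notation RM := (measurableTypeR R).
Local Notation mu1 := (circle_measure R).
Variable d : nat.
Local Notation mud := (torus_measure R d).
Local Notation muS := (torus_measure R d.+1).
Local Notation prodm := (mu1 \x mud)%E.
Local Notation consp := (@cons_pair R d).

Lemma meas_consp : measurable_fun setT consp.
Proof. exact: (@measurable_cons _ _ _ RM). Qed.

Lemma meas_sec2 (d' : measure_display) (U : measurableType d') (F : d.+1.-tuple RM -> U) t : measurable_fun setT F ->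
  measurable_fun setT (fun x : RM => F (consp (x, t))).
Proof.
move=> mF; apply: (measurableT_comp mF).
apply: (measurableT_comp meas_consp).
exact: pair2_measurable.
Qed.
Lemma meas_sec1 (d' : measure_display) (U : measurableType d') (F : d.+1.-tuple RM -> U) x : measurable_fun setT F ->
  measurable_fun setT (fun t : d.-tuple RM => F (consp (x, t))).
Proof.
move=> mF; apply: (measurableT_comp mF).
apply: (measurableT_comp meas_consp).
exact: pair1_measurable.
Qed.

Lemma ge0_integral_torusS (f : d.+1.-tuple RM -> \bar R) : measurable_fun setT f ->
  (forall x, 0 <= f x)%E ->
  (\int[muS]_z f z = \int[mud]_t \int[mu1]_x f (consp (x, t)))%E.
Proof.
move=> mf f0.
have -> : (\int[muS]_z f z = \int[prodm]_z f (consp z))%E.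
  by have := ge0_integral_pushforward meas_consp prodm measurableT mf (fun y _ => f0 y).
have mfc : measurable_fun setT (f \o consp) by exact: (measurableT_comp mf meas_consp).
have mfc0 z : (0 <= (f \o consp) z)%E by exact: f0.
have h1 := @fubini_tonelli1 _ _ _ _ _ mu1 mud _ mfc mfc0.
have h2 := @fubini_tonelli _ _ _ _ _ mu1 mud _ mfc mfc0.
by rewrite [LHS]h1 -[RHS]h2.
Qed.

Lemma rint_torusS (F : d.+1.-tuple RM -> R) : rint muS F ->
  prodm.-integrable setT (EFin \o (F \o consp)).
Proof.
move=> hF; have mF := rint_meas hF.
apply/integrableP; split.
  by apply/measurable_EFinP; exact: (measurableT_comp mF meas_consp).
move/integrableP : hF => [_]; apply: le_lt_trans.
have mF' : measurable_fun setT (fun z => `|(F z)%:E|%E).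
  by apply: measurableT_comp => //; exact/measurable_EFinP.
by have <- := ge0_integral_pushforward meas_consp prodm measurableT mF' (fun y _ => abse_ge0 _).
Qed.

Lemma Rintegral_torusS_prod (F : d.+1.-tuple RM -> R) : rint muS F ->
  (\int[muS]_z (F z)%:E = \int[prodm]_z (F (consp z))%:E)%E.
Proof.
move=> hF; have mF := rint_meas hF.
apply: (integral_pushforward meas_consp) => //; first exact/measurable_EFinP.
exact: rint_torusS.
Qed.

(** Fubini yields inner integrals in the extended reals, finite only almost everywhere; [fine]
    alters them on a null set. *)
Lemma rint_fine d' (T : measurableType d') (mu : {finite_measure set T -> \bar R})
    (f : T -> \bar R) : mu.-integrable setT f ->
  rint mu (fun x => fine (f x)) /\ (\int[mu]_x (fine (f x))%:E = \int[mu]_x f x)%E.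
Proof.
move=> hf; have mf := measurable_int mu hf.
have mff : measurable_fun setT (fun x => (fine (f x))%:E).
  by apply/measurable_EFinP; exact: (measurableT_comp _ mf).
have hae : ae_eq mu setT (fun x => (fine (f x))%:E) f.
  by have := integrable_ae measurableT hf; apply: filterS => x h _; rewrite fineK// h.
split; last by apply: ae_eq_integral.
apply/integrableP; split => //.
move/integrableP : hf => [_]; apply: le_lt_trans.
apply: ge0_le_integral => //.
- exact: measurableT_comp.
- exact: measurableT_comp.
by move=> x _ /=; case: (f x) => [r| |] /=; rewrite ?lexx// normr0 leey.
Qed.

Lemma integrable_fubini_G (f : RM * d.-tuple RM -> \bar R) :
  prodm.-integrable setT f -> mud.-integrable setT (fubini_G mu1 f).
Proof.
move=> hf; have mf := measurable_int _ hf.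
have mfa : measurable_fun setT (fun z => `|f z|%E).
  by apply: measurableT_comp => //; exact: mf.
have msec (y : d.-tuple RM) : measurable_fun setT (fun x : RM => f (x, y)).
  exact: (measurableT_comp mf (pair2_measurable _)).
have mG := measurable_fubini_G hf.
apply/integrableP; split; first exact: mG.
move/integrableP : hf => [_].
have := @fubini_tonelli2 _ _ _ _ _ mu1 mud _ mfa (fun z => abse_ge0 _).
move=> /= ->; apply: le_lt_trans.
apply: ge0_le_integral => //.
- by apply: measurableT_comp => //; exact: mG.
- exact: measurable_fun_fubini_tonelli_G.
- by move=> y _; exact: le_abse_integral.
Qed.

Lemma torus_Fubini21 (F : d.+1.-tuple RM -> R) : rint muS F ->
  rint mud (fun t => \int[mu1]_x F (consp (x, t))) /\
  \int[muS]_z F z = \int[mud]_t \int[mu1]_x F (consp (x, t)).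
Proof.
move=> hF; have hi := rint_torusS hF.
have hG : mud.-integrable setT (fubini_G mu1 (EFin \o (F \o consp))).
  exact: integrable_fubini_G.
have [h1 h2] := rint_fine hG; split; first exact: h1.
rewrite /Rintegral Rintegral_torusS_prod//; congr fine.
by rewrite -(integral21_prod_meas1 hi).
Qed.

Lemma torus_Fubini12 (F : d.+1.-tuple RM -> R) : rint muS F ->
  rint mu1 (fun x => \int[mud]_t F (consp (x, t))) /\
  \int[muS]_z F z = \int[mu1]_x \int[mud]_t F (consp (x, t)).
Proof.
move=> hF; have hi := rint_torusS hF.
have hG : mu1.-integrable setT (fubini_F mud (EFin \o (F \o consp))).
  exact: integrable_fubini_F.
have [h1 h2] := rint_fine hG; split; first exact: h1.
rewrite /Rintegral Rintegral_torusS_prod//; congr fine.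
by rewrite -(integral12_prod_meas1 hi).
Qed.

Lemma torus_sec_ae (F : d.+1.-tuple RM -> R) : rint muS F ->
  {ae mud, forall t, rint mu1 (fun x => F (consp (x, t)))}.
Proof. by move=> hF; exact: ae_integrable2 (rint_torusS hF). Qed.

Lemma cint_torus21 (F : d.+1.-tuple RM -> R[i]) : cintegrable muS F ->
  cintegrable mud (fun t => cint mu1 (fun x => F (consp (x, t)))) /\
  cint muS F = cint mud (fun t => cint mu1 (fun x => F (consp (x, t)))).
Proof.
move=> [h1 h2]; have [a1 a2] := torus_Fubini21 h1; have [b1 b2] := torus_Fubini21 h2.
by split; [split|apply: complex_ext].
Qed.

End TorusFubini.

Section TorusParseval.
Variable R : realType.
Local Notation RM := (measurableTypeR R).
Local Notation mu1 := (circle_measure R).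

Definition chard d (k : d.-tuple int) (x : d.-tuple RM) : R[i] :=
  cis (\sum_(j < d) (tnth k j)%:~R * (tnth x j : R)).

Lemma chard_cons d (k0 : int) (k : d.-tuple int) (x : RM) (t : d.-tuple RM) :
  chard [tuple of k0 :: k] (cons_pair (x, t)) = char1 k0 x * chard k t.
Proof.
rewrite /chard /char1 -cisD; congr cis; rewrite big_ord_recl !tnth0; congr (_ + _).
by apply: eq_bigr => j _; rewrite !tnthS.
Qed.

Lemma chard_meas d (k : d.-tuple int) : cmeas (chard k).
Proof.
have h : measurable_fun setT (fun x : d.-tuple RM => \sum_(j < d) (tnth k j)%:~R * (tnth x j : R)).
  apply: measurable_sum => j; apply: measurable_funM => //.
  exact: measurable_tnth.
split; apply: (measurableT_comp _ h); apply: continuous_meas;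
  [exact: continuous_cos|exact: continuous_sin].
Qed.

Lemma chard_L2 d (k : d.-tuple int) : L2f (torus_measure R d) (chard k).
Proof.
apply: (@L2f_bounded _ _ _ _ _ 1); first exact: chard_meas.
by move=> x; rewrite sqn_cis.
Qed.

Lemma Rintegral_torus0 (F : 0.-tuple RM -> R) : \int[torus_measure R 0]_x F x = F [tuple].
Proof.
have -> : F = cst (F [tuple]) by apply/funext => x; congr F; exact: tuple0.
rewrite Rintegral_cst// (_ : fine _ = 1) ?mulr1//.
by rewrite -[RHS]/(fine 1%:E); congr fine; exact: diracT.
Qed.

Lemma ip_chard d (k l : d.-tuple int) :
  ip (torus_measure R d) (chard k) (chard l) = if k == l then ((2 * pi) ^+ d)%:C else 0.
Proof.
elim: d k l => [|d IH] k l.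
  rewrite [k]tuple0 [l]tuple0 eqxx /ip /cint !Rintegral_torus0 expr0.
  by rewrite /chard big_ord0 cis0 /=; congr (_ +i* _); ring.
have /cint_torus21[_] := ip_cintegrable (chard_L2 k) (chard_L2 l).
rewrite /ip => ->.
case/tupleP: k => k0 k; case/tupleP: l => l0 l.
transitivity (cint (torus_measure R d) (fun t => ip mu1 (char1 k0) (char1 l0) * (chard k t * conjc (chard l t)))).
  apply: eq_cint => t; rewrite mulrC /ip -cintZ; last by apply: ip_cintegrable; exact: char1_L2.
  apply: eq_cint => x; rewrite !chard_cons rmorphM; ring.
rewrite cintZ; last by apply: ip_cintegrable; exact: chard_L2.
rewrite -/(ip _ (chard k) (chard l)) IH ip_char1.
have -> : ([tuple of k0 :: k] == [tuple of l0 :: l]) = (k0 == l0) && (k == l).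
  by rewrite -val_eqE /= eqseq_cons.
case: (k0 == l0) => /=; last by rewrite mul0r.
by case: (k == l); rewrite ?mulr0// exprS -rmorphM.
Qed.

Lemma twopiX_gt0 d : 0 < (2 * pi) ^+ d :> R.
Proof. by rewrite exprn_gt0// twopi_gt0. Qed.

Lemma bessel_torus d (f : d.-tuple RM -> R[i]) (K : seq (d.-tuple int)) :
  L2f (torus_measure R d) f -> uniq K ->
  \sum_(k <- K) sqn (ip (torus_measure R d) f (chard k)) <=
    (2 * pi) ^+ d * nrm2 (torus_measure R d) f.
Proof.
move=> hf uK; apply: bessel => //.
- by move=> i; exact: chard_L2.
- exact: twopiX_gt0.
- exact: ip_chard.
Qed.

Lemma rint_ae_le d' (T : measurableType d') (mu : {finite_measure set T -> \bar R}) (u v : T -> R) :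
  measurable_fun setT u -> (forall x, 0 <= u x) -> (forall x, 0 <= v x) -> rint mu v ->
  {ae mu, forall x, u x <= v x} -> rint mu u.
Proof.
move=> mu' u0 v0 hv uv; apply: rint_of_ge0_lty => //.
have /integrableP[mv hv'] := hv; apply: le_lt_trans hv'.
under [leRHS]eq_integral do rewrite /= ger0_norm//.
apply: ae_ge0_le_integral => //.
- by move=> x _; rewrite lee_fin.
- exact/measurable_EFinP.
- by move=> x _; rewrite lee_fin.
- by apply: filterS uv => x h _; rewrite lee_fin.
Qed.

Lemma ae_eq_Rintegral d' (T : measurableType d') (mu : {finite_measure set T -> \bar R}) (u v : T -> R) :
  rint mu u -> rint mu v -> {ae mu, forall x, u x = v x} ->
  \int[mu]_x u x = \int[mu]_x v x.
Proof.
move=> hu hv h; apply/eqP; rewrite eq_le; apply/andP; split;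
  by apply: ae_le_Rintegral => //; apply: filterS h => x ->.
Qed.

Section ParsevalStep.
Variable d : nat.
Local Notation mud := (torus_measure R d).
Local Notation muS := (torus_measure R d.+1).
Variable f : d.+1.-tuple RM -> R[i].
Hypothesis hf : L2f muS f.

Let sec t x := f (cons_pair (x, t)).

(** The Fourier coefficient in the first variable as a function of the others; it is meaningful for
    almost every [t], by [sec_L2_ae]. *)
Definition partial_coef (k : int) (t : d.-tuple RM) : R[i] := ip mu1 (sec t) (char1 k).

Lemma sec_L2_ae : {ae mud, forall t, L2f mu1 (sec t)}.
Proof.
have /L2fP[[f1 f2] f3] := hf.
apply: filterS (torus_sec_ae f3) => t ht; apply/L2fP; split => //.
split.
  exact: (@meas_sec2 R d _ _ (fun z => Rec (f z))).
exact: (@meas_sec2 R d _ _ (fun z => Imc (f z))).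
Qed.

Lemma nrm2_sec : rint mud (fun t => nrm2 mu1 (sec t)) /\
  nrm2 muS f = \int[mud]_t nrm2 mu1 (sec t).
Proof.
have /L2fP[_ f3] := hf; have [h1 h2] := torus_Fubini21 f3.
split; first by apply: rint_eq h1 => t; rewrite nrm2E.
by rewrite nrm2E h2; apply: eq_Rintegral => t _; rewrite nrm2E.
Qed.

Let lifted k (z : d.+1.-tuple RM) : R[i] := char1 k (tnth z ord0).

Let lifted_cons k x (t : d.-tuple RM) : lifted k (cons_pair (x, t)) = char1 k x.
Proof. by rewrite /lifted tnth0. Qed.

Let lifted_L2 k : L2f muS (lifted k).
Proof.
apply: (@L2f_bounded _ _ _ _ _ 1); last by move=> x; rewrite sqn_cis.
have [h1 h2] := char1_meas R k.
by split; [apply: (measurableT_comp h1)|apply: (measurableT_comp h2)]; exact: measurable_tnth.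
Qed.

(** The character of the first coordinate, lifted to the larger torus, makes this an inner integral
    of an integrable function, so Fubini provides measurability. *)
Lemma partial_coef_meas k : cmeas (partial_coef k).
Proof.
have [[h1 h2] _] := cint_torus21 (ip_cintegrable hf (lifted_L2 k)).
have e : partial_coef k = (fun t => cint mu1 (fun x => f (cons_pair (x, t)) * conjc (lifted k (cons_pair (x, t))))).
  by apply/funext => t; apply: eq_cint => x; rewrite lifted_cons.
by rewrite e; split; [exact: (rint_meas h1)|exact: (rint_meas h2)].
Qed.

Lemma partial_coef_bessel (K : seq int) : uniq K ->
  {ae mud, forall t, \sum_(k <- K) sqn (partial_coef k t) <= 2 * pi * nrm2 mu1 (sec t)}.
Proof.
move=> uK; apply: filterS sec_L2_ae => t ht.
apply: (bessel ht) => //; [exact: char1_L2|exact: twopi_gt0|exact: ip_char1].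
Qed.

(** Bessel's inequality on almost every fibre, for the single frequency [k], dominates the squared
    coefficient by the integrable fibre norm. *)
Lemma partial_coef_L2 k : L2f mud (partial_coef k).
Proof.
apply/L2fP; split; first exact: partial_coef_meas.
apply: (rint_ae_le _ _ _ (rintZ (2 * pi) nrm2_sec.1)).
- exact/cmeas_sqn/partial_coef_meas.
- by move=> t; exact: sqn_ge0.
- by move=> t; rewrite mulr_ge0 ?nrm2_ge0// ltW ?twopi_gt0.
by apply: filterS (partial_coef_bessel (K := [:: k]) isT) => t; rewrite big_seq1.
Qed.

Lemma ip_partial_coef k0 (k : d.-tuple int) :
  ip mud (partial_coef k0) (chard k) = ip muS f (chard [tuple of k0 :: k]).
Proof.
have [_ h2] := cint_torus21 (ip_cintegrable hf (chard_L2 [tuple of k0 :: k])).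
have hc : L2f mu1 (char1 k0) by exact: char1_L2.
have [[a1 a2] _] := cint_torus21 (ip_cintegrable hf (chard_L2 [tuple of k0 :: k])).
have [b1 b2] := ip_cintegrable (partial_coef_L2 k0) (chard_L2 k).
have key : {ae mud, forall t, partial_coef k0 t * conjc (chard k t) =
    cint mu1 (fun x => f (cons_pair (x, t)) * conjc (chard [tuple of k0 :: k] (cons_pair (x, t))))}.
  apply: filterS sec_L2_ae => t ht.
  rewrite mulrC /partial_coef /ip -cintZ; last exact: ip_cintegrable.
  by apply: eq_cint => x; rewrite chard_cons rmorphM /sec; ring.
rewrite [RHS]/ip h2 /ip; apply: complex_ext.
  by apply: (ae_eq_Rintegral b1 a1); apply: filterS key => t ->.
by apply: (ae_eq_Rintegral b2 a2); apply: filterS key => t ->.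
Qed.

End ParsevalStep.

(* Quantifying over finite sets of frequencies replaces the sum over Z^d, so
   that in the induction it suffices to split finite sets by first coordinate. *)
Theorem parseval_torus d (f : d.-tuple RM -> R[i]) M : L2f (torus_measure R d) f ->
  (forall K : seq (d.-tuple int), uniq K ->
     \sum_(k <- K) sqn (ip (torus_measure R d) f (chard k)) <= M) ->
  (2 * pi) ^+ d * nrm2 (torus_measure R d) f <= M.
Proof.
elim: d f M => [|d IH] f M hf hM.
  have := hM [:: [tuple]] isT; rewrite big_seq1 expr0 mul1r nrm2E Rintegral_torus0.
  rewrite /ip /cint !Rintegral_torus0 /chard big_ord0 cis0 conjc1 mulr1.
  by case: (f [tuple]).
have p0 := twopi_gt0 R; have pd0 := twopiX_gt0 d.
(* Finite sets of frequencies with distinct first coordinates can be united, so a bound on all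
   finite sums passes to the sum over [s] of the suprema; the induction hypothesis compares each
   norm with its supremum. *)
have main (s : seq int) : uniq s -> forall M',
    (forall K : seq (d.+1.-tuple int), uniq K -> all (fun k => thead k \in s) K ->
      \sum_(k <- K) sqn (ip (torus_measure R d.+1) f (chard k)) <= M') ->
    \sum_(k <- s) (2 * pi) ^+ d * nrm2 (torus_measure R d) (partial_coef f k) <= M'.
  elim: s => [|k0 s IHs] /= us M' hM'.
    by have := hM' [::] isT isT; rewrite !big_nil.
  case/andP: us => ks us; rewrite big_cons -lerBrDl; apply: IHs => // K uK sK.
  rewrite lerBrDl -lerBrDr; apply: IH; first exact: partial_coef_L2.
  move=> K' uK'; rewrite lerBrDr.
  have := hM' ([seq [tuple of k0 :: k] | k : d.-tuple int <- K'] ++ K).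
  rewrite big_cat big_map /=.
  under eq_bigr do rewrite -ip_partial_coef//.
  apply.
    rewrite cat_uniq uK andbT map_inj_uniq ?uK'/=; last first.
      by move=> x y /(congr1 val)/= [/val_inj].
    apply/hasPn => k kK; apply/mapP => -[k' _ kE].
    by move/allP : sK => /(_ _ kK); rewrite kE theadE (negbTE ks).
  rewrite all_cat; apply/andP; split.
    by apply/allP => k /mapP[k' _ ->]; rewrite theadE mem_head.
  by apply: sub_all sK => k; rewrite in_cons => ->; rewrite orbT.
have [rn ->] := nrm2_sec hf.
pose h (t : d.-tuple RM) : R := 2 * pi * nrm2 (circle_measure R) (fun x => f (cons_pair (x, t))).
pose H N (t : d.-tuple RM) : R := \sum_(k <- symm N) sqn (partial_coef f k t).
have hi : rint (torus_measure R d) h by exact: rintZ.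
have hk k : rint (torus_measure R d) (fun t => sqn (partial_coef f k t)).
  by have /L2fP[] := partial_coef_L2 hf k.
have HN N : (2 * pi) ^+ d * \int[torus_measure R d]_t H N t <= M.
  have -> : \int[torus_measure R d]_t H N t =
      \sum_(k <- symm N) nrm2 (torus_measure R d) (partial_coef f k).
    rewrite /H; elim: (symm N) => [|k s IHs].
      by under eq_Rintegral do rewrite big_nil; rewrite big_nil Rintegral_cst// mul0r.
    under eq_Rintegral do rewrite big_cons.
    have hs : rint (torus_measure R d) (fun t => \sum_(j <- s) sqn (partial_coef f j t)).
      elim: s {IHs} => [|j s IHs]; first by under eq_fun do rewrite big_nil; exact: rint0.
      by under eq_fun do rewrite big_cons; apply: rintD.
    rewrite (RintegralD measurableT (hk k) hs) big_cons.
    by congr (_ + _); [rewrite nrm2E|exact: IHs].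
  rewrite mulr_sumr; apply: main (uniq_symm N) _ _ => K uK _; exact: hM.
have mH N : measurable_fun setT (H N).
  by apply: measurable_sum => k; exact: rint_meas (hk k).
pose F N (t : d.-tuple RM) := (H N t)%:E.
have c1 N : measurable_fun setT (F N) by exact/measurable_EFinP.
(* On almost every fibre Bessel keeps [H N] below [h] and [parseval1] makes it converge to [h], so
   [h] is both the limit and the dominating function. *)
have c2 : {ae torus_measure R d, forall t, setT t -> F N t @[N --> \oo] --> (h t)%:E}.
  apply: filterS2 (sec_L2_ae hf) (ae_foralln (fun N => partial_coef_bessel hf (uniq_symm N))).
  move=> t ht hB _; apply: cvg_EFin; first by near=> N.
  apply/cvgrPdist_le => e e0.
  have := parseval1 ht e0; apply: filterS => N hN.
  rewrite /= ger0_norm; last by rewrite subr_ge0; exact: hB.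
  by rewrite lerBlDl; exact: hN.
have c4 : {ae torus_measure R d, forall t N, setT t -> (`|F N t| <= (h t)%:E)%E}.
  apply: filterS (ae_foralln (fun N => partial_coef_bessel hf (uniq_symm N))).
  move=> t hB N _; rewrite /= lee_fin ger0_norm; last by apply: sumr_ge0 => k _; exact: sqn_ge0.
  exact: hB.
have mh : measurable_fun setT (fun t => (h t)%:E) by apply/measurable_EFinP; exact: rint_meas hi.
have [_ _] := dominated_convergence measurableT c1 mh c2 hi c4.
rewrite -[X in _ --> X]fineK; last exact: (integrable_fin_num _ hi).
move=> /fine_cvg hcv.
have : (2 * pi) ^+ d * \int[torus_measure R d]_t h t <= M.
  rewrite mulrC -ler_pdivlMr//; apply/ler_addgt0Pr => e e0.
  move/cvgrPdist_le : hcv => /(_ _ e0)[N _ /(_ N (leqnn N))] /= hN.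
  have := HN N; rewrite mulrC -ler_pdivlMr// => h2.
  rewrite -lerBlDr (le_trans _ h2)// lerBlDr -lerBlDl.
  by apply: le_trans hN; exact: ler_norm.
rewrite /h RintegralZl// mulrA -exprSr; apply.
Unshelve. all: by end_near. Qed.

End TorusParseval.

(** * Test functions and distributional derivatives *)

Section ContinuousOnTorus.
Variable R : realType.
Local Notation RM := (measurableTypeR R).
Variable d : nat.
Local Notation point := (d.-tuple RM).

(** Rounding coordinates down to multiples of 1/(N+1) links the topology of ['rV[R]_d] to the
    product sigma-algebra on tuples: a continuous function is the pointwise limit of its values on
    these countable grids. *)
Definition grid (N : nat) (k : d.-tuple int) : 'rV[R]_d := \row_j ((tnth k j)%:~R / N.+1%:R).
Definition grid_index (N : nat) (x : point) : d.-tuple int :=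
  [tuple Num.floor ((tnth x j : R) * N.+1%:R) | j < d].

Lemma grid_index_measurable N (k : d.-tuple int) : measurable [set x : point | grid_index N x = k].
Proof.
have -> : [set x : point | grid_index N x = k] =
  \big[setI/setT]_(j < d) ((fun x : point => tnth x j) @^-1`
     (`[(tnth k j)%:~R / N.+1%:R, ((tnth k j)%:~R + 1) / N.+1%:R[%classic : set R)).
  rewrite eqEsubset; split=> x /=.
    move=> <-; rewrite -bigcap_seq => j _ /=; rewrite in_itv/= tnth_mktuple.
    rewrite ler_pdivrMr// ltr_pdivlMr// floor_le_tmp/=.
    by rewrite -[X in _ + X]/(1%:~R) -intrD lt_succ_floor.
  rewrite -bigcap_seq => h; apply: eq_from_tnth => j; rewrite tnth_mktuple.
  have := h j (mem_index_enum _); rewrite /= in_itv/= ler_pdivrMr// ltr_pdivlMr// => h1.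
  by apply: floor_def; rewrite intrD.
apply: bigsetI_measurable => j _.
rewrite -[X in measurable X]setTI.
by apply: measurable_tnth => //; exact: measurable_itv.
Qed.

Lemma grid_step_measurable N (h : 'rV[R]_d -> R) :
  measurable_fun setT (fun x : point => h (grid N (grid_index N x))).
Proof.
move=> _ Y mY; rewrite setTI.
(* The indices form a countable type, so the preimage is a countable union of measurable cells;
   codes of no tuple contribute the empty set. *)
rewrite (_ : _ @^-1` _ = \bigcup_i (if unpickle i is Some k then
   if h (grid N k) \in Y then [set x : point | grid_index N x = k] else set0 else set0)).
  apply: bigcupT_measurable => i; case: unpickle => // k; case: ifP => // _.
  exact: grid_index_measurable.
rewrite eqEsubset; split=> x /=.
  move=> hY; exists (pickle (grid_index N x)) => //.
  by rewrite pickleK mem_set.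
move=> [i _]; case: unpickle => // k; case: ifP => // /set_mem hk /= ->.
exact: hk.
Qed.

Lemma grid_approx N (x : point) j :
  `|row_of_point x ord0 j - grid N (grid_index N x) ord0 j| < N.+1%:R^-1.
Proof.
rewrite !mxE tnth_mktuple; set y : R := tnth x j.
have N0 : 0 < N.+1%:R :> R by [].
have h1 := floor_le_tmp (y * N.+1%:R); have h2 := lt_succ_floor (y * N.+1%:R).
rewrite -(ltr_pM2r N0) mulVf ?lt0r_neq0// -[X in _ * X](ger0_norm (ltW N0)) -normrM mulrBl divfK ?lt0r_neq0//.
by move: h1 h2; rewrite intrD ltr_norml => *; apply/andP; split; lra.
Qed.

Lemma grid_cvg (x : point) : grid N (grid_index N x) @[N --> \oo] --> (row_of_point x : 'rV[R]_d).
Proof.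
apply/cvg_ballP => e e0.
have := @near_infty_natSinv_lt R (PosNum e0).
apply: filterS => N hN; split => // i j; rewrite (ord1 i).
by rewrite /ball /=; apply: lt_trans hN; exact: grid_approx.
Qed.

Lemma continuous_row_measurable (h : 'rV[R]_d -> R) : continuous h ->
  measurable_fun setT (fun x : point => h (row_of_point x)).
Proof.
move=> ch; apply: (@measurable_fun_cvg _ _ _ setT (fun N x => h (grid N (grid_index N x)))).
  by move=> N; exact: grid_step_measurable.
have H x := cvg_comp _ _ (@grid_cvg x) (@ch (row_of_point x)).
by move=> x _; exact: H.
Qed.

Definition cube (x : point) := forall j, 0 <= (tnth x j : R) <= 2 * pi.

Lemma continuous_row_bounded (h : 'rV[R]_d -> R) : continuous h ->
  exists M, forall x : point, cube x -> `|h (row_of_point x)| <= M.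
Proof.
move=> ch.
have cK := @rV_compact R d (fun=> `[0%R, 2 * pi]%classic) (fun i => @segment_compact R 0 (2 * pi)).
have /compact_bounded[M [_ hM]] := continuous_compact (@continuous_subspaceT _ _ _ _ ch) cK.
exists (`|M| + 1) => x cx.
apply: hM; first by rewrite (le_lt_trans (ler_norm M))// ltrDl.
exists (row_of_point x) => //= j.
by rewrite mxE in_itv/=; exact: cx.
Qed.

End ContinuousOnTorus.

Section BoundedOnCube.
Variable R : realType.
Local Notation RM := (measurableTypeR R).

(** The measure lives on all of R^d, while compactness bounds continuous functions only on the cube.
    Tonelli reduces the transfer to one variable, where the complement of the period is null. *)
Lemma ge0_integral_cube_le d (f : d.-tuple RM -> \bar R) M : measurable_fun setT f ->
  (forall x, 0 <= f x)%E -> 0 <= M -> (forall x, cube x -> (f x <= M%:E)%E) ->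
  (\int[torus_measure R d]_x f x <= (M * (2 * pi) ^+ d)%:E)%E.
Proof.
elim: d f M => [|d IH] f M mf f0 M0 fM.
  rewrite expr0 mulr1.
  have -> : f = cst (f [tuple]) by apply/funext => x; congr f; exact: tuple0.
  rewrite integral_cst//= diracT mule1; apply: fM.
  by move=> [].
rewrite ge0_integral_torusS// exprS mulrA.
have mfc : measurable_fun setT (f \o @cons_pair R d).
  exact: (measurableT_comp mf (@meas_consp R d)).
apply: IH.
- have hG := @measurable_fun_fubini_tonelli_G _ _ _ _ _ (circle_measure R) _ mfc.
  by apply: hG => z; exact: f0.
- by move=> t; exact: integral_ge0.
- by rewrite mulr_ge0// ltW ?twopi_gt0.
move=> t ct.
apply: (@le_trans _ _ (\int[circle_measure R]_x (M%:E))%E).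
  apply: ae_ge0_le_integral => //.
  - exact: meas_sec2.
  - apply: ae_per => x /andP[x0 x2] _; apply: fM => j.
    case: (unliftP ord0 j) => [j' ->|->]; first by rewrite tnthS.
    by rewrite tnth0 !ltW.
rewrite integral_cst// EFinM lee_wpmul2l// ?lee_fin//.
by rewrite -circle_measureT.
Qed.

Lemma rint_cube d (F : d.-tuple RM -> R) M : measurable_fun setT F ->
  (forall x, cube x -> `|F x| <= M) -> rint (torus_measure R d) F.
Proof.
move=> mF FM; apply/integrableP; split; first exact/measurable_EFinP.
have mF' : measurable_fun setT (fun x => `|(F x)%:E|%E).
  by apply: measurableT_comp => //; exact/measurable_EFinP.
apply: (le_lt_trans (@ge0_integral_cube_le d _ `|M| mF' _ _ _)) => //.
  by move=> x cx; rewrite /= lee_fin (le_trans (FM x cx))// ler_norm.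
by rewrite ltry.
Qed.

End BoundedOnCube.

(** * Vanishing integrals of partial derivatives of periodic functions *)

Section PartialIntegration.
Variable R : realType.
Local Notation RM := (measurableTypeR R).

Definition upd d (j : 'I_d) (s : R) (x : d.-tuple RM) : d.-tuple RM :=
  [tuple (if i == j then (s : RM) else tnth x i) | i < d].

Lemma upd_cons0 d (s x : R) (t : d.-tuple RM) :
  upd ord0 s (cons_pair ((x : RM), t)) = cons_pair ((s : RM), t).
Proof.
apply: eq_from_tnth => i; rewrite tnth_mktuple.
by case: (unliftP ord0 i) => [i' ->|->]; rewrite ?eqxx ?tnth0// !tnthS.
Qed.
Lemma upd_consS d (j : 'I_d) (s x : R) (t : d.-tuple RM) :
  upd (lift ord0 j) s (cons_pair ((x : RM), t)) = cons_pair ((x : RM), upd j s t).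
Proof.
apply: eq_from_tnth => i; rewrite tnth_mktuple.
case: (unliftP ord0 i) => [i' ->|->]; rewrite ?tnth0// !tnthS tnth_mktuple.
by rewrite (inj_eq lift_inj).
Qed.

(** Fubini either peels off the first coordinate and recurses, or, when [j] is the first coordinate,
    integrates it innermost, where the fundamental theorem of calculus and [pF] give 0. *)
Lemma Rintegral_partial_eq0 d (j : 'I_d) (F DF : d.-tuple RM -> R) M :
  measurable_fun setT DF -> (forall x, cube x -> `|DF x| <= M) ->
  (forall t (s : R), is_derive s (1 : R) (fun s : R => F (upd j s t)) (DF (upd j s t))) ->
  (forall t, continuous (fun s : R => DF (upd j s t))) ->
  (forall t, F (upd j (2 * pi) t) = F (upd j 0 t)) ->
  \int[torus_measure R d]_x DF x = 0.
Proof.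
elim: d j F DF M => [[]//|d IH] j F DF M mDF bDF dF cDF pF.
have hi := rint_cube mDF bDF.
case: (unliftP ord0 j) => [j' jE|jE]; rewrite {}jE in dF cDF pF.
  have [_ ->] := torus_Fubini12 hi.
  have := @ae_eq_Rintegral _ _ _ (circle_measure R) (fun x => \int[torus_measure R d]_t DF (cons_pair (x, t))) (fun=> 0).
  rewrite Rintegral_cst// mul0r; apply; [exact: (torus_Fubini12 hi).1|exact: rint0|].
  apply: ae_per => x /andP[x0 x2].
  apply: (IH j' (fun t => F (cons_pair (x, t))) _ M).
  - exact: meas_sec1.
  - move=> t ct; apply: bDF => i; case: (unliftP ord0 i) => [i' ->|->].
      by rewrite tnthS; exact: ct.
    by rewrite tnth0 !ltW.
  - move=> t s; have := dF (cons_pair (x, t)) s; rewrite upd_consS.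
    by under eq_fun do rewrite upd_consS.
  - by move=> t; have := cDF (cons_pair (x, t)); under eq_fun do rewrite upd_consS.
  - by move=> t; have := pF (cons_pair (x, t)); rewrite !upd_consS.
have [_ ->] := torus_Fubini21 hi.
under eq_Rintegral => t _.
  have dG (s : R) : is_derive s (1 : R) (fun s : R => F (cons_pair ((s : RM), t))) (DF (cons_pair ((s : RM), t))).
    have := dF (cons_pair ((0 : RM), t)) s; rewrite upd_cons0.
    by under eq_fun do rewrite upd_cons0.
  have cG : continuous (fun s : R => DF (cons_pair ((s : RM), t))).
    by have := cDF (cons_pair ((0 : RM), t)); under eq_fun do rewrite upd_cons0.
  rewrite (circle_FTC dG cG).
  have := pF (cons_pair ((0 : RM), t)); rewrite !upd_cons0 => ->.
  rewrite subrr; over.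
by rewrite Rintegral_cst// mul0r.
Qed.

Lemma row_upd d (j : 'I_d) (s : R) (x : d.-tuple RM) :
  row_of_point (upd j s x) = s *: 'e_j + row_of_point (upd j 0 x).
Proof.
apply/rowP => i; rewrite !mxE !tnth_mktuple eqxx /=.
by case: eqVneq => _; rewrite ?mulr1 ?addr0// mulr0 add0r.
Qed.

Lemma is_derive_line (V : normedModType R) (f : V -> R) (a v : V) (s : R) :
  derivable f (s *: v + a) v ->
  is_derive s (1 : R) (fun h : R => f (h *: v + a)) ('D_v f (s *: v + a)).
Proof.
move=> df.
have e : (fun h : R => h^-1 *: (((fun h : R => f (h *: v + a)) \o shift s) (h *: (1 : R)) - f (s *: v + a))) =
    (fun h : R => h^-1 *: ((f \o shift (s *: v + a)) (h *: v) - f (s *: v + a))).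
  apply/funext => h /=; congr (_ *: (f _ - _)).
  by rewrite [h *: 1]mulr1 scalerDl addrA.
by apply: DeriveDef; rewrite /derivable /derive e.
Qed.

Lemma Rintegral_deriv_eq0 d (j : 'I_d) (h : 'rV[R]_d -> R) :
  continuous h -> (forall x, derivable h x 'e_j) -> continuous (fun x => 'D_('e_j) h x) ->
  (forall x, h (x + (2 * pi) *: 'e_j) = h x) ->
  \int[torus_measure R d]_x 'D_('e_j) h (row_of_point x) = 0.
Proof.
move=> ch dh cdh ph.
have [M hM] := continuous_row_bounded cdh.
apply: (@Rintegral_partial_eq0 _ j (fun x => h (row_of_point x))
  (fun x => 'D_('e_j) h (row_of_point x)) M).
- exact: (continuous_row_measurable cdh).
- by [].
- move=> t s; have := is_derive_line (dh (s *: 'e_j + row_of_point (upd j 0 t))).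
  rewrite -row_upd => H.
  by under eq_fun do rewrite row_upd.
- move=> t.
  rewrite (_ : (fun s : R => _) = (fun s : R => 'D_('e_j) h (s *: 'e_j + row_of_point (upd j 0 t)))); last first.
    by apply/funext => s; rewrite row_upd.
  have H : continuous (fun s : R => s *: 'e_j + row_of_point (upd j 0 t) : 'rV[R]_d).
    by move=> u; apply: cvgD; [apply: cvgZr_tmp; exact: cvg_id|exact: cvg_cst].
  by move=> s; exact: (continuous_comp (@H s) (@cdh _)).
- by move=> t; rewrite row_upd addrC ph -[in RHS](add0r (row_of_point _)) -(scale0r 'e_j) -row_upd.
Qed.

End PartialIntegration.

(** * Characters as test functions *)

Section Waves.
Variables (R : realType) (d : nat).
Local Notation RM := (measurableTypeR R).
Local Notation mud := (torus_measure R d).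
Implicit Types (k : d.-tuple int) (z : R[i]).

Definition kdot k (v : 'rV[R]_d) : R := \sum_(j < d) (tnth k j)%:~R * v ord0 j.

Lemma kdotD k v w : kdot k (v + w) = kdot k v + kdot k w.
Proof. by rewrite /kdot -big_split; apply: eq_bigr => j _; rewrite mxE mulrDr. Qed.
Lemma kdotZ k s v : kdot k (s *: v) = s * kdot k v.
Proof. by rewrite /kdot mulr_sumr; apply: eq_bigr => j _; rewrite mxE mulrCA. Qed.
Lemma kdot_e k j : kdot k 'e_j = (tnth k j)%:~R.
Proof.
rewrite /kdot (bigD1 j)//= big1 ?addr0 => [|i ij]; rewrite !mxE !eqxx /= ?mulr1//.
by rewrite (negbTE ij) mulr0.
Qed.

Lemma chardE k (x : d.-tuple RM) : chard k x = cis (kdot k (row_of_point x)).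
Proof. by congr cis; apply: eq_bigr => j _; rewrite mxE. Qed.

Lemma continuous_kdot k : continuous (kdot k).
Proof.
move=> v; rewrite /kdot.
have H (s : seq 'I_d) : {for v, continuous (fun v : 'rV[R]_d => \sum_(j <- s) (tnth k j)%:~R * v ord0 j)}.
  elim: s => [|j s IH].
    have -> : (fun v : 'rV[R]_d => \sum_(j <- [::]) (tnth k j)%:~R * v ord0 j) = fun=> 0.
      by apply/funext => w; rewrite big_nil.
    exact: (@cst_continuous _ _ (0 : R) v).
  have -> : (fun v : 'rV[R]_d => \sum_(j <- j :: s) (tnth k j)%:~R * v ord0 j) =
      (fun v : 'rV[R]_d => (tnth k j)%:~R * v ord0 j + \sum_(j <- s) (tnth k j)%:~R * v ord0 j).
    by apply/funext => w; rewrite big_cons.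
  apply: continuousD; last exact: IH.
  apply: (@continuousM _ _ (fun=> (tnth k j)%:~R) (fun w : 'rV[R]_d => w ord0 j)).
    exact: cst_continuous.
  exact: coord_continuous.
exact: H.
Qed.

(** Smoothness is defined for real functions. This family is closed under partial derivatives, which
    multiply [z] by i k_j, and it contains the real (z = 1) and imaginary (z = i) parts of the
    conjugate character. *)
Definition wave z k (v : 'rV[R]_d) : R := Rec (z * cis (kdot k v)).

Lemma continuous_wave z k : continuous (wave z k).
Proof.
move=> v.
have -> : wave z k = (fun v => Rec z * cos (kdot k v) - Imc z * sin (kdot k v)).
  by apply/funext => w; rewrite /wave ReM.
have hc := continuous_comp (@continuous_kdot k v) (@continuous_cos R _).
have hs := continuous_comp (@continuous_kdot k v) (@continuous_sin R _).
apply: (@continuousB _ _ _ (fun v => Rec z * cos (kdot k v)) (fun v => Imc z * sin (kdot k v))).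
  by apply: (@continuousM _ _ (fun=> Rec z)) => //; exact: cst_continuous.
by apply: (@continuousM _ _ (fun=> Imc z)) => //; exact: cst_continuous.
Qed.

Lemma is_derive_of_line (V : normedModType R) (f : V -> R) (a v : V) (l : R) :
  is_derive (0 : R) (1 : R) (fun h : R => f (h *: v + a)) l -> is_derive a v f l.
Proof.
move=> [df vf].
have e : (fun h : R => h^-1 *: (((fun h : R => f (h *: v + a)) \o shift 0) (h *: (1 : R)) - f (0 *: v + a))) =
    (fun h : R => h^-1 *: ((f \o shift a) (h *: v) - f a)).
  apply/funext => h /=; congr (_ *: (f _ - f _)).
    by rewrite [h *: 1]mulr1 addr0.
  by rewrite scale0r add0r.
by move: df vf; rewrite /derivable /derive e => df vf; apply: DeriveDef.
Qed.

Lemma is_derive_wave z k j (v : 'rV[R]_d) :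
  is_derive v 'e_j (wave z k) (wave ((0 +i* (tnth k j)%:~R) * z) k v).
Proof.
apply: is_derive_of_line; set w := z * cis (kdot k v).
set c : R := (tnth k j)%:~R.
have -> : (fun h : R => wave z k (h *: 'e_j + v)) =
    (fun h : R => Rec w * cos (c * h) - Imc w * sin (c * h)).
  apply/funext => h; rewrite /wave kdotD kdotZ kdot_e -/c cisD mulrCA -/w mulrC ReM /=.
  by rewrite [h * c]mulrC.
have h1 := is_deriveZ (Rec w) (is_derive_cosZ c 0).
have h2 := is_deriveZ (Imc w) (is_derive_sinZ c 0).
apply: is_derive_eq (is_deriveB h1 h2) _.
rewrite /wave -mulrA -/w mulr0 sin0 cos0 !ReImE /GRing.scale /=; ring.
Qed.

Lemma iterated_partial_wave z k s :
  iterated_partial s (wave z k) = wave ((\prod_(j <- s) (0 +i* (tnth k j)%:~R)) * z) k.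
Proof.
elim: s => [|j s IH]; first by rewrite big_nil mul1r.
rewrite /= -/(iterated_partial s (wave z k)) IH big_cons -mulrA.
by apply/funext => v; have [_ ->] := is_derive_wave (\prod_(j0 <- s) (0 +i* (tnth k j0)%:~R) * z) k j v.
Qed.

Lemma smooth_wave z k : smooth (wave z k).
Proof.
move=> s; rewrite iterated_partial_wave; split; first exact: continuous_wave.
by move=> j x; have [] := is_derive_wave (\prod_(j0 <- s) (0 +i* (tnth k j0)%:~R) * z) k j x.
Qed.

Definition conj_char k (v : 'rV[R]_d) : R[i] := conjc (cis (kdot k v)).

Lemma conj_char_Re k : (fun v => Rec (conj_char k v)) = wave 1 k.
Proof. by apply/funext => v; rewrite /conj_char /wave mul1r ReJ. Qed.
Lemma conj_char_Im k : (fun v => Imc (conj_char k v)) = wave (0 +i* 1) k.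
Proof. by apply/funext => v; rewrite /conj_char /wave ImJ ReM /=; ring. Qed.

Lemma conj_char_test k : torus_test_function (conj_char k).
Proof.
split.
- by rewrite conj_char_Re; exact: smooth_wave.
- by rewrite conj_char_Im; exact: smooth_wave.
move=> j x; rewrite /conj_char kdotD kdotZ kdot_e cisD mulrC.
by rewrite [2 * pi * _]mulrC cis_int2pi mul1r.
Qed.

(* (i k)^alpha *)
Definition symbol (alpha : 'I_d -> nat) k : R[i] :=
  \prod_(j <- multi_index_seq alpha) (0 +i* (tnth k j)%:~R).

Lemma classical_derivative_conj_char alpha k x :
  classical_derivative alpha (conj_char k) x = conjc (symbol alpha k) * conj_char k x.
Proof.
rewrite /classical_derivative conj_char_Re conj_char_Im !iterated_partial_wave.
rewrite /wave -/(symbol alpha k) /conj_char; apply: complex_ext; rewrite !ReImE /=; ring.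
Qed.

Definition freq_weight (alpha : 'I_d -> nat) k : R :=
  \prod_(j < d) ((tnth k j)%:~R ^+ 2) ^+ alpha j.

Lemma sqn_prod (I : Type) (s : seq I) (F : I -> R[i]) :
  sqn (\prod_(i <- s) F i) = \prod_(i <- s) sqn (F i).
Proof. by elim: s => [|i s IH]; rewrite ?big_nil ?sqn1// !big_cons sqnM IH. Qed.

Lemma big_multi_index (S : comNzRingType) (alpha : 'I_d -> nat) (F : 'I_d -> S) :
  \prod_(j <- multi_index_seq alpha) F j = \prod_(j < d) F j ^+ alpha j.
Proof.
rewrite /multi_index_seq big_flatten big_map -big_enum /=.
by rewrite !big_enum /=; apply: eq_bigr => j _; rewrite big_nseq iter_mulr_1.
Qed.

Lemma sqn_symbol alpha k : sqn (symbol alpha k) = freq_weight alpha k.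
Proof.
rewrite /symbol sqn_prod big_multi_index; apply: eq_bigr => j _.
by congr (_ ^+ _); rewrite /sqn /=; ring.
Qed.

(** The conjugate character is itself a test function and an eigenfunction of the derivative;
    comparing squared moduli removes the sign (-1)^|alpha| and the phase of (i k)^alpha. *)
Lemma ip_distributional_derivative alpha (f g : d.-tuple RM -> R[i]) k : L2f mud f ->
  distributional_derivative alpha f g ->
  sqn (ip mud g (chard k)) = freq_weight alpha k * sqn (ip mud f (chard k)).
Proof.
move=> hf hfg; have := hfg _ (conj_char_test k).
have -> : complex_integral (fun x => g x * conj_char k (row_of_point x)) = ip mud g (chard k).
  by apply: eq_cint => x; rewrite /conj_char -chardE.
have -> : complex_integral (fun x => f x * classical_derivative alpha (conj_char k) (row_of_point x)) =
    conjc (symbol alpha k) * ip mud f (chard k).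
  rewrite /ip -cintZ; last by apply: ip_cintegrable => //; exact: chard_L2.
  apply: eq_cint => x; rewrite classical_derivative_conj_char /conj_char -chardE; ring.
move=> /(congr1 sqn); rewrite !sqnM sqnJ sqn_symbol sqnX.
by rewrite (_ : sqn (-1) = 1) ?expr1n ?mul1r// sqnN sqn1.
Qed.

End Waves.

(** * Weak derivatives of trigonometric polynomials *)

Section WeakDerivatives.
Variables (R : realType) (d : nat).
Local Notation RM := (measurableTypeR R).
Local Notation mud := (torus_measure R d).
Implicit Types (k : d.-tuple int) (z : R[i]) (psi : 'rV[R]_d -> R).

Definition periodic_row psi := forall (j : 'I_d) x, psi (x + (2 * pi) *: 'e_j) = psi x.

Lemma periodic_iterated_partial s psi : periodic_row psi -> periodic_row (iterated_partial s psi).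
Proof.
move=> pp; elim: s => [|j s IH] //= i x.
rewrite -/(iterated_partial s psi); set f := iterated_partial s psi in IH *.
have e : (fun h : R => h^-1 *: ((f \o shift (x + (2 * pi) *: 'e_i)) (h *: 'e_j) - f (x + (2 * pi) *: 'e_i))) =
    (fun h : R => h^-1 *: ((f \o shift x) (h *: 'e_j) - f x)).
  by apply/funext => h /=; rewrite addrA !IH.
by rewrite /derive e.
Qed.

Lemma continuous_L2_row psi1 psi2 : continuous psi1 -> continuous psi2 ->
  L2f mud (fun x => psi1 (row_of_point x) +i* psi2 (row_of_point x)).
Proof.
move=> c1 c2; have m1 := continuous_row_measurable c1; have m2 := continuous_row_measurable c2.
have mm : cmeas (fun x : d.-tuple RM => psi1 (row_of_point x) +i* psi2 (row_of_point x)) by split.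
apply/L2fP; split => //.
have [M1 h1] := continuous_row_bounded c1; have [M2 h2] := continuous_row_bounded c2.
apply: (@rint_cube _ _ _ (M1 ^+ 2 + M2 ^+ 2)); first exact: cmeas_sqn.
move=> x cx; rewrite ger0_norm ?sqn_ge0// lerD// -real_normK ?num_real// lerXn2r ?nnegrE//=.
- exact: le_trans (h1 _ cx).
- exact: h1.
- exact: le_trans (h2 _ cx).
- exact: h2.
Qed.

Definition wave_coef k psi : R[i] :=
  cint mud (fun x => chard k x * (psi (row_of_point x))%:C).

Lemma real_row_L2 psi : continuous psi -> L2f mud (fun x => (psi (row_of_point x))%:C).
Proof.
move=> c; have c0 : continuous (fun _ : 'rV[R]_d => 0 : R) by exact: cst_continuous.
exact: (continuous_L2_row c c0).
Qed.

Lemma wave_mul_rint z k psi : continuous psi ->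
  rint mud (fun x => wave z k (row_of_point x) * psi (row_of_point x)).
Proof.
move=> c; have [h _] := cintegrableZ z (L2f_prod (chard_L2 R k) (real_row_L2 c)).
apply: rint_eq h => x; rewrite mulrA ReM /= mulr0 subr0.
by rewrite /wave chardE.
Qed.

(** Integration by parts: the derivative of [wave z k * psi] integrates to 0 by periodicity. This is
    done for the real functions [wave z k] with every [z], and the complex identity is recovered
    from them. *)
Lemma wave_coef_partial k j psi : continuous psi -> (forall x, derivable psi x 'e_j) ->
  continuous (fun x => 'D_('e_j) psi x) -> periodic_row psi ->
  wave_coef k (fun x => 'D_('e_j) psi x) = - (0 +i* (tnth k j)%:~R) * wave_coef k psi.
Proof.
move=> c dpsi cd pp; set w := 0 +i* (tnth k j)%:~R.
have key z : \int[mud]_x (wave z k (row_of_point x) * 'D_('e_j) psi (row_of_point x)) =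
    - \int[mud]_x (wave (w * z) k (row_of_point x) * psi (row_of_point x)).
  apply/eqP; rewrite -addr_eq0 -RintegralD//; [|exact: (wave_mul_rint z k cd)|exact: (wave_mul_rint (w * z) k c)].
  have dW v := is_derive_wave z k j v.
  have dh v : is_derive v 'e_j (wave z k * psi)
      (wave z k v *: 'D_('e_j) psi v + psi v *: wave (w * z) k v).
    exact: is_deriveM (dW v) (derivableP (dpsi v)).
  have ch : continuous (wave z k * psi).
    by move=> v; exact: (continuousM (@continuous_wave R d z k v) (@c v)).
  have cdh : continuous (fun v => 'D_('e_j) (wave z k * psi) v).
    rewrite (_ : (fun v => 'D_('e_j) (wave z k * psi) v) =
      (wave z k * (fun v => 'D_('e_j) psi v) + psi * wave (w * z) k)); last first.
      by apply/funext => v; have [_ ->] := dh v.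
    move=> v; apply: continuousD.
      exact: (continuousM (@continuous_wave R d z k v) (@cd v)).
    exact: (continuousM (@c v) (@continuous_wave R d (w * z) k v)).
  have ph : forall x, (wave z k * psi) (x + (2 * pi) *: 'e_j) = (wave z k * psi) x.
    move=> x; rewrite /GRing.mul /= pp /wave kdotD kdotZ kdot_e cisD.
    by rewrite [2 * pi * _]mulrC cis_int2pi mulr1.
  rewrite -(Rintegral_deriv_eq0 ch (fun x => @ex_derive _ _ _ _ _ _ _ (dh x)) cdh ph).
  apply/eqP; apply: eq_Rintegral => x _.
  by have [_ ->] := dh (row_of_point x); rewrite /GRing.scale /= [psi _ * _]mulrC.
have jE z' phi : continuous phi ->
    Rec (z' * wave_coef k phi) = \int[mud]_x (wave z' k (row_of_point x) * phi (row_of_point x)).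
  move=> cphi; rewrite /wave_coef -cintZ; last exact: L2f_prod (chard_L2 R k) (real_row_L2 cphi).
  rewrite /cint /=; apply: eq_Rintegral => x _.
  by rewrite mulrA ReM /= mulr0 subr0 /wave chardE.
(* The choice z = 1 compares real parts and z = -i compares imaginary parts. *)
have fin (a b : R[i]) : (forall z, Rec (z * a) = - Rec (w * z * b)) -> a = - w * b.
  move=> h; have := h (1 +i* 0); have := h (0 +i* (-1)).
  move=> h1 h2; apply: complex_ext; [move: h2|move: h1]; rewrite !ReImE /=; lra.
by apply: fin => z; rewrite !jE// key.
Qed.

Lemma wave_coef_iterated_partial k s psi : smooth psi -> periodic_row psi ->
  wave_coef k (iterated_partial s psi) =
  (\prod_(j <- s) - (0 +i* (tnth k j)%:~R)) * wave_coef k psi.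
Proof.
move=> sp pp; elim: s => [|j s IH]; first by rewrite big_nil mul1r.
have [c1 d1] := sp s; have [c2 _] := sp (j :: s).
rewrite big_cons -mulrA -IH -wave_coef_partial//.
exact: periodic_iterated_partial.
Qed.

Lemma size_multi_index (alpha : 'I_d -> nat) :
  size (multi_index_seq alpha) = (\sum_j alpha j)%N.
Proof.
rewrite /multi_index_seq size_flatten /shape -map_comp sumnE big_map big_enum /=.
by apply: eq_bigr => j _; rewrite /= size_nseq.
Qed.

Lemma prodN (s : seq 'I_d) (F : 'I_d -> R[i]) :
  \prod_(j <- s) - F j = (-1) ^+ size s * \prod_(j <- s) F j.
Proof.
elim: s => [|j s IH]; first by rewrite !big_nil mulr1.
by rewrite !big_cons IH /= exprS; ring.
Qed.

Lemma test_function_parts (phi : 'rV[R]_d -> R[i]) : torus_test_function phi ->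
  [/\ smooth (fun x => Rec (phi x)), smooth (fun x => Imc (phi x)),
    periodic_row (fun x => Rec (phi x)) & periodic_row (fun x => Imc (phi x))].
Proof. by case=> h1 h2 h3; split => // j x; rewrite h3. Qed.

Lemma cint_chard_parts k (p1 p2 : 'rV[R]_d -> R) : continuous p1 -> continuous p2 ->
  cint mud (fun x => chard k x * (p1 (row_of_point x) +i* p2 (row_of_point x))) =
  wave_coef k p1 + (0 +i* 1) * wave_coef k p2.
Proof.
move=> c1 c2.
have h1 := L2f_prod (chard_L2 R k) (real_row_L2 c1).
have h2 := L2f_prod (chard_L2 R k) (real_row_L2 c2).
rewrite /wave_coef -cintZ// -cintD//; last exact: cintegrableZ.
apply: eq_cint => x; rewrite mulrCA -mulrDr; congr (_ * _).
by apply: complex_ext; rewrite !ReImE /=; ring.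
Qed.

Lemma distributional_derivative_trig (K : seq (d.-tuple int)) (a : d.-tuple int -> R[i]) alpha :
  distributional_derivative alpha (fun x => \sum_(k <- K) a k * chard k x)
    (fun x => \sum_(k <- K) a k * (symbol R alpha k * chard k x)).
Proof.
move=> phi tphi; have [s1 s2 p1 p2] := test_function_parts tphi.
have [c1 _] := s1 [::]; have [c2 _] := s2 [::].
have [d1 _] := s1 (multi_index_seq alpha); have [d2 _] := s2 (multi_index_seq alpha).
have lphi := continuous_L2_row c1 c2; have ldphi := continuous_L2_row d1 d2.
have phiE x : phi x = Rec (phi x) +i* Imc (phi x) by case: (phi x).
have hphi k : cintegrable mud (fun x => chard k x * phi (row_of_point x)).
  have := L2f_prod (chard_L2 R k) lphi.
  by under eq_fun do rewrite -phiE.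
have hdphi k : cintegrable mud (fun x => chard k x * classical_derivative alpha phi (row_of_point x)).
  exact: L2f_prod (chard_L2 R k) ldphi.
have key k : cint mud (fun x => chard k x * classical_derivative alpha phi (row_of_point x)) =
    (-1) ^+ (\sum_j alpha j) * (symbol R alpha k * cint mud (fun x => chard k x * phi (row_of_point x))).
  rewrite (cint_chard_parts k d1 d2) !wave_coef_iterated_partial// prodN size_multi_index.
  rewrite -/(symbol R alpha k).
  under eq_cint do rewrite phiE.
  rewrite (cint_chard_parts k c1 c2); ring.
rewrite -!/(cint mud _).
transitivity (cint mud (fun x => \sum_(k <- K) a k * (chard k x * classical_derivative alpha phi (row_of_point x)))).
  by apply: eq_cint => x; rewrite mulr_suml; apply: eq_bigr => k _; rewrite mulrA.
rewrite cint_sum; last by move=> k; exact: cintegrableZ.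
transitivity ((-1) ^+ (\sum_j alpha j) * cint mud (fun x => \sum_(k <- K) (a k * symbol R alpha k) * (chard k x * phi (row_of_point x)))); last first.
  congr (_ * _); apply: eq_cint => x; rewrite mulr_suml; apply: eq_bigr => k _; ring.
rewrite cint_sum; last by move=> k; exact: cintegrableZ.
rewrite mulr_sumr; apply: eq_bigr => k _; rewrite !cintZ// key; ring.
Qed.

End WeakDerivatives.

(** * Approximation numbers and mixed weights *)

Section ApproximationBounds.
Variables (R : realType) (d m : nat).
Local Notation RM := (measurableTypeR R).
Local Notation mud := (torus_measure R d).
Local Notation C := R[i].
Local Notation coef f k := (ip mud f (chard k)).
Local Notation V := ((2 * pi) ^+ d : R).
Local Notation freq := (d.-tuple int).
Implicit Types (f g : d.-tuple RM -> C) (k : freq) (K S : seq freq).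

Definition mix_weight k : R := \prod_(j < d) \sum_(a < m.+1) ((tnth k j)%:~R ^+ 2) ^+ a.

Lemma freq_weight_ge0 (alpha : 'I_d -> nat) k : 0 <= freq_weight R alpha k.
Proof. by apply: prodr_ge0 => j _; rewrite exprn_ge0 ?sqr_ge0. Qed.

(** Expanding the product gives one summand for each multi-index, matching the sum that defines
    [Hmix_norm]. *)
Lemma mix_weightE k :
  mix_weight k = \sum_(alpha : {ffun 'I_d -> 'I_m.+1}) freq_weight R (fun j => alpha j) k.
Proof. by rewrite /mix_weight bigA_distr_bigA. Qed.

Lemma mix_weight_ge1 k : 1 <= mix_weight k.
Proof.
rewrite /mix_weight; elim/big_ind: _ => // [x y x1 y1|j _].
  by rewrite -[1]mulr1 ler_pM.
rewrite big_ord_recl expr0 lerDl; apply: sumr_ge0 => a _.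
by rewrite exprn_ge0 ?sqr_ge0.
Qed.

Lemma mix_weight_ge0 k : 0 <= mix_weight k.
Proof. by rewrite (le_trans _ (mix_weight_ge1 k)). Qed.

Lemma V_gt0 : 0 < V. Proof. exact: twopiX_gt0. Qed.

Lemma L2normE f : L2norm f = Num.sqrt (nrm2 mud f). Proof. by []. Qed.

Lemma L2_derivativeP f (alpha : 'I_d -> nat) : Hmix m f -> (forall j, (alpha j <= m)%N) ->
  L2f mud (L2_derivative alpha f) /\ distributional_derivative alpha f (L2_derivative alpha f).
Proof.
move=> [hf hd] ha; have [g hg1 hg2] := hd alpha ha.
exact: (@xgetPex _ (fun=> 0) [set g | L2 g /\ distributional_derivative alpha f g] (ex_intro _ g (conj hg1 hg2))).
Qed.

Lemma Hmix_L2 f : Hmix m f -> L2f mud f. Proof. by case. Qed.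

Lemma sqr_Hmix_norm f : Hmix_norm m f ^+ 2 =
  \sum_(alpha : {ffun 'I_d -> 'I_m.+1}) nrm2 mud (L2_derivative (fun j => alpha j) f).
Proof.
rewrite /Hmix_norm sqr_sqrtr; last by apply: sumr_ge0 => alpha _; exact: sqr_ge0.
by apply: eq_bigr => alpha _; rewrite L2normE sqr_sqrtr ?nrm2_ge0.
Qed.

Lemma Hmix_norm_ge0 f : 0 <= Hmix_norm m f. Proof. exact: sqrtr_ge0. Qed.

(** Bessel's inequality for each derivative, summed over the multi-indices; the chosen
    [L2_derivative] enters only through its coefficients. *)
Lemma Hmix_bessel f K : Hmix m f -> uniq K ->
  \sum_(k <- K) mix_weight k * sqn (coef f k) <= V * Hmix_norm m f ^+ 2.
Proof.
move=> hf uK; rewrite sqr_Hmix_norm mulr_sumr.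
under eq_bigr => k _ do rewrite mix_weightE mulr_suml.
rewrite exchange_big /=; apply: ler_sum => alpha _.
have [h1 h2] := L2_derivativeP hf (fun j => leq_ord (alpha j)).
under eq_bigr => k _ do rewrite -(ip_distributional_derivative k (Hmix_L2 hf) h2).
exact: bessel_torus.
Qed.

Lemma sum_support K S (F : freq -> R) : uniq K -> uniq S -> (forall k, 0 <= F k) ->
  (forall k, k \notin S -> F k = 0) -> \sum_(k <- K) F k <= \sum_(k <- S) F k.
Proof.
move=> uK uS F0 FS.
rewrite (bigID (fun k => k \in S)) /= [X in _ + X]big1 ?addr0; last by move=> k /FS.
rewrite -big_filter; set K' := [seq k <- K | k \in S].
rewrite [leRHS](bigID (fun k => k \in K')) /=.
have -> : \sum_(k <- S | k \in K') F k = \sum_(k <- K') F k.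
  rewrite -big_filter; apply: perm_big; apply: uniq_perm.
  - exact: filter_uniq.
  - exact: filter_uniq.
  by move=> k; rewrite mem_filter /K' !mem_filter; case: (k \in S); rewrite ?andbF ?andbT.
by rewrite lerDl; apply: sumr_ge0.
Qed.

(** When the spectrum of [f] lies in [S], so does that of every derivative, and Parseval reduces
    each norm to a finite sum. *)
Lemma Hmix_parseval f S : Hmix m f -> uniq S -> (forall k, k \notin S -> coef f k = 0) ->
  V * Hmix_norm m f ^+ 2 <= \sum_(k <- S) mix_weight k * sqn (coef f k).
Proof.
move=> hf uS fS; rewrite sqr_Hmix_norm mulr_sumr.
under [leRHS]eq_bigr => k _ do rewrite mix_weightE mulr_suml.
rewrite [leRHS]exchange_big /=; apply: ler_sum => alpha _.
have [h1 h2] := L2_derivativeP hf (fun j => leq_ord (alpha j)).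
apply: parseval_torus => // K uK.
under [leLHS]eq_bigr => k _ do rewrite (ip_distributional_derivative k (Hmix_L2 hf) h2).
apply: sum_support => // k; first by rewrite mulr_ge0 ?freq_weight_ge0 ?sqn_ge0.
by move=> /fS ->; rewrite sqn0 mulr0.
Qed.

Definition trigp S (a : freq -> C) : d.-tuple RM -> C := fun x => \sum_(k <- S) a k * chard k x.

Lemma trigp_L2 S a : L2f mud (trigp S a).
Proof. by apply: L2f_sum => k; apply: L2fZ; exact: chard_L2. Qed.

Lemma coef_trigp S a k : uniq S -> coef (trigp S a) k = if k \in S then V%:C * a k else 0.
Proof.
move=> uS; rewrite ip_suml; last 2 first.
- by move=> l; apply: L2fZ; exact: chard_L2.
- exact: chard_L2.
rewrite (eq_bigr (fun l => if l == k then V%:C * a k else 0)); last first.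
  move=> l _; rewrite ipZl; [|exact: chard_L2|exact: chard_L2].
  by rewrite ip_chard; case: eqP => [->|]; rewrite ?mulr0// mulrC.
have [kS|kS] := boolP (k \in S); last first.
  rewrite big_seq big1// => l lS; rewrite ifN//.
  by apply: contraNneq kS => <-.
rewrite (bigD1_seq k)//= eqxx big1 ?addr0// => l lk.
by rewrite (negbTE lk).
Qed.

Theorem approximation_number_le S n (b : R) : uniq S -> (size S < n)%N -> 0 <= b ->
  (forall k, k \notin S -> 1 <= b ^+ 2 * mix_weight k) ->
  (@approximation_number_embedding R d m n <= b%:E)%E.
Proof.
move=> uS Sn b0 hb.
(* The orthogonal projection onto the characters of [S]: its rank is at most [size S], and [f - A f]
   keeps exactly the coefficients outside [S]. *)
pose A f : d.-tuple RM -> C := trigp S (fun k => (V^-1)%:C * coef f k).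
have Vinv (z : C) : V%:C * ((V^-1)%:C * z) = z.
  rewrite mulrA (_ : V%:C * (V^-1)%:C = 1) ?mul1r//.
  by rewrite -rmorphM divff// lt0r_neq0// V_gt0.
have AL2 f : L2f mud (A f) by exact: trigp_L2.
have coefA f k : coef (A f) k = if k \in S then coef f k else 0.
  by rewrite coef_trigp// Vinv.
have pY0 : L2norm (0 : d.-tuple RM -> C) = 0.
  by rewrite L2normE nrm2E; under eq_Rintegral do rewrite sqn0; rewrite Rintegral_cst// mul0r sqrtr0.
apply: (@le_trans _ _ (operator_norm (Hmix m) (Hmix_norm m) (@L2norm R d) (fun f : d.-tuple RM -> C => f - A f))).
  apply: ereal_inf_lbound; exists A => //; split.
    split.
    - by move=> f _; exact: AL2.
    - move=> a f g /Hmix_L2 hf /Hmix_L2 hg.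
      have hc k : coef (a *: f + g) k = a * coef f k + coef g k.
        rewrite -ipZl//; last exact: chard_L2.
        by rewrite -ipDl//; [exact: L2fZ|exact: chard_L2].
      rewrite (_ : _ - _ = 0)//; apply/funext => x.
      change (A (a *: f + g) x - (a * A f x + A g x) = 0).
      rewrite /A /trigp mulr_sumr -big_split /= -sumrB big1// => k _.
      rewrite hc; ring.
    - exists 1 => // f hf; rewrite mul1r L2normE -(ger0_norm (Hmix_norm_ge0 f)) -sqrtr_sqr.
      rewrite ler_sqrt ?sqr_ge0// -(ler_pM2l V_gt0).
      apply: parseval_torus => // K uK; apply: le_trans (Hmix_bessel hf uK).
      apply: ler_sum => k _; rewrite coefA; case: ifP => _.
        by rewrite ler_peMl ?sqn_ge0// mix_weight_ge1.
      by rewrite sqn0 mulr_ge0 ?sqn_ge0 ?mix_weight_ge0.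
  exists (size S) => //; exists (fun i => chard (tnth (in_tuple S) i)).
    by move=> i; exact: chard_L2.
  move=> f hf; exists (fun i => (V^-1)%:C * coef f (tnth (in_tuple S) i)).
  rewrite (_ : _ - _ = 0)//; apply/funext => x.
  transitivity (A f x - (\sum_(i < size S) ((V^-1)%:C * coef f (tnth (in_tuple S) i)) *: (chard (tnth (in_tuple S) i) : d.-tuple RM -> C)) x) => //.
  rewrite fct_sumE /A /trigp big_tnth subrr//.
apply: ge_ereal_sup => _ [f [hf f1] <-]; rewrite lee_fin L2normE.
have hfA : L2f mud (f - A f) by apply: L2fB => //; exact: Hmix_L2.
rewrite -(ger0_norm b0) -sqrtr_sqr ler_sqrt ?sqr_ge0// -(ler_pM2l V_gt0).
apply: parseval_torus => // K uK.
apply: (@le_trans _ _ (\sum_(k <- K) b ^+ 2 * (mix_weight k * sqn (coef f k)))).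
  apply: ler_sum => k _.
  have -> : coef (f - A f) k = coef f k - coef (A f) k.
    by rewrite -ipBl//; [exact: Hmix_L2|exact: chard_L2].
  rewrite coefA; case: ifPn => kS.
    by rewrite subrr sqn0 !mulr_ge0 ?sqr_ge0 ?mix_weight_ge0 ?sqn_ge0.
  by rewrite subr0 mulrA ler_peMl ?sqn_ge0// hb.
rewrite -mulr_sumr mulrC ler_wpM2r ?sqr_ge0//.
apply: (le_trans (Hmix_bessel hf uK)).
by rewrite ler_piMr ?(ltW V_gt0)// expr_le1// Hmix_norm_ge0.
Qed.

Lemma trigp_Hmix S a : Hmix m (trigp S a).
Proof.
split; first exact: trigp_L2.
move=> alpha _; exists (fun x => \sum_(k <- S) a k * (symbol R alpha k * chard k x)).
  by apply: L2f_sum => k; apply: L2fZ; apply: L2fZ; exact: chard_L2.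
exact: distributional_derivative_trig.
Qed.

Definition null f := L2f mud f /\ nrm2 mud f = 0.

Lemma nullD f g : null f -> null g -> null (f + g).
Proof.
move=> [f1 f2] [g1 g2]; split; first exact: L2fD.
apply/eqP; rewrite eq_le nrm2_ge0 andbT.
by apply: (le_trans (nrm2D_le f1 g1)); rewrite f2 g2 !mulr0 addr0.
Qed.
Lemma nullZ a f : null f -> null (a *: f).
Proof.
move=> [f1 f2]; split; first exact: L2fZ.
by have := nrm2Z a f1; rewrite f2 mulr0.
Qed.
Lemma null0 : null 0.
Proof.
split; first exact: L2f0.
by rewrite nrm2E; under eq_Rintegral do rewrite sqn0; rewrite Rintegral_cst// mul0r.
Qed.
Lemma null_sum (I : Type) (s : seq I) (F : I -> d.-tuple RM -> C) :
  (forall i, null (F i)) -> null (\sum_(i <- s) F i).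
Proof. by move=> h; elim/big_ind: _ => //; [exact: null0|exact: nullD]. Qed.
Lemma L2norm_null f : L2f mud f -> L2norm f = 0 -> null f.
Proof.
move=> hf; rewrite L2normE => /eqP; rewrite sqrtr_eq0 => h; split=> //.
by apply/eqP; rewrite eq_le h nrm2_ge0.
Qed.

Lemma trigpE S a : trigp S a = \sum_(k <- S) a k *: (chard k : d.-tuple RM -> C).
Proof. by apply/funext => x; rewrite fct_sumE. Qed.

(** [A] respects linear combinations only up to null functions, so the errors are accumulated term
    by term and stay null. *)
Lemma operator_trigp (A : (d.-tuple RM -> C) -> d.-tuple RM -> C) S a :
  bounded_linear_operator (Hmix m) (Hmix_norm m) (@L2 R d) (@L2norm R d) A ->
  null (A (trigp S a) - \sum_(k <- S) a k *: A (trigp [:: k] (fun=> 1))).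
Proof.
move=> [A1 A2 _].
have hk k : trigp [:: k] (fun=> 1) = chard k.
  by apply/funext => x; rewrite /trigp big_seq1 mul1r.
have hA s b : L2f mud (A (trigp s b)) by apply: A1; exact: trigp_Hmix.
have h0 : trigp [::] a = 0 by rewrite trigpE big_nil.
have H0 : Hmix m (0 : d.-tuple RM -> C) by rewrite -h0; exact: trigp_Hmix.
elim: S => [|k S IH].
  rewrite big_nil subr0 h0.
  have hA0 : L2f mud (A 0) by rewrite -h0; exact: hA.
  (* Linearity at 1 * 0 + 0 leaves - A 0, so [A 0] is null. *)
  have : null (A (1 *: 0 + 0) - (1 *: A 0 + A 0)).
    apply: L2norm_null; last exact: A2.
    by rewrite scaler0 addr0 scale1r; apply: L2fB => //; exact: L2fD.
  rewrite scaler0 addr0 scale1r opprD addNKr => /(nullZ (-1)).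
  by rewrite scaleN1r opprK.
have ktr : trigp (k :: S) a = a k *: trigp [:: k] (fun=> 1) + trigp S a.
  by rewrite hk !trigpE big_cons.
have lin : null (A (trigp (k :: S) a) - (a k *: A (trigp [:: k] (fun=> 1)) + A (trigp S a))).
  apply: L2norm_null; last by rewrite ktr; apply: A2; exact: trigp_Hmix.
  by apply: L2fB => //; apply: L2fD => //; exact: L2fZ.
have telescope (U : zmodType) (x b c e : U) : (x - (b + c)) + (c - e) = x - (b + e).
  by rewrite !opprD !addrA subrK.
by have := nullD lin IH; rewrite big_cons telescope.
Qed.

(** Every [A] of rank below n kills, up to a null function, some nonzero combination f of the
    characters of [S]; for such f the ratio of the L2 norm to the mixed norm is at least 1 / W. *)
Theorem approximation_number_ge S n (W : R) : uniq S -> (n <= size S)%N -> 0 < W ->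
  (forall k, k \in S -> mix_weight k <= W ^+ 2) ->
  (W^-1%:E <= @approximation_number_embedding R d m n)%E.
Proof.
move=> uS nS W0 hW; apply: le_ereal_inf_tmp => _ [A [hA [r rn [e he hr]]] <-].
have [A1 _ _] := hA.
have Hk k : Hmix m (trigp [:: k] (fun=> 1)) by exact: trigp_Hmix.
pose c k : 'I_r -> C := projT1 (cid (hr _ (Hk k))).
have hc k : null (A (trigp [:: k] (fun=> 1)) - \sum_(i < r) c k i *: e i).
  apply: L2norm_null; last exact: (projT2 (cid (hr _ (Hk k)))).
  apply: L2fB; first exact: A1.
  rewrite (_ : \sum_(i < r) _ = (fun x => \sum_(i < r) c k i * e i x)); last first.
    by apply/funext => x; rewrite fct_sumE.
  by apply: L2f_sum => i; apply: L2fZ; exact: he.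
pose s := size S.
pose Cm : 'M[C]_(s, r) := \matrix_(i, j) c (tnth (in_tuple S) i) j.
(* Row i holds the coordinates of the image of the i-th character; with more rows than columns, as r
   < n <= s, the rows are linearly dependent. *)
have : kermx Cm != 0.
  rewrite -mxrank_eq0 mxrank_ker subn_eq0 -ltnNge.
  by rewrite (leq_ltn_trans (rank_leq_col Cm))// (leq_trans rn nS).
move=> /rowV0Pn[v /sub_kermxP vC v0].
(* Carries the kernel vector from positions in [S] to frequencies, with value 0 outside [S]. *)
pose a0 k : C := if insub (index k S) is Some i then v ord0 i else 0.
have a0E i : a0 (tnth (in_tuple S) i) = v ord0 i.
  rewrite /a0 (tnth_nth (tnth (in_tuple S) i)) index_uniq// ?ltn_ord//.
  by rewrite insubT ?ltn_ord// => h; congr (v _ _); exact: val_inj.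
have nn : 0 < nrm2 mud (trigp S a0).
  have [i vi] : exists i, v ord0 i != 0.
    apply/existsP; rewrite -negb_forall; apply: contra v0 => /forallP h.
    by apply/eqP/rowP => i; rewrite mxE; exact/eqP.
  have hb := bessel_torus (trigp_L2 S a0) (isT : uniq [:: tnth (in_tuple S) i]).
  move: hb; rewrite big_seq1 coef_trigp// mem_tnth a0E sqnM sqn_real => hb.
  rewrite -(pmulr_rgt0 _ V_gt0); apply: lt_le_trans hb.
  by rewrite mulr_gt0 ?sqn_gt0// exprn_gt0 ?V_gt0.
(* Scales the polynomial to L2 norm 1 / W, so that its mixed norm is at most 1 by the bound on the
   weights. *)
pose t := (W * Num.sqrt (nrm2 mud (trigp S a0)))^-1.
have t0 : 0 < t by rewrite invr_gt0 mulr_gt0// sqrtr_gt0.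
pose a k := t%:C * a0 k; pose f := trigp S a.
have fE : f = (fun x => t%:C * trigp S a0 x).
  by apply/funext => x; rewrite /f /trigp mulr_sumr; apply: eq_bigr => k _; rewrite mulrA.
have fL2 : L2f mud f by exact: trigp_L2.
have nf : nrm2 mud f = (W^-1) ^+ 2.
  rewrite fE nrm2Z ?sqn_real; last exact: trigp_L2.
  rewrite /t invfM exprMn -mulrA [X in _ * (X * _)]exprVn sqr_sqrtr ?nrm2_ge0//.
  by rewrite mulVf ?mulr1// lt0r_neq0.
have fH : Hmix m f by exact: trigp_Hmix.
have Af : null (A f).
  have h1 : null (\sum_(k <- S) a k *: (A (trigp [:: k] (fun=> 1)) - \sum_(i < r) c k i *: e i)).
    by apply: null_sum => k; exact: nullZ.
  have h2 := nullD (operator_trigp S a hA) h1.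
  suff hz : \sum_(k <- S) a k *: (\sum_(i < r) c k i *: e i) = 0.
    move: h2; under [X in _ + X]eq_bigr do rewrite scalerBr.
    by rewrite sumrB hz subr0 subrK.
  under eq_bigr => k _ do rewrite scaler_sumr.
  rewrite exchange_big /= big1// => i _.
  under eq_bigr => k _ do rewrite scalerA.
  rewrite -scaler_suml big_tnth.
  have : (v *m Cm) ord0 i = 0 by rewrite vC mxE.
  rewrite mxE => hv.
  under eq_bigr => j _ do rewrite /a a0E -mulrA.
  rewrite -mulr_sumr (eq_bigr (fun j => v ord0 j * Cm j i)) ?hv ?mulr0 ?scale0r// => j _.
  by rewrite mxE.
apply: ereal_sup_ubound; exists f; last first.
  congr EFin; rewrite L2normE (nrm2_eq0_sub fL2 Af.1 Af.2) nf sqrtr_sqr ger0_norm//.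
  by rewrite invr_ge0 ltW.
split => //.
rewrite -(ger0_norm (Hmix_norm_ge0 f)) -sqrtr_sqr -sqrtr1 ler_sqrt//.
rewrite -(ler_pM2l V_gt0).
apply: (le_trans (Hmix_parseval fH uS _)).
  by move=> k kS; rewrite coef_trigp// (negbTE kS).
apply: (@le_trans _ _ (\sum_(k <- S) W ^+ 2 * sqn (coef f k))).
  by rewrite big_seq [leRHS]big_seq; apply: ler_sum => k kS; rewrite ler_wpM2r ?sqn_ge0// hW.
rewrite -mulr_sumr.
apply: (@le_trans _ _ (W ^+ 2 * (V * nrm2 mud f))).
  by rewrite ler_wpM2l ?sqr_ge0// bessel_torus.
by rewrite nf mulrCA -exprMn mulfV ?expr1n// lt0r_neq0.
Qed.

End ApproximationBounds.

(** * Counting in the hyperbolic cross *)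

Section HyperbolicCross.
Local Open Scope nat_scope.

Definition int_range (N : nat) : seq int :=
  0%R :: flatten [seq [:: Posz n; (- Posz n)%R] | n <- iota 1 N].

Lemma mem_int_range N (k : int) : (k \in int_range N) = (`|k| <= N)%N.
Proof.
rewrite inE; apply/orP/idP => [[/eqP -> //|/flattenP[s /mapP[n]]]|kN].
  rewrite mem_iota => /andP[n1 nN] ->; rewrite !inE => /orP[] /eqP ->; lia.
have [->|k0] := eqVneq k 0%R; [by left|right].
apply/flattenP; exists [:: Posz `|k|%N; (- Posz `|k|%N)%R].
  by apply/mapP; exists `|k|%N => //; rewrite mem_iota; lia.
rewrite !inE; case: k k0 kN => n k0 kN; lia.
Qed.

Lemma uniq_int_range N : uniq (int_range N).
Proof.
rewrite /int_range /=; apply/andP; split.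
  apply/negP => /flattenP[s /mapP[n]]; rewrite mem_iota => /andP[n1 _] ->.
  rewrite !inE; lia.
suff H m : 0 < m -> uniq (flatten [seq [:: Posz n; (- Posz n)%R] | n <- iota m N]) by exact: H.
elim: N m => //= N IH n n0; rewrite !inE IH// andbT.
have h (z : int) : `|z|%N = n -> z \notin flatten [seq [:: Posz n0; (- Posz n0)%R] | n0 <- iota n.+1 N].
  move=> zn; apply/negP => /flattenP[s /mapP[l]]; rewrite mem_iota => /andP[ln _] ->.
  rewrite !inE; lia.
rewrite negb_or !h ?abszN ?absz_nat// !andbT; lia.
Qed.

Lemma big_int_range N (F : nat -> nat) :
  \sum_(k <- int_range N) F `|k|%N = F 0 + 2 * \sum_(1 <= n < N.+1) F n.
Proof.
rewrite /int_range big_cons; congr (_ + _).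
rewrite big_flatten big_map /= /index_iota subn1 /= big_distrr /=.
apply: eq_bigr => n _; rewrite !big_cons big_nil addn0 mul2n -addnn; congr (_ + F _); lia.
Qed.

Definition freq_size d (k : d.-tuple int) : nat := \prod_(j < d) (absz (tnth k j)).+1.

(** The condition (1 + |k|) q <= N on the remaining product q means q <= N %/ (1 + |k|), which gives
    the recursion. The slices at |k| = N > 0 have bound 0 and are empty, as is every cross of bound
    0. *)
Fixpoint hyp_cross d (N : nat) : seq (d.-tuple int) :=
  if d is d'.+1 then
    [seq [tuple of k :: (t : d'.-tuple int)] | k <- int_range N, t <- hyp_cross d' (N %/ (absz k).+1)]
  else if N == 0 then [::] else [:: [tuple]].

Lemma hyp_crossS d N : hyp_cross d.+1 N =
  [seq [tuple of k :: (t : d.-tuple int)] | k <- int_range N, t <- hyp_cross d (N %/ (absz k).+1)].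
Proof. by []. Qed.

Lemma freq_size_cons d (k : int) (t : d.-tuple int) :
  freq_size [tuple of k :: t] = (absz k).+1 * freq_size t.
Proof.
rewrite /freq_size big_ord_recl tnth0; congr (_ * _).
by apply: eq_bigr => j _; rewrite tnthS.
Qed.

Lemma freq_size_gt0 d (k : d.-tuple int) : 0 < freq_size k.
Proof. by apply: prodn_gt0. Qed.

Lemma mem_hyp_cross d N (k : d.-tuple int) : (k \in hyp_cross d N) = (freq_size k <= N).
Proof.
elim: d N k => [|d IH] N k.
  rewrite /freq_size big_ord0 [k]tuple0; case: N => //= N.
case/tupleP: k => k0 k; rewrite freq_size_cons hyp_crossS.
apply/flatten_mapP/idP => [[l lN /mapP[t tN e]]|h].
  have [-> ->] : k0 = l /\ k = t.
    by move: e => /(congr1 val) [-> /val_inj ->].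
  by move: tN; rewrite IH leq_divRL// mulnC.
exists k0; last by apply/mapP; exists k => //; rewrite IH leq_divRL// mulnC.
rewrite mem_int_range; have := freq_size_gt0 k; nia.
Qed.

Lemma uniq_hyp_cross d N : uniq (hyp_cross d N).
Proof.
elim: d N => [|d IH] N; first by rewrite /=; case: ifP.
rewrite hyp_crossS; apply: allpairs_uniq_dep => //; first exact: uniq_int_range.
by move=> [x y] [x' y'] _ _ /= /(congr1 val) [-> /val_inj ->].
Qed.

Definition cross_card d N := size (hyp_cross d N).

Lemma cross_card0 N : cross_card 0 N = (0 < N).
Proof. by rewrite /cross_card /=; case: N. Qed.

Lemma cross_card_at0 d : cross_card d 0 = 0.
Proof.
rewrite /cross_card; case: (hyp_cross d 0) (@mem_hyp_cross d 0) => // k s /(_ k).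
by rewrite mem_head leqNgt freq_size_gt0.
Qed.

Lemma cross_cardS d N : cross_card d.+1 N =
  cross_card d N + 2 * \sum_(1 <= n < N.+1) cross_card d (N %/ n.+1).
Proof.
rewrite /cross_card hyp_crossS size_allpairs_dep sumnE big_map.
rewrite (@big_int_range N (fun n => size (hyp_cross d (N %/ n.+1)))).
by rewrite divn1.
Qed.

(* number of [l]-tuples of integers [>= 2] with product at most [N] *)
Fixpoint proper_card l N : nat :=
  if l is l'.+1 then \sum_(1 <= n < N.+1) proper_card l' (N %/ n.+1) else (0 < N).

(** Here l counts the nonzero coordinates: C(d,l) positions, 2^l signs, and factors 1 + |k_j| >= 2.
    The induction is Pascal's rule. *)
Lemma cross_card_proper d N : cross_card d N =
  \sum_(l < d.+1) 'C(d, l) * 2 ^ l * proper_card l N.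
Proof.
elim: d N => [|d IH] N; first by rewrite cross_card0 big_ord1 bin0 !mul1n.
rewrite cross_cardS IH.
under eq_bigr do rewrite IH.
rewrite exchange_big big_distrr.
have -> : \sum_(l < d.+1) 'C(d, l) * 2 ^ l * proper_card l N =
    \sum_(l < d.+2) 'C(d, l) * 2 ^ l * proper_card l N.
  by rewrite [RHS]big_ord_recr /= bin_small// !mul0n addn0.
rewrite big_ord_recl [RHS]big_ord_recl !bin0 -addnA; congr (_ + _).
rewrite -big_split; apply: eq_bigr => l _ /=.
rewrite -big_distrr /= /bump add1n binS expnS.
move: (\sum_(1 <= n < N.+1) proper_card l (N %/ n.+1)) => X; ring.
Qed.

Lemma proper_cardS l N : proper_card l.+1 N = \sum_(1 <= n < N.+1) proper_card l (N %/ n.+1).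
Proof. by []. Qed.

Lemma proper_card_at0 l : proper_card l 0 = 0.
Proof. by case: l => [|l] //=; rewrite big_geq. Qed.

End HyperbolicCross.

(** * Counting bounds by powers of the logarithm *)

Section CrossBounds.
Variable R : realType.
Implicit Types (a b x : R).

(** With [subX_ge], a mean value inequality for powers: it compares a power of the logarithm with a
    difference of next higher powers, which telescopes. *)
Lemma subX_le a b n : 0 <= b -> b <= a ->
  a ^+ n.+1 - b ^+ n.+1 <= n.+1%:R * (a - b) * a ^+ n.
Proof.
move=> b0 ba; have a0 := le_trans b0 ba.
elim: n => [|n IH]; first by rewrite !expr1 expr0 mulr1 mul1r.
have h : (a - b) * b ^+ n.+1 <= (a - b) * a ^+ n.+1.
  by rewrite ler_wpM2l ?subr_ge0// lerXn2r.
have := ler_wpM2l a0 IH; rewrite !exprS in h *; rewrite -[n.+2%:R]natr1; lra.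
Qed.

Lemma subX_ge a b n : 0 <= b -> b <= a ->
  n.+1%:R * (a - b) * b ^+ n <= a ^+ n.+1 - b ^+ n.+1.
Proof.
move=> b0 ba; have a0 := le_trans b0 ba.
elim: n => [|n IH]; first by rewrite !expr1 expr0 mulr1 mul1r.
have h : (a - b) * b ^+ n.+1 <= (a - b) * a ^+ n.+1.
  by rewrite ler_wpM2l ?subr_ge0// lerXn2r.
have := ler_wpM2l b0 IH; rewrite !exprS in h *; rewrite -[n.+2%:R]natr1; lra.
Qed.

Lemma ln_succ_ge n : (0 < n)%N -> n.+1%:R^-1 <= ln n.+1%:R - ln n%:R :> R.
Proof.
move=> n0; have n0' : 0 < n%:R :> R by rewrite ltr0n.
have := @le_ln1Dx R (- n.+1%:R^-1).
have -> : 1 + - n.+1%:R^-1 = n%:R / n.+1%:R :> R.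
  by rewrite -natr1; field; rewrite natr1 pnatr_eq0.
rewrite ln_div ?posrE// => h.
have h1 : -1 < - n.+1%:R^-1 :> R by rewrite ltrN2 invf_lt1// ltr1n ltnS.
by rewrite -lerN2 opprB h.
Qed.

Lemma ln_succ_le n : (0 < n)%N -> ln n.+1%:R - ln n%:R <= n%:R^-1 :> R.
Proof.
move=> n0; have n0' : 0 < n%:R :> R by rewrite ltr0n.
have := @le_ln1Dx R (n%:R^-1).
have -> : 1 + n%:R^-1 = n.+1%:R / n%:R :> R by rewrite -natr1; field; rewrite lt0r_neq0.
rewrite ln_div ?posrE//; apply.
by rewrite (lt_trans _ (_ : 0 < _)) ?invr_gt0//.
Qed.

(** The induction step is the discrete form of integrating ln(N/t)^l / t from 1 to N, where the
    decreasing integrand dominates the sum over the points n + 1. *)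
Lemma proper_card_le l N : (0 < N)%N ->
  (proper_card l.+1 N)%:R <= N%:R * ln N%:R ^+ l / l`!%:R :> R.
Proof.
elim: l N => [|l IH] N N0.
  rewrite expr0 fact0 divr1 mulr1 ler_nat /=.
  rewrite (@leq_trans (\sum_(1 <= n < N.+1) 1))//; first by apply: leq_sum => n _; case: (0 < _)%N.
  by rewrite sum_nat_const_nat subn1 muln1.
(* Up to sign an antiderivative of the integrand at n; [term] bounds one summand by its decrease
   from n to n + 1. *)
pose g n : R := ln (N%:R / n%:R) ^+ l.+1 / l.+1`!%:R.
have term n : (0 < n)%N -> (n < N)%N ->
    (proper_card l.+1 (N %/ n.+1))%:R <= N%:R * (g n - g n.+1).
  move=> n0 nN.
  have q0 : (0 < N %/ n.+1)%N by rewrite divn_gt0.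
  apply: (le_trans (IH _ q0)).
  have n0' : 0 < n%:R :> R by rewrite ltr0n.
  have N0' : 0 < N%:R :> R by rewrite ltr0n.
  have qle : (N %/ n.+1)%:R <= N%:R / n.+1%:R :> R.
    by rewrite ler_pdivlMr// -natrM ler_nat leq_trunc_div.
  have q1 : 1 <= (N %/ n.+1)%:R :> R by rewrite ler1n.
  pose a : R := ln (N%:R / n%:R); pose b : R := ln (N%:R / n.+1%:R).
  have ab : n.+1%:R^-1 <= a - b.
    rewrite /a /b !ln_div ?posrE//; have := ln_succ_ge n0.
    by move: (n.+1%:R^-1) (ln n.+1%:R) (ln n%:R) (ln N%:R) => *; lra.
  have b0 : 0 <= b by rewrite ln_ge0// (le_trans q1).
  have nn : 0 <= n.+1%:R^-1 :> R by [].
  have qb : ln (N %/ n.+1)%:R <= b by rewrite ler_ln// posrE ?ltr0n// divr_gt0.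
  have := @subX_ge a b l b0 _; rewrite -subr_ge0 (le_trans nn ab) => /(_ isT) h.
  apply: (@le_trans _ _ (N%:R / n.+1%:R * b ^+ l / l`!%:R)).
    have lq0 : 0 <= ln (N %/ n.+1)%:R :> R by exact: ln_ge0.
    rewrite ler_wpM2r ?invr_ge0// ler_pM ?exprn_ge0//.
    by apply: lerXn2r; rewrite ?nnegrE.
  have -> : g n - g n.+1 = (a ^+ l.+1 - b ^+ l.+1) / l.+1%:R * l`!%:R^-1.
    by rewrite /g -mulrBl factS natrM invfM mulrA.
  rewrite mulrA ler_wpM2r ?invr_ge0// -mulrA ler_wpM2l// ler_pdivlMr//.
  apply: le_trans h; rewrite mulrC mulrA ler_wpM2r ?exprn_ge0//.
  by rewrite ler_wpM2l.
(* The summand n = N vanishes because N %/ (N+1) = 0. *)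
have -> : proper_card l.+2 N = (\sum_(1 <= n < N) proper_card l.+1 (N %/ n.+1))%N.
  by rewrite proper_cardS big_nat_recr// (divn_small (ltnSn N)) proper_card_at0; exact: addn0.
rewrite natr_sum.
have : \sum_(1 <= n < N) (proper_card l.+1 (N %/ n.+1))%:R <= \sum_(1 <= n < N) N%:R * (g n - g n.+1).
  by rewrite big_nat [leRHS]big_nat; apply: ler_sum => n /andP[n1 nN]; exact: term.
move/le_trans; apply; rewrite -mulr_sumr -mulrA ler_wpM2l//.
have -> : \sum_(1 <= i < N) (g i - g i.+1) = g 1%N - g N.
  rewrite -[g 1%N - g N]opprB -(telescope_sumr g N0) -sumrN.
  by apply: eq_bigr => n _; rewrite opprB.
rewrite /g divff ?pnatr_eq0 -?lt0n// ln1 expr0n /= mul0r subr0 divr1//.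
Qed.

End CrossBounds.

Section CrossCardBounds.
Variable R : realType.
Implicit Types (a b x r L : R).

(** The ratio L / (l+1) of consecutive terms is at least 1 as long as l < e <= L. *)
Lemma powfact_mono L e l : 0 <= L -> e%:R <= L -> (l <= e)%N ->
  L ^+ l / l`!%:R <= L ^+ e / e`!%:R.
Proof.
move=> L0; elim: e => [|e IH] eL; first by rewrite leqn0 => /eqP->.
rewrite leq_eqVlt => /predU1P[->//|le].
have eL' : e%:R <= L by rewrite (le_trans _ eL)// ler_nat.
apply: (le_trans (IH eL' le)).
rewrite exprS factS natrM invfM mulrACA ler_peMl ?divr_ge0 ?exprn_ge0//.
by rewrite ler_pdivlMr// mul1r.
Qed.

Lemma sum_bin_pow2 d : \sum_(l < d) ('C(d, l.+1) * 2 ^ l.+1)%:R = 3 ^+ d - 1 :> R.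
Proof.
have -> : 3 = 1 + 2 :> R by ring.
rewrite exprDn big_ord_recl /= subn0 expr1n mul1r expr0 bin0 mulr1n addrC addKr.
by apply: eq_bigr => l _; rewrite expr1n mul1r /bump add1n natrM natrX mulr_natl.
Qed.

(** The origin gives the summand 1. The bound [L] stands in for ln N, which may drop below [e],
    where the monotonicity in l used here fails. *)
Lemma cross_card_le e N L : (0 < N)%N -> ln N%:R <= L -> e%:R <= L ->
  (cross_card e.+1 N)%:R <= 1 + (3 ^+ e.+1 - 1) * (N%:R * (L ^+ e / e`!%:R)).
Proof.
move=> N0 lnL eL; have L0 : 0 <= L by exact: le_trans eL.
rewrite cross_card_proper big_ord_recl bin0 expn0 !mul1n [proper_card _ _]/= N0.
rewrite natrD lerD2l natr_sum -sum_bin_pow2 mulr_suml.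
apply: ler_sum => l _; rewrite natrM ler_wpM2l//.
apply: (le_trans (proper_card_le R l N0)); rewrite -mulrA ler_wpM2l//.
apply: (@le_trans _ _ (L ^+ l / l`!%:R)).
  by rewrite ler_wpM2r// lerXn2r// ?nnegrE// ln_ge0// ler1n.
by apply: powfact_mono => //; rewrite -ltnS.
Qed.

(** A real parameter [r] below N + 1 replaces [N], so that the floors in N %/ (n+1) lose nothing
    from one dimension to the next. The telescoping sum starts at 2, whence one ln 2 for each
    step. *)
Lemma cross_card_ge d N r : 0 < r -> r < N%:R + 1 -> 0 <= ln r - ln 6 - d%:R * ln 2 ->
  3 / 4 * 2 ^+ d.+1 * r * ((ln r - ln 6 - d%:R * ln 2) ^+ d / d`!%:R) <= (cross_card d.+1 N)%:R.
Proof.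
elim: d N r => [|d IH] N r r0 rN T0.
  rewrite expr0 fact0 divr1 mulr1 expr1.
  (* In dimension one the cross has 2N - 1 > 2r - 3 points, and 2r - 3 >= 3r/2 exactly from r = 6
     on; this is the origin of ln 6. *)
  have r6 : 6 <= r by rewrite -ler_ln ?posrE//; move: T0; rewrite mul0r subr0 subr_ge0.
  have N0 : (0 < N)%N by rewrite -(ltr_nat R); lra.
  rewrite cross_cardS cross_card0 N0.
  have h : (N.-1 <= \sum_(1 <= n < N.+1) cross_card 0 (N %/ n.+1))%N.
    rewrite big_nat_recr//= (@leq_trans (\sum_(1 <= n < N) 1))//.
      by rewrite sum_nat_const_nat muln1 subn1.
    apply: (@leq_trans (\sum_(1 <= n < N) cross_card 0 (N %/ n.+1)) _ _ _ (leq_addr _ _)).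
    by rewrite big_nat [leqRHS]big_nat; apply: leq_sum => n /andP[n1 nN]; rewrite cross_card0 divn_gt0 ?nN.
  rewrite natrD natrM.
  have : (N.-1)%:R <= (\sum_(1 <= n < N.+1) cross_card 0 (N %/ n.+1))%:R :> R by rewrite ler_nat.
  have : N%:R = N.-1%:R + 1 :> R by rewrite natr1 prednK.
  move: rN; change (nat_of_bool true) with 1%N.
  move: (N%:R : R) (N.-1%:R : R) ((\sum_(1 <= n < N.+1) cross_card 0 (N %/ n.+1))%:R : R).
  by move=> u v w; lra.
pose T n := ln r - ln n%:R - ln 6 - d%:R * ln 2 : R.
(* Truncation at 0 covers the indices where the induction hypothesis does not apply, since the
   claimed bound is nonpositive there, and makes the last telescoping term vanish. *)
pose a n : R := Num.max 0 (T n).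
pose G n := a n ^+ d.+1 / d.+1`!%:R.
have a0 n : 0 <= a n by rewrite /a le_max lexx.
have l2 : 0 <= ln 2 :> R by rewrite ln_ge0// ler1n.
have term n : (0 < n)%N -> 3 / 4 * 2 ^+ d.+1 * r * (G n.+1 - G n.+2) <= (cross_card d.+1 (N %/ n.+1))%:R.
  move=> n0; have n0' : 0 < n.+1%:R :> R by rewrite ltr0n.
  have K0 : 0 <= 3 / 4 * 2 ^+ d.+1 * r by rewrite !mulr_ge0// ?exprn_ge0// ltW.
  have [Tn|Tn] := leP 0 (T n.+1); last first.
    have aE : a n.+1 = 0 by rewrite /a max_l// ltW.
    have hG : G n.+1 - G n.+2 <= 0.
      by rewrite subr_le0 /G aE expr0n /= mul0r divr_ge0// exprn_ge0.
    apply: (@le_trans _ _ 0) => //; exact: mulr_ge0_le0.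
  have aE : a n.+1 = T n.+1 by rewrite /a max_r.
  have q0 : 0 < r / n.+1%:R by rewrite divr_gt0.
  (* The condition r < N + 1 is inherited because N + 1 <= (N %/ (n+1) + 1) (n+1). *)
  have qN : r / n.+1%:R < (N %/ n.+1)%:R + 1.
    rewrite ltr_pdivrMr// (lt_le_trans rN)// natr1 natr1 -natrM ler_nat.
    by rewrite ltn_ceil.
  have qT : ln (r / n.+1%:R) - ln 6 - d%:R * ln 2 = T n.+1 by rewrite ln_div ?posrE.
  have := IH _ _ q0 qN; rewrite qT => /(_ Tn); apply: le_trans.
  have -> : 3 / 4 * 2 ^+ d.+1 * (r / n.+1%:R) * (T n.+1 ^+ d / d`!%:R) =
    3 / 4 * 2 ^+ d.+1 * r * (n.+1%:R^-1 * T n.+1 ^+ d * d`!%:R^-1) by ring.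
  rewrite ler_wpM2l//.
  have -> : G n.+1 - G n.+2 = (a n.+1 ^+ d.+1 - a n.+2 ^+ d.+1) / d.+1%:R * d`!%:R^-1.
    by rewrite /G -mulrBl factS natrM invfM mulrA.
  rewrite ler_wpM2r ?invr_ge0// ler_pdivrMr//.
  have aa : T n.+1 - n.+1%:R^-1 <= a n.+2.
    rewrite /a le_max; apply/orP; right; have := ln_succ_le R (ltn0Sn n); rewrite /T.
    by move: (n.+1%:R^-1) (ln n.+1%:R) (ln n.+2%:R) (ln r) (ln 6) (d%:R * ln 2) => *; lra.
  have ba : a n.+2 <= a n.+1.
    rewrite {1}/a ge_max a0 /= /a le_max; apply/orP; right; rewrite /T; have : ln n.+1%:R <= ln n.+2%:R :> R by rewrite ler_ln ?posrE// ler_nat.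
    by move: (ln n.+1%:R) (ln n.+2%:R) (ln r) (ln 6) (d%:R * ln 2) => *; lra.
  apply: (le_trans (subX_le d (a0 _) ba)); rewrite aE.
  rewrite [leRHS]mulrC mulrA ler_wpM2r ?exprn_ge0// ler_wpM2l//.
  by move: aa; move: (n.+1%:R^-1) (T n.+1) (a n.+2) => *; lra.
have sumG : \sum_(1 <= n < N.+1) (G n.+1 - G n.+2) = G 2%N.
  have h := telescope_sumr (fun n => G n.+1) (ltn0Sn N).
  have GN : G N.+2 = 0.
    rewrite /G /a max_l ?expr0n ?mul0r// /T.
    have h1 : ln r <= ln N.+2%:R.
      rewrite ler_ln ?posrE// (le_trans (ltW rN))// natr1 ler_nat//.
    have h6 : 0 <= ln 6 :> R by rewrite ln_ge0// ler1n.
    have hd : 0 <= d%:R * ln 2 :> R by rewrite mulr_ge0.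
    by move: (ln N.+2%:R) (ln r) (ln 6) (d%:R * ln 2) h1 h6 hd => *; lra.
  rewrite (_ : G 2%N = - (G N.+2 - G 2%N)); last by rewrite GN sub0r opprK.
  rewrite -h -sumrN.
  by apply: eq_bigr => n _; rewrite opprB.
rewrite cross_cardS natrD natrM natr_sum.
have hs : 3 / 4 * 2 ^+ d.+1 * r * G 2%N <= \sum_(1 <= n < N.+1) (cross_card d.+1 (N %/ n.+1))%:R.
  rewrite -sumG mulr_sumr big_nat [leRHS]big_nat.
  by apply: ler_sum => n /andP[n1 _]; exact: term.
have T2 : ln r - ln 6 - d.+1%:R * ln 2 = T 2%N.
  by rewrite /T -natr1; ring.
have G2 : G 2%N = (ln r - ln 6 - d.+1%:R * ln 2) ^+ d.+1 / d.+1`!%:R.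
  by rewrite /G /a max_r -?T2.
rewrite -G2 exprS.
have c0 : 0 <= (cross_card d.+1 N)%:R :> R by [].
move: hs c0; move: (2 ^+ d.+1) (G 2%N) (\sum_(1 <= n < N.+1) _) (cross_card d.+1 N)%:R => P g S c hs c0.
have -> : 3 / 4 * (2 * P) * r * g = 2 * (3 / 4 * P * r * g) by ring.
lra.
Qed.

End CrossCardBounds.

(** * The two bounds *)

Section Weights.
Variable R : realType.

Lemma sum_pow_le (y : R) m : 0 <= y -> \sum_(a < m.+1) y ^+ a <= (1 + y) ^+ m.
Proof.
move=> y0; elim: m => [|m IH]; first by rewrite big_ord1 !expr0.
rewrite big_ord_recl expr0 exprS mulrDl mul1r lerD//.
  by rewrite exprn_ege1// lerDl.
under eq_bigr => a _ do rewrite lift0 exprS.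
by rewrite -mulr_sumr ler_wpM2l.
Qed.

Lemma power_mean_two (y : R) m : 0 <= y -> 2 * (1 + y) ^+ m.+1 <= 2 ^+ m.+1 * (1 + y ^+ m.+1).
Proof.
move=> y0; elim: m => [|m IH]; first by rewrite !expr1.
have y1 : 0 <= 1 + y by lra.
(* Both factors have the same sign; expanded, this says that y + y^(m+1) <= 1 + y^(m+2), which is
   what the induction step requires. *)
have hprod : 0 <= (1 - y) * (1 - y ^+ m.+1).
  have [y_le1|y_gt1] := leP y 1.
    by rewrite mulr_ge0// subr_ge0// exprn_ile1.
  by rewrite mulr_le0// subr_le0 ?(ltW y_gt1)// exprn_ege1// ltW.
rewrite exprSr mulrA (le_trans (ler_wpM2r y1 IH))//.
rewrite [2 ^+ m.+2]exprSr -!mulrA ler_wpM2l ?exprn_ge0//.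
move: hprod; rewrite [y ^+ m.+2]exprS; lra.
Qed.

Lemma sqr_intr (k : int) : (k%:~R : R) ^+ 2 = (absz k)%:R ^+ 2.
Proof. by rewrite natr_absz intr_norm real_normK// num_real. Qed.

Lemma mix_weight_le d m (k : d.-tuple int) :
  mix_weight R m k <= ((freq_size k)%:R ^+ m) ^+ 2.
Proof.
rewrite /mix_weight /freq_size natr_prod -!prodrXl; apply: ler_prod => j _.
rewrite sumr_ge0 => [/=|a _]; last by rewrite exprn_ge0 ?sqr_ge0.
rewrite sqr_intr (le_trans (sum_pow_le m (sqr_ge0 _)))//.
rewrite -exprM mulnC exprM lerXn2r ?nnegrE ?addr_ge0 ?sqr_ge0//.
by rewrite -natr1; have : 0 <= (absz (tnth k j))%:R :> R by []; nra.
Qed.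

(** In each coordinate (1 + |k|)^(2m) <= 2^m (1 + k^2)^m <= 2^(2m-1) (1 + k^(2m)). The power 2m - 1
    instead of 2m saves a factor 2 per coordinate, the source of 2^(-d/2) in the upper bound. *)
Lemma mix_weight_ge d m (k : d.-tuple int) : (0 < m)%N ->
  2 ^+ d * ((freq_size k)%:R ^+ m) ^+ 2 <= ((2 ^+ m) ^+ 2) ^+ d * mix_weight R m k.
Proof.
case: m => // m _; rewrite /mix_weight /freq_size natr_prod -!prodrXl.
rewrite -[X in X ^+ d]/(_ : R) -{1}(card_ord d) -[X in _ <= _ ^+ X * _](card_ord d).
rewrite -!prodr_const -!big_split /=; apply: ler_prod => j _.
rewrite !mulr_ge0 ?exprn_ge0//= sqr_intr.
set x : R := (absz (tnth k j))%:R; have x0 : 0 <= x by [].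
(* Only the two extreme exponents of the sum are kept; they are distinct because the order is
   positive. *)
apply: (@le_trans _ _ ((2 ^+ m.+1) ^+ 2 * (1 + (x ^+ 2) ^+ m.+1))); last first.
  rewrite ler_wpM2l ?sqr_ge0// big_ord_recl big_ord_recr expr0 lerD2l lift0.
  by rewrite lerDr; apply: sumr_ge0 => a _; rewrite exprn_ge0 ?sqr_ge0.
have h1 := power_mean_two m (sqr_ge0 x).
rewrite -[(absz (tnth k j)).+1%:R]natr1 -/x.
have h2 : ((x + 1) ^+ m.+1) ^+ 2 <= 2 ^+ m.+1 * (1 + x ^+ 2) ^+ m.+1.
  rewrite -exprM mulnC exprM -exprMn lerXn2r ?nnegrE ?mulr_ge0 ?addr_ge0 ?sqr_ge0//.
  by have := sqr_ge0 (x - 1); lra.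
have p0 : 0 <= 2 ^+ m.+1 :> R by rewrite exprn_ge0.
rewrite [(2 ^+ m.+1) ^+ 2]expr2 -mulrA (le_trans _ (ler_wpM2l p0 h1))//.
by rewrite [leRHS]mulrCA ler_wpM2l.
Qed.

End Weights.

(** * Numerical estimates and rounding *)

Section Numerics.
Variable R : realType.

(** The logarithmic form of d! >= (d/e)^d; its d ln d compensates the ln d contained in ln L in the
    lower bound. *)
Lemma ln_fact_ge d : d%:R * ln d%:R - d%:R <= ln d`!%:R :> R.
Proof.
elim: d => [|d IH]; first by rewrite fact0 ln1 mul0r subrr.
rewrite factS natrM lnM ?posrE ?ltr0n ?fact_gt0//.
case: d IH => [|d] IH; first by rewrite fact0 ln1 mulr0; lra.
have h := ln_succ_le R (ltn0Sn d).
have d0 : 0 < d.+1%:R :> R by [].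
have h2 : d.+1%:R * (ln d.+2%:R - ln d.+1%:R) <= 1 :> R.
  by rewrite mulrC -ler_pdivlMr// mul1r.
have -> : d.+2%:R * ln d.+2%:R - d.+2%:R = (d.+1%:R + 1) * ln d.+2%:R - (d.+1%:R + 1) :> R.
  by rewrite natr1.
move: IH h2; set A := ln (_`!)%:R; set B := ln d.+2%:R; set C := ln d.+1%:R; lra.
Qed.

Lemma ln12_ge2 : 2 <= ln 12 :> R.
Proof.
rewrite -[2](@expRK R) ler_ln ?posrE ?expR_gt0//.
(* From e^(-1/4) >= 3/4; the eighth power gives e^2 <= (4/3)^8 < 12. *)
have h : expR (4^-1) <= 4 / 3 :> R.
  have := expR_ge1Dx (- 4^-1 : R); rewrite expRN => h.
  have e0 : 0 < expR (4^-1) :> R by exact: expR_gt0.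
  have h3 := ler_wpM2r (ltW e0) h; rewrite mulVf ?lt0r_neq0// in h3; lra.
have -> : expR 2 = expR (4^-1) ^+ 8 :> R.
  by rewrite -expRM_natl; congr expR; field.
apply: (@le_trans _ _ ((4 / 3) ^+ 8)).
  by rewrite lerXn2r ?nnegrE ?expR_ge0.
lra.
Qed.

Lemma ln27_ge1 : 1 <= ln 27 :> R.
Proof.
have := ln12_ge2; have : ln 12 <= ln 27 :> R by rewrite ler_ln ?posrE//; lra.
lra.
Qed.

(** Rounding for the upper bound: N < r keeps the count strictly below n, and frequencies outside
    the cross have size at least N + 1 >= r. The lower bound rounds the other way, by
    [nat_floor_approx]. *)
Lemma nat_pred_approx (x : R) : 0 < x -> exists N : nat, N%:R < x /\ x <= N%:R + 1.
Proof.
move=> x0.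
have ex : exists n : nat, x <= n%:R.
  exists (Num.truncn x).+1; have /andP[_ h] := truncn_itv (ltW x0).
  exact: ltW h.
case: (ex_minnP ex) => [[|n] xn hmin]; first by move: xn; rewrite leNgt x0.
exists n; rewrite natr1; split => //.
by rewrite ltNge; apply/negP => /hmin; rewrite ltnn.
Qed.

Lemma nat_floor_approx (x : R) : 0 < x -> exists N : nat, N%:R <= x /\ x < N%:R + 1.
Proof.
move=> x0; exists (Num.truncn x); have /andP[h1 h2] := truncn_itv (ltW x0).
by rewrite natr1.
Qed.

End Numerics.

Section MainBounds.
Variable R : realType.

Lemma ln_nat_ge_dim d n : (27 ^ d <= n)%N -> d%:R <= ln n%:R :> R.
Proof.
move=> dn; have n0 : (0 < n)%N by rewrite (leq_trans _ dn)// expn_gt0.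
have : ln ((27 ^+ d) : R) <= ln n%:R.
  by rewrite ler_ln ?posrE ?exprn_gt0 ?ltr0n// -natrX ler_nat.
apply: le_trans; rewrite lnXn// -[leRHS]mulr_natl ler_peMr//.
exact: ln27_ge1.
Qed.

Lemma fact_le_pow (L : R) e : e%:R <= L -> e`!%:R <= L ^+ e.
Proof.
elim: e => [|e IH] eL; first by rewrite fact0 expr0.
have L0 : 0 <= L by exact: le_trans eL.
rewrite factS natrM exprS ler_pM// IH// (le_trans _ eL)// ler_nat//.
Qed.

(** The count is at most 1 + (3^d - 1) N Q < 1 + n - n / 3^d with d = e + 1, and n >= 3^d absorbs
    the 1. Since Q >= 1, r <= n and ln N stays below L. *)
Lemma cross_card_lt e n (r L Q : R) N : (27 ^ e.+1 <= n)%N -> L = ln n%:R ->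
  Q = L ^+ e / e`!%:R -> r = n%:R / (3 ^+ e.+1 * Q) -> N%:R < r ->
  (cross_card e.+1 N < n)%N.
Proof.
move=> dn LE QE rE Nr.
have n0 : (0 < n)%N by rewrite (leq_trans _ dn)// expn_gt0.
have dL : e.+1%:R <= L by rewrite LE; exact: ln_nat_ge_dim.
have eL : e%:R <= L by rewrite (le_trans _ dL)// ler_nat.
have L0 : 0 < L by rewrite (lt_le_trans _ dL).
have Q1 : 1 <= Q by rewrite QE ler_pdivlMr ?mul1r ?ltr0n ?fact_gt0// fact_le_pow.
have Q0 : 0 < Q by rewrite (lt_le_trans _ Q1).
have t1 : 1 < 3 ^+ e.+1 :> R by rewrite exprn_egt1// ltr1n.
have t0 : 0 < 3 ^+ e.+1 :> R by rewrite exprn_gt0.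
case: (posnP N) => [->|N0].
  by rewrite cross_card_at0.
have n3 : 3 ^+ e.+1 <= n%:R :> R.
  by rewrite -natrX ler_nat (leq_trans _ dn)// leq_exp2r.
have rn : r <= n%:R.
  rewrite rE ler_pdivrMr ?mulr_gt0// ler_peMr// (le_trans (ltW t1))//.
  by rewrite ler_peMr// ltW.
have lnN : ln N%:R <= L.
  by rewrite LE ler_ln ?posrE ?ltr0n//; exact: le_trans (ltW Nr) rn.
have h := cross_card_le N0 lnN eL; rewrite -QE in h.
have h2 : N%:R * Q < n%:R / 3 ^+ e.+1.
  move: Nr; rewrite rE ltr_pdivlMr ?mulr_gt0// => h3.
  by rewrite ltr_pdivlMr// -mulrA [Q * _]mulrC.
have h4 : 1 <= n%:R / 3 ^+ e.+1 :> R by rewrite ler_pdivlMr ?mul1r.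
rewrite -(ltr_nat R) (le_lt_trans h)//.
have : (3 ^+ e.+1 - 1) * (N%:R * Q) < (3 ^+ e.+1 - 1) * (n%:R / 3 ^+ e.+1).
  by rewrite ltr_pM2l// subr_gt0.
have -> : (3 ^+ e.+1 - 1) * (n%:R / 3 ^+ e.+1) = n%:R - n%:R / 3 ^+ e.+1 :> R by field; rewrite lt0r_neq0.
lra.
Qed.

Lemma powR_half_sqr d : (2 `^ (- (d%:R / 2)) : R) ^+ 2 = (2 ^+ d)^-1.
Proof.
by rewrite powRN exprVn -powR_mulrn ?powR_ge0// -powRrM divfK ?powR_mulrn.
Qed.

Theorem upper_bound (m d n : nat) : (0 < m)%N -> (0 < d)%N -> (27 ^ d <= n)%N ->
  (@approximation_number_embedding R d m n <=
    ((6 ^+ d / (d.-1)`!%:R) ^+ m * 2 `^ (- (d%:R / 2)) *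
      (ln n%:R ^+ (d.-1 * m) / n%:R ^+ m))%:E)%E.
Proof.
case: d => // e m0 _ dn; rewrite succnK.
have n0 : (0 < n)%N by rewrite (leq_trans _ dn)// expn_gt0.
pose L : R := ln n%:R; rewrite -/L.
have dL : e.+1%:R <= L by exact: ln_nat_ge_dim.
have L0 : 0 < L by rewrite (lt_le_trans _ dL).
pose Q := L ^+ e / e`!%:R; pose r := n%:R / (3 ^+ e.+1 * Q).
have f0 : 0 < e`!%:R :> R by rewrite ltr0n fact_gt0.
have Q0 : 0 < Q by rewrite divr_gt0// exprn_gt0.
have nR : 0 < n%:R :> R by rewrite ltr0n.
have r0 : 0 < r by rewrite divr_gt0// mulr_gt0// exprn_gt0.
have [N [Nr rN]] := nat_pred_approx r0.
have t0 : 0 < 3 ^+ e.+1 :> R by rewrite exprn_gt0.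
(* The 3^d in 6^d comes from the count, through [r], and the 2^d from the weight comparison. *)
have bE : (6 ^+ e.+1 / e`!%:R) ^+ m * 2 `^ (- (e.+1%:R / 2)) * (L ^+ (e * m) / n%:R ^+ m) =
    (2 ^+ e.+1 / r) ^+ m * 2 `^ (- (e.+1%:R / 2)).
  rewrite mulrAC; congr (_ * _); rewrite exprM -expr_div_n -exprMn; congr (_ ^+ _).
  rewrite /r /Q (_ : 6 = 2 * 3 :> R); last by ring.
  by rewrite exprMn; field; rewrite !lt0r_neq0// exprn_gt0.
rewrite bE.
apply: (approximation_number_le (uniq_hyp_cross e.+1 N)).
- exact: (cross_card_lt dn erefl erefl erefl Nr).
- by rewrite mulr_ge0 ?powR_ge0// exprn_ge0// divr_ge0 ?exprn_ge0// ltW.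
move=> k; rewrite mem_hyp_cross -ltnNge => Nk.
have rk : r <= (freq_size k)%:R by rewrite (le_trans rN)// natr1 ler_nat.
rewrite exprMn powR_half_sqr.
set P : R := ((2 ^+ m) ^+ 2) ^+ e.+1.
have P0 : 0 < P by rewrite !exprn_gt0.
have D0 : 0 < 2 ^+ e.+1 :> R by rewrite exprn_gt0.
rewrite -(ler_pM2l P0) mulr1.
have hw := mix_weight_ge R k m0; rewrite -/P in hw.
have c0 : 0 <= ((2 ^+ e.+1 / r) ^+ m) ^+ 2 / 2 ^+ e.+1.
  by rewrite divr_ge0 ?sqr_ge0// ltW.
rewrite [leRHS]mulrCA; apply: le_trans (ler_wpM2l c0 hw).
have -> : ((2 ^+ e.+1 / r) ^+ m) ^+ 2 / 2 ^+ e.+1 * (2 ^+ e.+1 * ((freq_size k)%:R ^+ m) ^+ 2) =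
    P * (((freq_size k)%:R / r) ^+ m) ^+ 2.
  rewrite mulrA divfK ?lt0r_neq0//.
  have -> : P = ((2 ^+ e.+1) ^+ m) ^+ 2 by rewrite /P -!exprM; congr (_ ^+ _); ring.
  by rewrite -!exprMn; congr ((_ ^+ _) ^+ _); rewrite mulrA mulrAC.
rewrite ler_peMr ?(ltW P0)// exprn_ege1// exprn_ege1//.
by rewrite ler_pdivlMr// mul1r.
Qed.

Theorem lower_bound (m d n : nat) : (0 < d)%N ->
  (12 * expR 1 ^+ 2) ^+ d < n%:R :> R ->
  (((3 * 2 ^+ d / (d`!%:R * (2 + ln 12) ^+ d)) ^+ m *
      (ln n%:R ^+ (d.-1 * m) / n%:R ^+ m))%:E <=
    @approximation_number_embedding R d m n)%E.
Proof.
case: d => // e _ hn; rewrite succnK; pose d := e.+1.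
pose L : R := ln n%:R; rewrite -/L.
pose c : R := 2 + ln 12; rewrite -/c.
have l12 := ln12_ge2 R.
have c4 : 4 <= c by rewrite /c; lra.
have d1 : 1 <= d%:R :> R by rewrite ler1n.
have nR : 0 < n%:R :> R.
  by apply: lt_trans hn; rewrite exprn_gt0// mulr_gt0// exprn_gt0// expR_gt0.
(* This is the hypothesis on n after taking logarithms, since ln(12 e^2) = 2 + ln 12 = c. *)
have Ldc : d%:R * c < L.
  have : ln ((12 * expR 1 ^+ 2) ^+ d) < L.
    by rewrite ltr_ln// posrE// exprn_gt0// mulr_gt0// exprn_gt0// expR_gt0.
  rewrite lnXn ?mulr_gt0 ?exprn_gt0 ?expR_gt0//.
  rewrite lnM ?posrE ?exprn_gt0 ?expR_gt0// lnXn ?expR_gt0// expRK.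
  by rewrite -[(_ + _) *+ _]mulr_natl /c addrC.
have c0 : 0 < c by lra.
have L0 : 0 < L by apply: lt_trans Ldc; rewrite mulr_gt0//; lra.
have f0 : 0 < d`!%:R :> R by rewrite ltr0n fact_gt0.
have d0 : 0 < d%:R :> R by lra.
(* Chosen so that r^(-m) is the bound to be proved. *)
pose r := n%:R * (d`!%:R * c ^+ d) / (3 * 2 ^+ d * L ^+ e).
have r0 : 0 < r by rewrite divr_gt0 ?mulr_gt0 ?exprn_gt0.
have [N [Nr rN]] := nat_floor_approx r0.
pose T := ln r - ln 6 - e%:R * ln 2.
(* Write L = d c t with t >= 1, so L / c = d t. The losses 2d ln 2 + ln 3 are at most d ln 12, paid
   by the ln 12 in c; of the remaining 2 d t, one half is the target and the other covers the d from
   the factorial and (d-1) ln t <= (d-1)(t-1). *)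
have TL : L / c <= T.
  have [t t1 LE] : exists2 t, 1 <= t & L = d%:R * c * t.
    exists (L / (d%:R * c)); first by rewrite ler_pdivlMr ?mulr_gt0// mul1r ltW.
    by rewrite mulrC divfK// lt0r_neq0// mulr_gt0.
  have t0 : 0 < t by lra.
  have LcE : L / c = d%:R * t by rewrite LE; field; rewrite lt0r_neq0.
  have lnt : ln t <= t - 1.
    by rewrite [X in ln X](_ : t = 1 + (t - 1)); [apply: le_ln1Dx; lra|ring].
  have lnL : ln L = ln d%:R + ln c + ln t.
    by rewrite LE !lnM ?posrE ?mulr_gt0.
  have ln6 : ln 6 = ln 2 + ln 3 :> R by rewrite -lnM ?posrE//; congr ln; ring.
  have l12E : ln 12 = 2 * ln 2 + ln 3 :> R.
    rewrite (_ : 12 = 2 * 2 * 3); last by ring.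
    by rewrite lnM ?posrE// lnM ?posrE//; ring.
  have lnr : ln r = L + (ln d`!%:R + d%:R * ln c) - (ln 3 + d%:R * ln 2 + e%:R * ln L).
    rewrite /r ln_div ?posrE ?mulr_gt0 ?exprn_gt0// !lnM ?posrE ?mulr_gt0 ?exprn_gt0//.
    by rewrite !lnXn// !mulr_natl.
  have hf := ln_fact_ge R d.
  have hd : e%:R = d%:R - 1 :> R by rewrite /d -natr1 addrK.
  have lc : ln 3 <= ln c by rewrite ler_ln ?posrE//; lra.
  have ld : 0 <= ln d%:R :> R by rewrite ln_ge0.
  have l2 : 0 <= ln 2 :> R by rewrite ln_ge0// ler1n.
  have l3 : 0 <= ln 3 :> R by rewrite ln_ge0// ler1n.
  have h1 : (d%:R - 1) * ln t <= (d%:R - 1) * (t - 1) by rewrite ler_wpM2l//; lra.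
  have h2 : d%:R * 1 <= d%:R * t by rewrite ler_pM2l.
  have h3 : d%:R * ln 12 * 1 <= d%:R * ln 12 * t by rewrite ler_pM2l// mulr_gt0//; lra.
  have h4 : 1 * ln 3 <= d%:R * ln 3 :> R by rewrite ler_wpM2r.
  rewrite LcE /T lnr lnL ln6 hd {1}LE.
  move: (ln c) lc => lc lc3; rewrite /c; move: hf ld l2 l3 h1 h2 h3 h4; rewrite l12E.
  move: (ln d`!%:R) (ln d%:R) (ln t) (ln 2) (ln 3) lc3 => F ld lt l2 l3; lra.
have T0 : 0 <= T by rewrite (le_trans _ TL)// divr_ge0// ltW.
have hc := cross_card_ge r0 rN T0; rewrite -/T -/d in hc.
have nS : (n <= cross_card d N)%N.
  rewrite -(ler_nat R) (le_trans _ hc)//.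
  (* With T replaced by L / c the powers of L cancel and the count becomes n times d c / 4, at least
     n because c >= 4. *)
  apply: (@le_trans _ _ (3 / 4 * 2 ^+ d * r * ((L / c) ^+ e / e`!%:R))).
    have e0 : 0 < e`!%:R :> R by rewrite ltr0n fact_gt0.
    have -> : 3 / 4 * 2 ^+ d * r * ((L / c) ^+ e / e`!%:R) = n%:R * (d%:R * c / 4).
      rewrite /r /d factS natrM expr_div_n [c ^+ _]exprS.
      have : c ^+ e != 0 by rewrite lt0r_neq0// exprn_gt0.
      have : L ^+ e != 0 by rewrite lt0r_neq0// exprn_gt0.
      have : 2 ^+ e.+1 != 0 :> R by rewrite lt0r_neq0// exprn_gt0.
      move: (c ^+ e) (L ^+ e) (2 ^+ e.+1 : R) => C K P C0 K0 P0.
      by field; rewrite C0 K0 P0 lt0r_neq0.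
    by rewrite ler_peMr ?(ltW nR)// ler_pdivlMr// mul1r (le_trans c4)// ler_peMl// (ltW c0).
  rewrite ler_wpM2l//.
    by apply: mulr_ge0; [rewrite mulr_ge0 ?exprn_ge0|exact: ltW].
  have Lc0 : 0 <= L / c by apply: divr_ge0; apply: ltW.
  by rewrite ler_wpM2r ?invr_ge0// lerXn2r ?nnegrE.
have N0 : (0 < N)%N.
  rewrite lt0n; apply: contraTneq nS => ->.
  by rewrite cross_card_at0 -ltnNge -(ltr_nat R).
have NR : 0 < N%:R :> R by rewrite ltr0n.
apply: (@le_trans _ _ ((N%:R ^+ m)^-1)%:E).
  rewrite lee_fin.
  have -> : (3 * 2 ^+ e.+1 / ((e.+1)`!%:R * c ^+ e.+1)) ^+ m * (L ^+ (e * m) / n%:R ^+ m) = (r ^+ m)^-1.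
    rewrite exprM -expr_div_n -exprMn -exprVn; congr (_ ^+ _).
    by rewrite /r -/d; field; rewrite !lt0r_neq0// exprn_gt0.
  by rewrite lef_pV2 ?posrE ?exprn_gt0// lerXn2r// nnegrE ?(ltW r0) ?(ltW NR).
apply: (@approximation_number_ge R e.+1 m _ n (N%:R ^+ m) (uniq_hyp_cross e.+1 N)) => //; first by rewrite exprn_gt0.
move=> k; rewrite mem_hyp_cross => kN.
apply: (le_trans (mix_weight_le R m k)).
by rewrite lerXn2r ?nnegrE ?exprn_ge0// lerXn2r ?nnegrE// ler_nat.
Qed.

End MainBounds.

Theorem theorem4p21 (R : realType) (m d n : nat)
    (m_gt0 : (0 < m)%N) (d_gt0 : (0 < d)%N) (n_gt0 : (0 < n)%N) :
  ((27 ^ d <= n)%N ->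
    (@approximation_number_embedding R d m n <=
      ((6 ^+ d / (d.-1)`!%:R) ^+ m * 2 `^ (- (d%:R / 2)) *
        (ln n%:R ^+ (d.-1 * m) / n%:R ^+ m))%:E)%E) /\
  ((12 * expR 1 ^+ 2) ^+ d < n%:R :> R ->
    (((3 * 2 ^+ d / (d`!%:R * (2 + ln 12) ^+ d)) ^+ m *
        (ln n%:R ^+ (d.-1 * m) / n%:R ^+ m))%:E <=
      @approximation_number_embedding R d m n)%E).
Proof. by split; [exact: upper_bound|exact: lower_bound]. Qed.
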